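(* Let $K,L$ be star bodies in $\mathbb{R}^n$, let $k$ be an integer with $0<k<n$, and let $\mu_1,\mu_2$ be measures on $\mathbb{R}^n$ with non-negative locally integrable densities $f$ and $g$ respectively, where $\|g\|_\infty=g(0)=1$. Suppose that $$\mu_1(K\cap H)\le \mu_2(L\cap H)\qquad\text{for all } H\in Gr_{n-k}.$$ Then $$\mu_1(K)\le \left(d_{\rm ovr}(K,\mathcal{BP}_k^n)\right)^k\, \frac{n}{n-k}\, |K|^{\frac kn}\left(\mu_2(L)\right)^{\frac{n-k}n}.$$
   Context: A closed bounded set $K\subset\mathbb{R}^n$ is a star body if every straight line through the origin crosses the boundary of $K$ at exactly two points different from the origin, the origin is an interior point of $K$, and the Minkowski functional $\|x\|_K=\min\{a\ge 0: x\in aK\}$ is continuous on $\mathbb{R}^n$. $|K|$ denotes volume (Lebesgue measure in the proper dimension). $Gr_{n-k}$ is the Grassmannian of $(n-k)$-dimensional linear subspaces of $\mathbb{R}^n$. If $\mu$ is the measure with density $f$, then $\mu(B)=\int_B f(x)\,dx$ for compact $B\subset\mathbb{R}^n$, and for $H\in Gr_{n-k}$, $\mu(B\cap H)=\int_{B\cap H} f(x)\,dx$, where the restriction of $f$ to $H$ is integrated with respect to Lebesgue measure on $H$. The spherical Radon transform $\mathcal{R}_{n-k}:C(S^{n-1})\to C(Gr_{n-k})$ is $\mathcal{R}_{n-k}h(H)=\int_{S^{n-1}\cap H}h(x)\,dx$ (integration with respect to the (unnormalized) surface measure on the sphere $S^{n-1}\cap H$). An origin-symmetric star body $D$ in $\mathbb{R}^n$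 is a generalized $k$-intersection body, written $D\in\mathcal{BP}_k^n$, if there is a finite non-negative Borel measure $\nu_D$ on $Gr_{n-k}$ such that for every $h\in C(S^{n-1})$ $$\int_{S^{n-1}}\|x\|_D^{-k}h(x)\,dx=\int_{Gr_{n-k}}\mathcal{R}_{n-k}h(H)\,d\nu_D(H).$$ The outer volume ratio distance is $$d_{\rm ovr}(K,\mathcal{BP}_k^n)=\inf\left\{\left(\frac{|D|}{|K|}\right)^{1/n}: K\subset D,\ D\in\mathcal{BP}_k^n\right\}.$$ *)

(* Defs.v *)
From HB Require Import structures.
From mathcomp Require Import all_boot all_order all_algebra.
From mathcomp Require Import all_classical all_reals all_analysis.

Set Implicit Arguments.
Unset Strict Implicit.
Unset Printing Implicit Defensive.

Import Order.TTheory GRing.Theory Num.Theory.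
Import numFieldNormedType.Exports.

Local Open Scope classical_set_scope.
Local Open Scope ring_scope.

Section borel_matrix.
Variables (R : realType) (m n : nat).

HB.instance Definition _ := @isMeasurable.Build
  (sigma_display (@open 'M[R]_(m, n))) 'M[R]_(m, n) <<s @open 'M[R]_(m, n) >>
  (@sigma_algebra0 _ setT _) (@sigma_algebraC _ _)
  (@sigma_algebra_bigcup _ setT _).

Lemma open_measurable_mx (U : set 'M[R]_(m, n)) : open U -> measurable U.
Proof. by move=> oU; apply: sub_sigma_algebra. Qed.

Lemma closed_measurable_mx (U : set 'M[R]_(m, n)) : closed U -> measurable U.
Proof.
move=> cU; rewrite -[U]setCK; apply: measurableC.
by apply: open_measurable_mx; exact: closed_openC.
Qed.

Lemma measurable_fun_mx d (T : measurableType d) (f : T -> 'M[R]_(m, n)) :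
  (forall U, open U -> measurable (f @^-1` U)) -> measurable_fun setT f.
Proof.
move=> mf; apply: (@measurability _ _ _ _ setT f (@open 'M[R]_(m, n))) => //.
by move=> _ [U oU <-]; rewrite setTI; exact: mf.
Qed.

End borel_matrix.

Section lebesgue.
Variable R : realType.
Local Notation T := (measurableTypeR R).

Section cons.
Variable n : nat.

Definition cons_pair (p : T * n.-tuple T) : n.+1.-tuple T :=
  [the n.+1.-tuple T of p.1 :: p.2].

Let measurable_cons_pair : measurable_fun setT cons_pair.
Proof. exact: measurable_cons. Qed.

HB.instance Definition _ := isMeasurableFun.Build _ _ _ _ cons_pair
  measurable_cons_pair.

Variable mu : {sigma_finite_measure set (n.-tuple T) -> \bar R}.

Definition lebesgue_cons : set (n.+1.-tuple T) -> \bar R :=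
  pushforward (lebesgue_measure \x mu)%E cons_pair.

Let lebesgue_cons0 : lebesgue_cons set0 = 0%E.
Proof. exact: measure0. Qed.

Let lebesgue_cons_ge0 A : (0 <= lebesgue_cons A)%E.
Proof. exact: measure_ge0. Qed.

Let lebesgue_cons_sigma_additive : semi_sigma_additive lebesgue_cons.
Proof. exact: measure_semi_sigma_additive. Qed.

HB.instance Definition _ := isMeasure.Build _ _ _ lebesgue_cons
  lebesgue_cons0 lebesgue_cons_ge0 lebesgue_cons_sigma_additive.

Let lebesgue_cons_sigma_finite : sigma_finite setT lebesgue_cons.
Proof.
have /sigma_finiteP[F [TF ndF mF]] :=
  @sigma_finiteT _ _ _ (@lebesgue_measure R).
have /sigma_finiteP[G [TG ndG mG]] := sigma_finiteT mu.
pose u (t : n.+1.-tuple T) : T * n.-tuple T := (thead t, [tuple of behead t]).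
have mu_ : measurable_fun setT u.
  by apply/measurable_fun_pair; [exact: measurable_tnth|exact: measurable_behead].
exists (fun i => u @^-1` (F i `*` G i)).
  apply/seteqP; split => // t _.
  have [i _ Fi] : (\bigcup_i F i) (u t).1 by rewrite -TF.
  have [j _ Gj] : (\bigcup_i G i) (u t).2 by rewrite -TG.
  exists (maxn i j) => //; split.
    by move: Fi; apply/subsetPset/ndF/leq_maxl.
  by move: Gj; apply/subsetPset/ndG/leq_maxr.
move=> i; have [mFi Fioo] := mF i; have [mGi Gioo] := mG i.
split; first by rewrite -[X in measurable X]setTI; apply: mu_ => //; exact: measurableX.
rewrite /lebesgue_cons /pushforward -comp_preimage.
rewrite (_ : u \o cons_pair = id); last first.
  by apply/funext => -[x t]; congr pair; apply/val_inj.
by rewrite preimage_id product_measure1E// lte_mul_pinfty// ge0_fin_numE.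
Qed.

HB.instance Definition _ := Measure_isSigmaFinite.Build _ _ _ lebesgue_cons
  lebesgue_cons_sigma_finite.

End cons.

Fixpoint lebesgue_tuple (n : nat) :
    {sigma_finite_measure set (n.-tuple T) -> \bar R} :=
  if n is n'.+1 then lebesgue_cons (lebesgue_tuple n') else \d_[tuple].

Section row_of_tuple.
Variable n : nat.

Definition row_of_tuple (t : n.-tuple T) : 'rV[R]_n := \row_i tnth t i.

Let measurable_row_of_tuple : measurable_fun setT row_of_tuple.
Proof.
apply: measurable_fun_mx => U oU.
pose B (q : 'rV[rat]_n) (k : nat) : set 'rV[R]_n :=
  ball (map_mx ratr q : 'rV[R]_n) (k.+1%:R^-1 : R).
have mB q k : measurable (row_of_tuple @^-1` B q k).
  rewrite (_ : _ @^-1` _ = \bigcap_(i in [set: 'I_n])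
      ((fun t : n.-tuple T => tnth t i) @^-1`
        (ball (ratr (q 0 i) : R) (k.+1%:R^-1 : R)))).
    apply: fin_bigcap_measurable => // i _; rewrite -[X in measurable X]setTI.
    apply: measurable_tnth => //; rewrite ball_itv; exact: measurable_itv.
  apply/seteqP; split => [t [_ h] j _ | t h].
    by have := h ord0 j; rewrite !mxE.
  split=> [|i j]; first by rewrite invr_gt0.
  by have := h j I; rewrite /= !mxE ord1.
rewrite (_ : _ @^-1` U = \bigcup_(p : 'rV[rat]_n * nat)
   (if pselect (B p.1 p.2 `<=` U) then row_of_tuple @^-1` B p.1 p.2 else set0)).
  apply: countable_bigcupT_measurable => // p.
  by case: pselect => _ /=; [exact: mB|exact: measurable0].
apply/seteqP; split => [t /= Ut|t [[q k] _ /=]]; last by case: pselect => // s /s.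
have := oU; rewrite openE => /(_ _ Ut) /nbhs_ballP[e /= e0 eU].
have [k ke] : exists k : nat, k.+1%:R^-1 < e / 2.
  by have [k] := ltr_add_invr (divr_gt0 e0 (ltr0n R 2)); rewrite add0r; exists k.
have /choice[q hq] : forall i : 'I_n, exists q : rat,
    ball (tnth t i : R) (k.+1%:R^-1 : R) (ratr q).
  move=> i; have [|q] := @rat_in_itvoo R (tnth t i - k.+1%:R^-1)
    (tnth t i + k.+1%:R^-1).
    by rewrite ltrBlDr -addrA ltrDl addr_gt0// invr_gt0.
  by move=> qt; exists q; rewrite ball_itv.
exists (\row_i q i, k) => //=.
case: pselect => /= [_|[]].
  split; first by rewrite invr_gt0.
  by move=> i j; rewrite !mxE; apply: ball_sym; exact: hq.
move=> x [_ Bx]; apply: eU; split => // i j.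
rewrite (ord1 i) mxE; apply: (@ball_split R (R : pseudoMetricType R) (ratr (q j) : R)).
  exact: le_ball (ltW ke) _ (hq j).
by have := Bx 0 j; rewrite !mxE; apply: le_ball; exact: ltW.
Qed.

HB.instance Definition _ := isMeasurableFun.Build _ _ _ _ row_of_tuple
  measurable_row_of_tuple.

Definition lebesgue : set 'rV[R]_n -> \bar R :=
  pushforward (lebesgue_tuple n) row_of_tuple.

Let lebesgue0 : lebesgue set0 = 0%E.
Proof. exact: measure0. Qed.

Let lebesgue_ge0 A : (0 <= lebesgue A)%E.
Proof. exact: measure_ge0. Qed.

Let lebesgue_sigma_additive : semi_sigma_additive lebesgue.
Proof. exact: measure_semi_sigma_additive. Qed.

HB.instance Definition _ := isMeasure.Build _ _ _ lebesgue
  lebesgue0 lebesgue_ge0 lebesgue_sigma_additive.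

End row_of_tuple.

End lebesgue.

Section sphere.
Variables (R : realType) (n : nat).

Definition enorm (x : 'rV[R]_n) : R := Num.sqrt (\sum_i x 0 i ^+ 2).

Definition sphere : set 'rV[R]_n := [set x | enorm x = 1].

Definition eball : set 'rV[R]_n := [set x | enorm x <= 1].

Definition unit_vector (x : 'rV[R]_n) : 'rV[R]_n := (enorm x)^-1 *: x.

Lemma enorm_continuous : continuous enorm.
Proof.
move=> x; apply: (@continuous_comp _ _ _ (fun x : 'rV[R]_n => \sum_i x 0 i ^+ 2)
  (@Num.sqrt R)); last exact: sqrt_continuous.
apply: (@cvg_big _ _ _ _ _ _ _ (nbhs x)) => [|i _].
  exact: add_continuous.
apply: (@continuous_comp _ _ _ (fun x : 'rV[R]_n => x 0 i)
  (fun y : R => y ^+ 2)); first exact: coord_continuous.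
exact: exprn_continuous.
Qed.

Lemma enorm_eq0 x : (enorm x == 0) = (x == 0).
Proof.
rewrite sqrtr_eq0; apply/idP/eqP => [|->]; last first.
  by rewrite big1// => i _; rewrite mxE expr0n.
move=> s0; have : \sum_i x 0 i ^+ 2 == 0.
  by rewrite eq_le s0 sumr_ge0// => i _; exact: sqr_ge0.
rewrite psumr_eq0; last by move=> i _; exact: sqr_ge0.
move=> /allP h; apply/rowP => i; rewrite mxE; apply/eqP.
by rewrite -sqrf_eq0; apply: h; rewrite mem_index_enum.
Qed.

Lemma measurable_eball : measurable eball.
Proof.
apply: closed_measurable_mx.
apply: (@closed_comp _ _ enorm [set y | y <= 1]) => [x _|].
  exact: enorm_continuous.
exact: closed_le.
Qed.

Let measurable_unit_vector : measurable_fun setT unit_vector.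
Proof.
apply: measurable_fun_mx => U oU.
have c0 : closed [set (0 : 'rV[R]_n)].
  apply: accessible_closed_set1; apply: hausdorff_accessible.
  exact: (@norm_hausdorff R 'rV[R]_n).
rewrite (_ : _ @^-1` _ = ([set~ 0] `&` unit_vector @^-1` U) `|`
    ([set 0] `&` unit_vector @^-1` U)); last first.
  by rewrite -setIUl setvU setTI.
apply: measurableU.
  apply: open_measurable_mx; rewrite openE => x [/= x0 Ux].
  apply: filterI; first by have := closed_openC c0; rewrite openE; exact.
  have : {for x, continuous unit_vector}.
    apply: (@cvgZ R 'rV[R]_n _ (nbhs x) _ (fun y => (enorm y)^-1) id).
      apply: (@cvgV R _ (nbhs x) _ enorm); last exact: enorm_continuous.
      by rewrite enorm_eq0; exact/eqP.
    exact: cvg_id.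
  by apply; exact: open_nbhs_nbhs.
have [U0|U0] := pselect (U (unit_vector 0)).
  rewrite (_ : _ `&` _ = [set 0]); first exact: closed_measurable_mx.
  by apply/seteqP; split => [x []//|x ->].
by rewrite (_ : _ `&` _ = set0) // -subset0 => x [/= ->].
Qed.

HB.instance Definition _ := isMeasurableFun.Build _ _ _ _ unit_vector
  measurable_unit_vector.

(* cone_volume A = |{x : |x| <= 1, x / |x| \in A}|, the volume of the cone with
   base A \subset S^(n-1) and apex 0. *)
Definition cone_volume : set 'rV[R]_n -> \bar R :=
  pushforward (mrestr (@lebesgue R n) measurable_eball) unit_vector.

Let cone_volume0 : cone_volume set0 = 0%E.
Proof. exact: measure0. Qed.

Let cone_volume_ge0 A : (0 <= cone_volume A)%E.
Proof. exact: measure_ge0. Qed.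

Let cone_volume_sigma_additive : semi_sigma_additive cone_volume.
Proof. exact: measure_semi_sigma_additive. Qed.

HB.instance Definition _ := isMeasure.Build _ _ _ cone_volume
  cone_volume0 cone_volume_ge0 cone_volume_sigma_additive.

(* Surface measure of S^(n-1), as a measure on R^n: the cone over A has volume
   |A| / n, as integration in polar coordinates shows. *)
Definition surface : set 'rV[R]_n -> \bar R := mscale n%:R%:nng cone_volume.

HB.instance Definition _ := Measure.on surface.

End sphere.

Section grassmannian.
Variables (R : realType) (n : nat).

Definition orthonormal_basis m (B : 'M[R]_(m, n)) (V : {vspace 'rV[R]_n}) :=
  B *m B^T = 1%:M /\ <<[tuple row i B | i < m]>>%VS = V.

Lemma exists_orthonormal_basis (V : {vspace 'rV[R]_n}) :
  exists B : 'M[R]_(\dim V, n), orthonormal_basis B V.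
Proof.
move: {2}(\dim V) (erefl (\dim V)) => m; elim: m V => [|m IHm] V dimV.
  rewrite dimV; exists 0; split; first by apply/matrixP => -[].
  move/eqP : dimV; rewrite dimv_eq0 => /eqP ->.
  apply/eqP; rewrite -subv0; apply/span_subvP => x /tnthP[[]//].
have [v vV v0] : exists2 v, v \in V & v != 0.
  exists (vpick V); first exact: memv_pick.
  by rewrite vpick0 -dimv_eq0 dimV.
pose u := unit_vector v.
have uV : u \in V by apply: memvZ.
have uu : u *m u^T = 1%:M.
  rewrite /u /unit_vector linearZ /= -scalemxAl -scalemxAr scalerA.
  apply/matrixP => i j; rewrite !ord1 !mxE -expr2 exprVn sqr_sqrtr; last first.
    by apply: sumr_ge0 => l _; exact: sqr_ge0.
  under [X in _ * X]eq_bigr do rewrite mxE -expr2.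
  rewrite mulVf//; apply: contraNN v0; rewrite -enorm_eq0 /enorm => /eqP ->.
  by rewrite sqrtr0.
pose phi : 'Hom('rV[R]_n, 'rV[R]_1) := linfun (mulmxr u^T).
have phiE x : phi x = x *m u^T by rewrite lfunE.
pose W := (V :&: lker phi)%VS.
have dimW : \dim W = m.
  have := limg_ker_dim phi V; rewrite dimV.
  suff -> : \dim (phi @: V) = 1%N by rewrite addn1 => -[].
  apply/eqP; rewrite eqn_leq; apply/andP; split.
    by apply: leq_trans (dimvS (subvf _)) _; rewrite dimvf /dim /= mul1n.
  rewrite lt0n dimv_eq0; apply/negP => /eqP V0.
  have : phi u \in (phi @: V)%VS by exact: memv_img.
  rewrite V0 memv0 phiE uu => /eqP/matrixP/(_ 0 0)/eqP.
  by rewrite !mxE /= oner_eq0.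
have := IHm _ dimW; rewrite dimW => -[C [CC CW]].
have rowC i : row i C \in W.
  rewrite -CW; apply: memv_span; apply/mapP; exists i => //.
  by rewrite mem_enum.
have Cu : C *m u^T = 0.
  apply/row_matrixP => i; rewrite row_mul row0 -phiE; apply/eqP.
  by rewrite -memv_ker; have := rowC i; rewrite memv_cap => /andP[].
have uC : u *m C^T = 0 by apply: trmx_inj; rewrite trmx_mul trmxK Cu trmx0.
pose B : 'M[R]_(1 + m, n) := col_mx u C.
have BB : B *m B^T = 1%:M.
  by rewrite tr_col_mx mul_col_row uu CC Cu uC -scalar_mx_block.
have rowBV (i : 'I_(1 + m)) : row i B \in V.
  case: (split_ordP i) => j ->; rewrite /B ?rowKu ?rowKd.
    by rewrite row_id.
  by have := rowC j; rewrite memv_cap => /andP[].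
rewrite dimV; exists B; split; first exact: BB.
apply/eqP; rewrite eqEsubv; apply/andP; split.
  by apply/span_subvP => x /mapP[i _ ->]; exact: rowBV.
set S := <<_>>%VS.
have rowS (i : 'I_(1 + m)) : row i B \in S.
  by apply: memv_span; apply/mapP; exists i => //; rewrite mem_enum.
have uS : u \in S by have := rowS (lshift m 0); rewrite rowKu row_id.
have WS : (W <= S)%VS.
  rewrite -CW; apply/span_subvP => x /mapP[i _ ->].
  by have := rowS (rshift 1 i); rewrite rowKd.
apply/subvP => x xV; rewrite -[x](subrK (phi x 0 0 *: u)) memvD//; last first.
  exact: memvZ.
apply: (subvP WS); rewrite memv_cap memvB//=; last exact: memvZ.
rewrite memv_ker linearB linearZ /= !phiE uu; apply/eqP/matrixP => i j.
by rewrite !ord1 !mxE /= mulr1 subrr.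
Qed.

Variable k : nat.

(* Gr_(n-k), the (n - k)-dimensional linear subspaces of R^n. *)
Definition grass := {V : {vspace 'rV[R]_n} | \dim V == (n - k)%N}.

HB.instance Definition _ := Choice.on grass.

Let dim_grass_point :
  \dim <<take (n - k) (vbasis (@fullv R 'rV[R]_n))>> == (n - k)%N.
Proof.
have fb : free (vbasis (@fullv R 'rV[R]_n)) := basis_free (vbasisP _).
have ft : free (take (n - k) (vbasis (@fullv R 'rV[R]_n))).
  apply: (catl_free (Y := drop (n - k) (vbasis (@fullv R 'rV[R]_n)))).
  by rewrite cat_take_drop.
move/eqP : ft => ->; rewrite size_takel// size_tuple dimvf /dim /= mul1n.
exact: leq_subr.
Qed.

HB.instance Definition _ := isPointed.Build grass
  (exist (fun V => \dim V == (n - k)%N) _ dim_grass_point).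

(* The quotient topology for the map sending an orthonormal (n - k)-frame to its
   span; a frame is an (n - k) x n matrix with orthonormal rows. *)
Definition grass_open : set (set grass) :=
  [set U | exists2 O : set 'M[R]_(n - k, n), open O &
    forall (H : grass) (B : 'M[R]_(n - k, n)), orthonormal_basis B (val H) ->
      (U H <-> O B)].

Let grass_openT : grass_open setT.
Proof. by exists setT => //; exact: openT. Qed.

Let grass_openI : setI_closed grass_open.
Proof.
move=> U V [P oP UP] [Q oQ VQ]; exists (P `&` Q); first exact: openI.
by move=> H B BH; split=> -[/(UP _ _ BH) ? /(VQ _ _ BH)].
Qed.

Let grass_open_bigU (I : Type) (F : I -> set grass) :
  (forall i, grass_open (F i)) -> grass_open (\bigcup_i F i).
Proof.
move=> oF; have /choice[P hP] : forall i, exists P : set 'M[R]_(n - k, n),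
    open P /\ forall (H : grass) B, orthonormal_basis B (val H) -> (F i H <-> P B).
  by move=> i; have [P oP FP] := oF i; exists P.
exists (\bigcup_i P i); first by apply: bigcup_open => i _; exact: (hP i).1.
by move=> H B BH; split=> -[i _ /((hP i).2 _ _ BH)]; exists i.
Qed.

HB.instance Definition _ := isOpenTopological.Build grass
  grass_openT grass_openI grass_open_bigU.

HB.instance Definition _ := @isMeasurable.Build
  (sigma_display (@open grass)) grass <<s @open grass >>
  (@sigma_algebra0 _ setT _) (@sigma_algebraC _ _)
  (@sigma_algebra_bigcup _ setT _).

End grassmannian.

Section subspace_integral.
Variables (R : realType) (n k : nat) (H : grass R n k).

Definition grass_basis : 'M[R]_(n - k, n) :=
  get [set B | orthonormal_basis B (val H)].

Lemma grass_basisP : orthonormal_basis grass_basis (val H).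
Proof.
apply: (@getPex _ [set B | orthonormal_basis B (val H)]).
have := exists_orthonormal_basis (val H).
by rewrite (eqP (valP H)).
Qed.

(* y |-> y *m grass_basis is a linear isometry from R^(n-k) onto H: Lebesgue
   measure on H and surface measure on the sphere of H are the images of those
   of R^(n-k), and by rotation invariance do not depend on the chosen basis. *)
Definition grass_integral (A : set 'rV[R]_n) (F : 'rV[R]_n -> \bar R) : \bar R :=
  (\int[@lebesgue R (n - k)]_(y in [set y | A (y *m grass_basis)])
     F (y *m grass_basis))%E.

Definition radon (h : 'rV[R]_n -> R) : \bar R :=
  (\int[@surface R (n - k)]_(y in @sphere R (n - k))
     (h (y *m grass_basis))%:E)%E.

End subspace_integral.

Section bodies.
Variables (R : realType) (n : nat).
Implicit Types (K D : set 'rV[R]_n) (f : 'rV[R]_n -> R).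

(* For a star body the infimum is attained. *)
Definition minkowski K (x : 'rV[R]_n) : R :=
  inf [set a | 0 <= a /\ exists2 y, K y & x = a *: y].

Definition boundary K : set 'rV[R]_n := closure K `\` K°.

Definition star_body K :=
  [/\ closed K, bounded_set K,
      forall u : 'rV[R]_n, u != 0 ->
        ([set x | [/\ boundary K x, x != 0 & exists t : R, x = t *: u]]
           #= `I_2)%card,
      K° 0
    & continuous (minkowski K)].

Definition gen_intersection_body (k : nat) D :=
  [/\ star_body D, forall x, D x -> D (- x)
    & exists nu : {finite_measure set grass R n k -> \bar R},
        forall h : 'rV[R]_n -> R, {within @sphere R n, continuous h} ->
          (\int[@surface R n]_(x in @sphere R n) (minkowski D x ^- k * h x)%:E =
           \int[nu]_H radon H h)%E].

(* The infimum is taken in the extended reals, so it would be +oo on an empty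
   class of bodies. *)
Definition dovr (k : nat) K : \bar R :=
  ereal_inf [set ((@lebesgue R n D / @lebesgue R n K) `^ n%:R^-1)%E |
             D in [set D | K `<=` D /\ gen_intersection_body k D]].

(* Lebesgue measurable, i.e. almost everywhere equal to a Borel function, and
   integrable on compact sets. *)
Definition locally_integrable_rV f :=
  (exists2 f0 : 'rV[R]_n -> R, measurable_fun setT f0 &
     {ae @lebesgue R n, forall x, f x = f0 x}) /\
  (forall C, compact C -> (\int[@lebesgue R n]_(x in C) `|f x|%:E < +oo)%E).

Definition density_measure f (B : set 'rV[R]_n) : \bar R :=
  (\int[@lebesgue R n]_(x in B) (f x)%:E)%E.

(* mu (B `&` H) for the measure mu with density f; when f >= 0 is not Lebesgue
   measurable on H, this is the lower integral. *)
Definition density_section k f (B : set 'rV[R]_n) (H : grass R n k) : \bar R :=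
  grass_integral H B (EFin \o f).

End bodies.

(* Main.v *)
Require Import Defs.
From HB Require Import structures.
From mathcomp Require Import all_boot all_order all_algebra.
From mathcomp Require Import all_classical all_reals all_analysis.
From mathcomp Require Import measurable_realfun ess_sup_inf ring lra zify.

(** Let [D] be a generalized [k]-intersection body with measure [nu].  Polar
coordinates turn its defining identity on the sphere into
<<
  int F(x) ||x||_D^(-k) dx  =  int_Gr ( int_H F ) dnu(H)
>>
for Borel functions [F >= 0] of bounded support; this is
[gen_intersection_body_integral].  If [K] is contained in [D], then
[||x||_D <= 1] on [K], and [nu] is non-negative, so
<<
  mu_1(K) <= int_K f ||x||_D^(-k) = int_Gr mu_1(K /\ H) dnu(H)
          <= int_Gr mu_2(L /\ H) dnu(H) = int_L g ||x||_D^(-k).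
>>
Among the densities with values in [[0, 1]] and given mass [m], the last
integral is largest for the one whose mass lies where [||x||_D] is smallest,
the indicator of the dilate [tD] of volume [m].  Its value there is
[n / (n-k) |D|^(k/n) m^((n-k)/n)] ([bathtub]).  The infimum over [D] gives the
theorem.

The identity is known for continuous functions on the sphere.  Lipschitz
functions increase to the indicator of an orthant [{x | x_i < a_i}], which gives
the equality on the cones [{|x| <= t, x / |x| in an orthant}]: both sides are
homogeneous of degree [n - k] in [t].  These cones are stable under
intersection and generate the Borel sets.  For the right-hand side to be a
measure, the volume of [A /\ H] must be measurable in [H].  It is computed in an
orthonormal basis of [H] that is an arbitrary choice, without any continuity
in [H]; but Lebesgue measure is invariant under orthogonal maps, so that every
orthonormal frame of [H] gives the same value, and for Lipschitz functions this
value is continuous in the frame ([measurable_sphere_mean]).  Orthogonal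
invariance comes from the uniqueness of translation invariant measures
([haar_swap], [lebesgue_mxmap]).

The densities [f] and [g] are Borel only up to a null set of [R^n], and a null
set may have sections of positive measure.  They are squeezed, at every point,
between Borel functions which agree off a null set ([borel_sandwich]); for every
[H] the hypothesis compares the function below [f] with the one above [g].

If no body of the class contains [K], the infimum is [+oo], and what remains to
be shown is that [mu_2(L) = 0] forces [mu_1(K) = 0].  That holds because a set
whose sections are null whenever those of some null set are is itself null
([null_by_sections], by Tonelli on a pencil of subspaces). *)
Import Order.TTheory GRing.Theory Num.Theory.
Import numFieldNormedType.Exports.

Local Open Scope classical_set_scope.
Local Open Scope ring_scope.

Set Implicit Arguments.
Unset Strict Implicit.
Unset Printing Implicit Defensive.

(** * Measurable maps into R^n and translation invariance *)

Section measurability.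
Context {R : realType}.

Lemma continuous_measurable_mx m n (f : 'M[R]_(m, n) -> R) :
  continuous f -> measurable_fun setT f.
Proof.
move=> /continuousP cf; apply: (measurability _ (RGenOpens.measurableE R)).
move=> _ [_ [a [b ->] <-]]; rewrite setTI; apply: open_measurable_mx.
exact/cf/interval_open.
Qed.

Lemma measurable_coord n (i : 'I_n) :
  measurable_fun setT (fun x : 'rV[R]_n => x 0 i).
Proof.
by apply: continuous_measurable_mx; exact: coord_continuous.
Qed.

Lemma measurable_rV d (T : measurableType d) n (f : T -> 'rV[R]_n) :
  (forall i, measurable_fun setT (fun x => f x 0 i)) -> measurable_fun setT f.
Proof.
move=> mf.
rewrite (_ : f = @row_of_tuple R n \o fun x => [tuple f x 0 i | i < n]); last first.
  by apply/funext => x; apply/rowP => i; rewrite !mxE tnth_mktuple.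
apply: measurableT_comp => //; apply/measurable_fun_tnthP => i.
by apply: eq_measurable_fun (mf i) => x _ /=; rewrite tnth_mktuple.
Qed.

Lemma measurable_mulmx m n (B : 'M[R]_(m, n)) :
  measurable_fun setT (fun y : 'rV[R]_m => y *m B).
Proof.
apply: measurable_rV => i.
under eq_fun do rewrite mxE.
apply: measurable_sum => j; apply: measurable_funM => //.
exact: measurable_coord.
Qed.

Lemma measurable_addrV d (T : measurableType d) n (f g : T -> 'rV[R]_n) :
  measurable_fun setT f -> measurable_fun setT g ->
  measurable_fun setT (fun x => f x + g x).
Proof.
move=> mf mg; apply: measurable_rV => i.
under eq_fun do rewrite mxE.
by apply: measurable_funD; apply: (measurableT_comp (measurable_coord i)).
Qed.

Lemma measurable_scalerV d (T : measurableType d) n (c : T -> R) (f : T -> 'rV[R]_n) :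
  measurable_fun setT c -> measurable_fun setT f ->
  measurable_fun setT (fun x => c x *: f x).
Proof.
move=> mf mg; apply: measurable_rV => i.
under eq_fun do rewrite mxE.
by apply: measurable_funM => //; apply: (measurableT_comp (measurable_coord i)).
Qed.

Lemma measurable_enorm n : measurable_fun setT (@enorm R n).
Proof.
by apply: continuous_measurable_mx; exact: enorm_continuous.
Qed.

End measurability.

Section transfer.
Context d1 d2 (X : measurableType d1) (Y : measurableType d2) {R : realType}.
Local Open Scope ereal_scope.

(** Change of variables in terms of an equation between the two measures, for a
map whose measurability is a hypothesis rather than part of its type. *)
Lemma ge0_integral_transfer (phi : X -> Y) (mu : {measure set X -> \bar R})
    (nu : {measure set Y -> \bar R}) (f : Y -> \bar R) :
  measurable_fun setT phi ->
  (forall A, measurable A -> nu A = mu (phi @^-1` A)) ->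
  measurable_fun setT f -> (forall y, 0 <= f y) ->
  \int[nu]_y f y = \int[mu]_x f (phi x).
Proof.
move=> mphi numu mf f0.
pose p : {mfun X >-> Y} := HB.pack phi (isMeasurableFun.Build _ _ _ _ _ mphi).
rewrite (eq_measure_integral (pushforward mu p)); last first.
  by move=> A mA _; exact: numu.
by rewrite ge0_integral_pushforward.
Qed.

End transfer.

Section translation.
Context {R : realType}.
Local Notation T := (measurableTypeR R).

(** The translate of the measure takes the same values on half-open intervals,
and these determine Lebesgue measure on the line. *)
Lemma lebesgue_measure_shift (a : R) (A : set T) : measurable A ->
  @lebesgue_measure R ((fun x => x + a) @^-1` A) = @lebesgue_measure R A.
Proof.
move=> mA; have ma : measurable_fun setT (fun x : T => x + a : T).
  exact: measurable_funD.
pose sh : {mfun T >-> T} := HB.pack (fun x : T => x + a : T)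
  (isMeasurableFun.Build _ _ _ _ _ ma).
apply/esym/(@lebesgue_measure_unique R (pushforward lebesgue_measure sh)) => //.
move=> _ [[b c]] _ <-.
change (@lebesgue_measure R `]b, c]%classic =
  @lebesgue_measure R ((fun x => x + a) @^-1` `]b, c]%classic)).
have -> : (fun x => x + a) @^-1` `]b, c]%classic = `]b - a, c - a]%classic.
  by apply/seteqP; split => x /=; rewrite !in_itv/= ltrBlDr lerBrDr.
rewrite !lebesgue_measure_itv/= !lte_fin ltrBlDr subrK; case: ifPn => // _.
by rewrite -!EFinB opprB addrA subrK.
Qed.

(** Translation, read on the tuples on which the measure is built. *)
Definition addt n (t u : n.-tuple T) : n.-tuple T := [tuple tnth t i + tnth u i | i < n].

Lemma measurable_cons_pair n : measurable_fun setT (@cons_pair R n).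
Proof. exact: measurable_cons. Qed.

(** One coordinate at a time: translation by [u] shifts the sections of [A] by
the tail of [u], and the points over which they lie by its head. *)
Lemma lebesgue_tuple_shift n (u : n.-tuple T) (A : set (n.-tuple T)) :
  measurable A ->
  lebesgue_tuple R n (@addt _ ^~ u @^-1` A) = lebesgue_tuple R n A.
Proof.
elim: n u A => [|n IHn] u A mA.
  congr (_ _); apply/seteqP; split => t /=;
   by rewrite (tuple0 (addt _ _)) (tuple0 t).
rewrite /= /lebesgue_cons /pushforward.
have mB : measurable (@cons_pair R n @^-1` A).
  by rewrite -[X in measurable X]setTI; exact: measurable_cons_pair.
set B := _ @^-1` A in mB *.
have -> : @cons_pair R n @^-1` (@addt _ ^~ u @^-1` A) =
   (fun p => (p.1 + thead u, addt p.2 [tuple of behead u])) @^-1` B.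
  have E (x : T) (t : n.-tuple T) : addt (cons_pair (x, t)) u =
      cons_pair (x + thead u, addt t [tuple of behead u]).
    apply/eq_from_tnth => i; rewrite tnth_mktuple.
    case: (unliftP ord0 i) => [j|] ->; first rewrite !tnthS tnth_mktuple.
      by congr (_ + _); rewrite [in RHS](tnth_nth 0) /= nth_behead (tnth_nth 0).
    by rewrite !tnth0.
  by apply/seteqP; split => -[x t] /=; rewrite E.
rewrite /product_measure1 /=.
pose F (x : T) : \bar R := lebesgue_tuple R n (xsection B x).
transitivity (\int[@lebesgue_measure R]_x F (x + thead u)%R)%E.
  apply: eq_integral => x _ /=; rewrite -[RHS](IHn [tuple of behead u]); last first.
    exact: measurable_xsection.
  by congr (_ _); apply/seteqP; split => t; rewrite /xsection/= !inE.
have mF : measurable_fun setT F by exact: measurable_fun_xsection.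
have mu_ : measurable_fun setT (fun x : T => (x + thead u)%R : T).
  exact: measurable_funD.
symmetry; apply: (@ge0_integral_transfer _ _ _ _ R _ lebesgue_measure
  lebesgue_measure F mu_ _ mF) => // C mC.
exact/esym/lebesgue_measure_shift.
Qed.

Lemma measurable_row_of_tuple n : measurable_fun setT (@row_of_tuple R n).
Proof. exact: measurable_funPT. Qed.

Lemma lebesgue_shift n (v : 'rV[R]_n) (A : set 'rV[R]_n) : measurable A ->
  lebesgue ((fun x => x + v) @^-1` A) = lebesgue A.
Proof.
move=> mA; rewrite /lebesgue /pushforward.
rewrite -[RHS](lebesgue_tuple_shift [tuple v 0 i | i < n]); last first.
  by rewrite -[X in measurable X]setTI; exact: measurable_row_of_tuple.
have E t : row_of_tuple t + v = row_of_tuple (addt t [tuple v 0 i | i < n]).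
  by apply/rowP => i; rewrite !mxE !tnth_mktuple.
by congr (lebesgue_tuple R n _); apply/funext => t; rewrite /preimage/= E.
Qed.

Lemma lebesgue_cube n (a : R) : (0 <= a)%R ->
  lebesgue [set x : 'rV[R]_n | forall i, (`|x 0 i| <= a)%R] = ((2 * a) ^+ n)%:E.
Proof.
move=> a0.
rewrite /lebesgue /pushforward.
rewrite (_ : _ @^-1` _ = [set t | forall i, (`|tnth t i| <= a)%R]); last first.
  by apply/seteqP; split => t h i /=; have := h i; rewrite mxE.
have mC k : measurable [set t : k.-tuple T | forall i, (`|tnth t i| <= a)%R].
  rewrite (_ : [set _ | _] = \bigcap_(i in [set: 'I_k])
      ((fun t : k.-tuple T => tnth t i) @^-1` `[- a, a]%classic)); last first.
    apply/seteqP; split => [t h i _|t h i] /=; first by rewrite in_itv/= -ler_norml.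
    by rewrite ler_norml; have := h i Logic.I; rewrite /= in_itv.
  apply: fin_bigcap_measurable => // i _; rewrite -[X in measurable X]setTI.
  by apply: measurable_tnth => //; exact: measurable_itv.
elim: n => [|n IHn].
  by rewrite expr0 /= diracE mem_set// => -[].
rewrite /= /lebesgue_cons /pushforward.
rewrite (_ : _ @^-1` _ =
  `[- a, a]%classic `*` [set t | forall i, (`|tnth t i| <= a)%R]); last first.
  apply/seteqP; split => [[x t]/= h|[x t]/=[h1 h2] i].
    split; first by have := h ord0; rewrite tnth0 /= in_itv/= ler_norml.
    by move=> i; have := h (lift ord0 i); rewrite tnthS.
  case: (unliftP ord0 i) => [j|] ->; rewrite ?tnthS ?tnth0//.
  by move: h1; rewrite in_itv/= -ler_norml.
rewrite product_measure1E; [|exact: measurable_itv|exact: mC].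
have E1 : @lebesgue_measure R `[- a, a]%classic = (2 * a)%:E.
  rewrite lebesgue_measure_itv /= lte_fin; case: ltP => aa.
    by rewrite -EFinB opprK -mulr2n mulr_natl.
  have -> : a = 0 by apply/eqP; lra.
  by rewrite mulr0.
by rewrite exprS EFinM -E1 -IHn.
Qed.

End translation.

(** * Lebesgue measure under linear maps *)

Section sigma_finite_alias.
Context d (T : measurableType d) {R : realType}.

(** [M] under a name that records a proof of sigma-finiteness: a measure that is
sigma-finite only by a hypothesis gets the structure that Tonelli's theorem
asks for. *)
Definition sigma_finite_alias (M : {measure set T -> \bar R})
  (sM : sigma_finite setT M) : set T -> \bar R := M.

Variables (M : {measure set T -> \bar R}) (sM : sigma_finite setT M).

HB.instance Definition _ := isMeasure.Build _ _ _ (sigma_finite_alias sM)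
  (measure0 M) (measure_ge0 M) (@measure_semi_sigma_additive _ _ _ M).

HB.instance Definition _ :=
  Measure_isSigmaFinite.Build _ _ _ (sigma_finite_alias sM) sM.

End sigma_finite_alias.

Section haar.
Context {R : realType}.

Lemma measurable_preimage d1 d2 (X : measurableType d1) (Y : measurableType d2)
    (f : X -> Y) (A : set Y) :
  measurable_fun setT f -> measurable A -> measurable (f @^-1` A).
Proof. by move=> mf mA; rewrite -[X in measurable X]setTI; exact: mf. Qed.

Definition cube n (a : R) : set 'rV[R]_n := [set x | forall i, `|x 0 i| <= a].

Lemma measurable_cube n a : measurable (@cube n a).
Proof.
rewrite (_ : @cube n a = \bigcap_(i in [set: 'I_n])
    ((fun x : 'rV[R]_n => x 0 i) @^-1` `[- a, a]%classic)); last first.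
  apply/seteqP; split => [t h i _|t h i] /=; first by rewrite in_itv/= -ler_norml.
  by rewrite ler_norml; have := h i Logic.I; rewrite /= in_itv.
apply: fin_bigcap_measurable => // i _; apply: measurable_preimage.
  exact: measurable_coord.
exact: measurable_itv.
Qed.

Lemma cube_mulmx m n (B : 'M[R]_(m, n)) (a : R) : exists2 b : R, 0 <= b &
  forall y : 'rV_m, cube a y -> cube b (y *m B).
Proof.
exists (`|a| * \sum_i \sum_j `|B i j|).
  by rewrite mulr_ge0// sumr_ge0// => i _; rewrite sumr_ge0.
move=> y ya j; rewrite mxE.
apply: le_trans (ler_norm_sum _ _ _) _; rewrite mulr_sumr; apply: ler_sum => i _.
rewrite normrM ler_pM//; first by rewrite (le_trans (ya i))// ler_norm.
by rewrite (bigD1 j)//= lerDl sumr_ge0.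
Qed.

Lemma cube_exists n (x : 'rV[R]_n) : exists k : nat, cube k%:R x.
Proof.
exists (Num.truncn (\sum_i `|x 0 i|)).+1 => i.
apply/ltW; apply: le_lt_trans (truncnS_gt _).
by rewrite (bigD1 i)//= lerDl sumr_ge0.
Qed.

Lemma lebesgue_sigma_finite n : sigma_finite setT (@lebesgue R n).
Proof.
exists (fun k : nat => @cube n k%:R).
  apply/seteqP; split => // x _; have [k kx] := cube_exists x; by exists k.
move=> k; split; first exact: measurable_cube.
by rewrite lebesgue_cube// ltry.
Qed.

HB.instance Definition _ n := Measure_isSigmaFinite.Build _ _ _ (@lebesgue R n)
  (@lebesgue_sigma_finite n).

Local Open Scope ereal_scope.

Lemma tonelli_sections d1 d2 (X : measurableType d1) (Y : measurableType d2)
    (m1 : {sigma_finite_measure set X -> \bar R})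
    (m2 : {sigma_finite_measure set Y -> \bar R}) (E : set (X * Y)) :
  measurable E ->
  \int[m1]_x m2 (xsection E x) = \int[m2]_y m1 (ysection E y).
Proof.
move=> mE; have := @product_measure_unique _ _ _ _ R m1 m2
  (product_measure2 m1 m2) _ E mE.
by apply => A B mA mB; exact: product_measure2E.
Qed.

(** Uniqueness of Haar measure in a finite form.  The measure of the pairs
[(x, y)] with [x] in [A] and [x + y] in [B] is [|A| M(B)] when [y] is integrated
first.  Integrating [x] first, translating by [y], and changing the order again
leaves the translates of [-A], of measure [M(-A)], over the points of [B].
When [B] is a cube, [M] is seen to be a multiple of Lebesgue measure. *)
Lemma haar_swap n (M : {measure set 'rV[R]_n -> \bar R}) (A B : set 'rV[R]_n) :
  sigma_finite setT M ->
  (forall (v : 'rV[R]_n) (A : set 'rV[R]_n), measurable A -> M ((fun x => x + v)%R @^-1` A) = M A) ->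
  measurable A -> measurable B ->
  lebesgue A * M B = lebesgue B * M (-%R @^-1` A).
Proof.
move=> sM tM mA mB.
pose N : {sigma_finite_measure set 'rV[R]_n -> \bar R} :=
  sigma_finite_alias sM.
have NM C : N C = M C by [].
pose E : set ('rV[R]_n * 'rV[R]_n) := [set p | A p.1 /\ B (p.1 + p.2)%R].
pose E' : set ('rV[R]_n * 'rV[R]_n) := [set p | A (p.1 - p.2)%R /\ B p.1].
have mopp : measurable_fun setT (-%R : 'rV[R]_n -> 'rV[R]_n).
  rewrite (_ : -%R = fun x : 'rV[R]_n => (x *m (-1)%:M)%R).
    exact: measurable_mulmx.
  by apply/funext => x; rewrite mul_mx_scalar scaleN1r.
have mE : measurable E.
  apply: measurableI; apply: measurable_preimage => //.
  by apply: measurable_addrV.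
have mE' : measurable E'.
  apply: measurableI; apply: measurable_preimage => //.
  by apply: measurable_addrV => //; exact: measurableT_comp.
transitivity (\int[@lebesgue R n]_x N (xsection E x)).
  transitivity (\int[@lebesgue R n]_x (M B * (\1_A x)%:E)).
    rewrite ge0_integralZl//; last exact/measurable_EFinP/measurable_indic.
    by rewrite integral_indic// setIT muleC.
  apply: eq_integral => x _; rewrite NM indicE.
  have [xA|xA] := boolP (x \in A); last first.
    rewrite mule0 (_ : xsection E x = set0) ?measure0//.
    apply/seteqP; split => // y; rewrite /xsection/= inE => -[Ax _].
    by move/negP : xA; rewrite inE.
  rewrite mule1 -(tM x B mB); congr (M _); apply/seteqP; split => y;
    rewrite /xsection /= inE /E/= addrC; first by split => //; rewrite inE in xA.
  by case.
rewrite tonelli_sections//.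
transitivity (\int[N]_y lebesgue (ysection E' y)).
  apply: eq_integral => y _; rewrite -[RHS](lebesgue_shift y); last first.
    exact: measurable_ysection.
  by congr (lebesgue _); apply/seteqP; split => x; rewrite /ysection/= !inE /E /E'/= addrK.
rewrite -tonelli_sections//.
transitivity (\int[@lebesgue R n]_x (M (-%R @^-1` A) * (\1_B x)%:E)); last first.
  rewrite ge0_integralZl//; last exact/measurable_EFinP/measurable_indic.
  by rewrite integral_indic// setIT muleC.
apply: eq_integral => x _; rewrite NM indicE.
have [xB|xB] := boolP (x \in B); last first.
  rewrite mule0 (_ : xsection E' x = set0) ?measure0//.
  apply/seteqP; split => // y; rewrite /xsection/= inE => -[_ Bx].
  by move/negP : xB; rewrite inE.
rewrite mule1 -(tM (- x)%R (-%R @^-1` A)); last exact: measurable_preimage.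
congr (M _); apply/seteqP; split => y;
    rewrite /xsection /= inE /E'/= opprB; first by case.
by split => //; rewrite inE in xB.
Qed.

Lemma EFin_mulI (c : R) (x y : \bar R) : (0 < c)%R ->
  c%:E * x = c%:E * y -> x = y.
Proof.
move=> c0 /(congr1 (mule c^-1%:E)).
by rewrite !muleA -!EFinM mulVf ?gt_eqF// !mul1e.
Qed.

Lemma lebesgueN n (A : set 'rV[R]_n) : measurable A ->
  lebesgue (-%R @^-1` A) = lebesgue A.
Proof.
move=> mA.
have E : lebesgue A * lebesgue (@cube n 1) =
    lebesgue (@cube n 1) * lebesgue (-%R @^-1` A).
  exact: (haar_swap (@lebesgue_sigma_finite n)
    (@lebesgue_shift R n) mA (measurable_cube 1)).
move: E; rewrite lebesgue_cube// muleC => /esym; apply: EFin_mulI.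
by rewrite mulr1 exprn_gt0.
Qed.

Lemma le_lebesgue n (A B : set 'rV[R]_n) : measurable A -> measurable B ->
  A `<=` B -> lebesgue A <= lebesgue B.
Proof. by move=> mA mB AB; apply: le_measure; rewrite ?inE. Qed.

(** A name for [y |-> y *m B] to which measurability can be attached. *)
Definition mxmap m n (B : 'M[R]_(m, n)) (y : 'rV[R]_m) : 'rV[R]_n := y *m B.

HB.instance Definition _ m n (B : 'M[R]_(m, n)) :=
  isMeasurableFun.Build _ _ _ _ (mxmap B) (measurable_mulmx B).

(** The image of Lebesgue measure by an invertible map is translation invariant,
hence a multiple of it by [haar_swap]; the factor compares the two measures on
the cube [[-1, 1]^n]. *)
Lemma lebesgue_mxmap n (Q : 'M[R]_n) : Q \in unitmx ->
  exists2 c : R, (0 < c)%R & forall A, measurable A ->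
    lebesgue (mxmap Q @^-1` A) = c%:E * lebesgue A.
Proof.
move=> uQ.
have sM : sigma_finite setT (pushforward (@lebesgue R n) (mxmap Q)).
  exists (fun k : nat => mxmap (invmx Q) @^-1` @cube n k%:R).
    apply/seteqP; split => // x _.
    by have [k kx] := cube_exists (mxmap (invmx Q) x); exists k.
  move=> k; split.
    apply: measurable_preimage; first exact: measurable_mulmx.
    exact: measurable_cube.
  rewrite /pushforward -comp_preimage.
  rewrite (_ : _ \o _ = id); first by rewrite preimage_id lebesgue_cube// ltry.
  by apply/funext => x /=; rewrite /mxmap mulmxK.
have tM (v : 'rV[R]_n) (A : set 'rV[R]_n) : measurable A ->
    pushforward (@lebesgue R n) (mxmap Q) ((fun x => x + v)%R @^-1` A) =
    pushforward (@lebesgue R n) (mxmap Q) A.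
  move=> mA; rewrite /pushforward -[RHS](lebesgue_shift (v *m invmx Q)%R).
    congr (lebesgue _); apply/funext => x.
    by rewrite /preimage/= /mxmap mulmxDl mulmxKV.
  by apply: measurable_preimage => //; exact: measurable_mulmx.
pose M1 := pushforward (@lebesgue R n) (mxmap Q) (cube 1).
have [a a0 ha] := cube_mulmx (invmx Q) 1.
have [b b0 hb] := cube_mulmx Q 1.
have M1oo : M1 \is a fin_num.
  rewrite ge0_fin_numE ?measure_ge0//.
  apply: (@le_lt_trans _ _ (lebesgue (@cube n a))); last by rewrite lebesgue_cube// ltry.
  apply: le_lebesgue; [|exact: measurable_cube|].
    by apply: measurable_preimage; [exact: measurable_mulmx|exact: measurable_cube].
  by move=> y /= /ha; rewrite /mxmap mulmxK.
have M10 : 0 < M1.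
  have [e e0 eb] : exists2 e : R, (0 < e)%R & (b * e <= 1)%R.
    exists (1 + b)^-1%R; first by rewrite invr_gt0 ltr_wpDr.
    by rewrite ler_pdivrMr ?ltr_wpDr// mul1r lerDr.
  have e1 : (0 < e^-1)%R by rewrite invr_gt0.
  apply: (@lt_le_trans _ _ (lebesgue (@cube n e))).
    by rewrite lebesgue_cube ?(ltW e0)// lte_fin exprn_gt0// mulr_gt0.
  apply: le_lebesgue; [exact: measurable_cube| |].
    by apply: measurable_preimage; [exact: measurable_mulmx|exact: measurable_cube].
  move=> y ye /= i; rewrite /mxmap.
  have /hb /(_ i) : cube 1 (e^-1 *: y)%R.
    move=> j; rewrite mxE normrM (gtr0_norm e1) mulrC ler_pdivrMr// mul1r.
    exact: ye.
  rewrite -scalemxAl mxE normrM (gtr0_norm e1) mulrC ler_pdivrMr//.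
  by move=> /le_trans; apply.
exists (fine M1 / 2 ^+ n)%R => [|A mA].
  by rewrite divr_gt0 ?exprn_gt0// fine_gt0// M10 ltey_eq M1oo.
have mN : measurable (-%R @^-1` A).
  rewrite (_ : -%R = mxmap (-1)%:M); last first.
    by apply/funext => x; rewrite /mxmap mul_mx_scalar scaleN1r.
  by apply: measurable_preimage => //; exact: measurable_mulmx.
have := haar_swap sM tM mN (measurable_cube 1).
rewrite lebesgueN// lebesgue_cube// -comp_preimage (_ : _ \o _ = id); last first.
  by apply/funext => x /=; rewrite opprK.
rewrite preimage_id -/M1 mulr1 => E.
apply: (@EFin_mulI (2 ^+ n)); first exact: exprn_gt0.
rewrite -E muleA -EFinM mulrCA divff ?mulr1 ?gt_eqF ?exprn_gt0//.
by rewrite fineK// muleC.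
Qed.

(** The factor is read off from the cube, which becomes another cube. *)
Lemma lebesgue_homothety n (t : R) (A : set 'rV[R]_n) : (0 < t)%R ->
  measurable A ->
  lebesgue ((fun x => t *: x)%R @^-1` A) = ((t ^+ n)^-1)%:E * lebesgue A.
Proof.
move=> t0 mA.
have uQ : (t%:M : 'M[R]_n) \in unitmx by rewrite unitmxE det_scalar unitrX// unitfE gt_eqF.
have [c c0 cE] := lebesgue_mxmap uQ.
have E B : mxmap t%:M @^-1` B = (fun x : 'rV[R]_n => t *: x)%R @^-1` B.
  by apply/funext => x; rewrite /preimage/= /mxmap mul_mx_scalar.
rewrite -E cE//; congr (_%:E * _).
have := cE _ (measurable_cube 1); rewrite E.
rewrite (_ : _ @^-1` _ = cube t^-1); last first.
  apply/funext => x; apply/propext; split => h i; have := h i;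
  by rewrite mxE normrM (gtr0_norm t0) mulrC -ler_pdivlMr// div1r.
rewrite !lebesgue_cube ?invr_ge0 ?ltW// -EFinM => -[].
by rewrite mulr1 exprMn exprVn mulrC => /mulIf -> //.
Qed.

Lemma enorm_mulmx m n (B : 'M[R]_(m, n)) (y : 'rV[R]_m) :
  B *m B^T = 1%:M -> enorm (y *m B) = enorm y.
Proof.
move=> BB; rewrite /enorm; congr Num.sqrt.
have E k (x : 'rV[R]_k) : (\sum_i x 0 i ^+ 2 = (x *m x^T) 0 0)%R.
  by rewrite mxE; apply: eq_bigr => i _; rewrite mxE.
by rewrite !E trmx_mul mulmxA -(mulmxA y) BB mulmx1.
Qed.

Lemma coord_le_enorm n (x : 'rV[R]_n) i : (`|x 0 i| <= enorm x)%R.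
Proof.
rewrite -(@ler_pXn2r _ 2)// ?nnegrE// ?sqrtr_ge0// sqr_sqrtr ?real_normK ?num_real//.
  by rewrite (bigD1 i)//= lerDl sumr_ge0// => j _; exact: sqr_ge0.
by apply: sumr_ge0 => j _; exact: sqr_ge0.
Qed.

Lemma enorm_le_sum n (x : 'rV[R]_n) : (enorm x <= \sum_i `|x 0 i|)%R.
Proof.
rewrite -(@ler_pXn2r _ 2)// ?nnegrE ?sqrtr_ge0 ?sumr_ge0//.
rewrite sqr_sqrtr; last by apply: sumr_ge0 => j _; exact: sqr_ge0.
suff [] : (\sum_i x 0 i ^+ 2 <= (\sum_i `|x 0 i|) ^+ 2 /\ 0 <= \sum_i `|x 0 i|)%R by [].
elim/big_ind2 : _ => [|a b c e [ab b0] [ce e0]|i _]; first by rewrite expr0n.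
  by split; [nra|exact: addr_ge0].
by rewrite real_normK ?num_real.
Qed.

Definition euball n (t : R) : set 'rV[R]_n := [set x | (enorm x <= t)%R].

Lemma measurable_euball n t : measurable (@euball n t).
Proof.
rewrite (_ : euball t = (@enorm R n) @^-1` `]-oo, t]%classic).
  by apply: measurable_preimage; [exact: measurable_enorm|exact: measurable_itv].
by apply/seteqP; split => x; rewrite /= in_itv.
Qed.

Lemma euball_lt_oo n t : lebesgue (@euball n t) < +oo.
Proof.
have t0 : (0 <= Num.max t 0)%R by rewrite le_max lexx orbT.
apply: (@le_lt_trans _ _ (lebesgue (@cube n (Num.max t 0%R)))).
  apply: le_lebesgue; [exact: measurable_euball|exact: measurable_cube|].
  move=> x /= xt i; rewrite le_max; apply/orP; left.
  exact: le_trans (coord_le_enorm _ _) xt.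
by rewrite lebesgue_cube// ltry.
Qed.

Lemma cube_sub_euball n (e : R) : (0 < e)%R -> exists2 d : R, (0 < d)%R &
  @cube n d `<=` euball e.
Proof.
move=> e0; exists (e / n.+1%:R)%R; first by rewrite divr_gt0.
move=> x xd; rewrite /euball/=; apply: le_trans (enorm_le_sum _) _.
apply: (@le_trans _ _ (\sum_(i < n) (e / n.+1%:R))%R); first exact: ler_sum.
rewrite sumr_const card_ord -[leLHS]mulr_natr -mulrA ger_pMr// mulrC ler_pdivrMr// mul1r.
by rewrite ler_nat.
Qed.

Lemma euball_gt0 n t : (0 < t)%R -> 0 < lebesgue (@euball n t).
Proof.
move=> /(cube_sub_euball n)[d d0 dt].
apply: (@lt_le_trans _ _ (lebesgue (@cube n d))).
  by rewrite lebesgue_cube ?ltW// lte_fin exprn_gt0// mulr_gt0.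
by apply: le_lebesgue => //; [exact: measurable_cube|exact: measurable_euball].
Qed.

(** An orthogonal map preserves the unit ball, whose volume is positive and
finite, so that the factor of [lebesgue_mxmap] is 1. *)
Lemma lebesgue_orthogonal n (Q : 'M[R]_n) A : Q *m Q^T = 1%:M -> measurable A ->
  lebesgue (mxmap Q @^-1` A) = lebesgue A.
Proof.
move=> QQ mA; have uQ : Q \in unitmx by have [] := mulmx1_unit QQ.
have [c c0 cE] := lebesgue_mxmap uQ.
suff c1 : c = 1%R by rewrite cE// c1 mul1e.
have := cE _ (measurable_euball 1).
rewrite (_ : _ @^-1` _ = euball 1); last first.
  by apply/funext => x; rewrite /preimage/euball/= /mxmap enorm_mulmx.
have /fineK <- : lebesgue (@euball n 1) \is a fin_num.
  by rewrite ge0_fin_numE ?euball_lt_oo.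
move=> /esym/eqP; rewrite -EFinM eqe => /eqP/(canRL (mulfK _)) ->; rewrite ?divff//.
all: by rewrite gt_eqF// fine_gt0// euball_gt0//= euball_lt_oo.
Qed.

End haar.

(** * Radial integration *)

Section radial.
Context {R : realType}.
Local Notation T1 := (measurableTypeR R).

Lemma measurable_inv : measurable_fun setT (@GRing.inv R).
Proof.
have c0 : closed [set (0 : R)] by exact: closed_eq.
have o0 : open [set~ (0 : R)] by exact: closed_openC.
rewrite -(setvU [set (0 : R)]); apply/measurable_funU.
- exact/measurableC.
- by [].
split; last exact: measurable_fun_set1.
apply: open_continuous_measurable_fun => // x; rewrite inE => /eqP x0.
exact: inv_continuous.
Qed.

Lemma measurable_exprV d (T : measurableType d) (q : T -> R) k :
  measurable_fun setT q -> measurable_fun setT (fun x => (q x ^+ k)^-1).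
Proof.
move=> mq; apply: (measurableT_comp measurable_inv).
by apply: (measurableT_comp (f := fun r : R => r ^+ k)).
Qed.

Lemma integral_itv_is_derive (f F : R -> R) (a b : R) : a <= b ->
  (forall x, a <= x <= b -> is_derive x 1 F (f x)) ->
  (forall x, a <= x <= b -> {for x, continuous f}) ->
  (\int[lebesgue_measure]_(x in `[a, b]) (f x)%:E = (F b - F a)%:E)%E.
Proof.
rewrite le_eqVlt => /predU1P[-> _ _|ab dF cf].
  by rewrite set_itv1 integral_set1 subrr.
have cF x : a <= x <= b -> {for x, continuous F}.
  by move=> /dF dFx; apply/differentiable_continuous/derivable1_diffP; case: dFx.
rewrite EFinB; apply: continuous_FTC2 => //.
- apply: continuous_in_subspaceT => x; rewrite inE/= in_itv/=; exact: cf.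
- split => [x| |].
  + by rewrite in_itv/= => /andP[ax xb]; have [] := dF x _ => //; rewrite !ltW.
  + by apply: cvg_at_right_filter; apply: cF; rewrite lexx ltW.
  + by apply: cvg_at_left_filter; apply: cF; rewrite lexx ltW.
- move=> x; rewrite in_itv/= => /andP[ax xb]; rewrite derive1E.
  by have [] := dF x _ => //; rewrite !ltW.
Qed.

Lemma is_derive_exp m (x : R) :
  is_derive x 1 (fun r => r ^+ m.+1 / m.+1%:R) (x ^+ m).
Proof.
have -> : (fun r : R => r ^+ m.+1 / m.+1%:R) = m.+1%:R^-1 \*: (id ^+ m.+1 : R -> R).
  by apply/funext => r /=; rewrite /GRing.scale/= mulrC exprfctE.
apply: is_derive_eq.
rewrite /GRing.scale/= mulr1 mulrA mulVf ?mul1r ?pnatr_eq0//.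
Qed.

Lemma is_derive_expV m (x : R) : 0 < x ->
  is_derive x 1 (fun r => - (r ^+ m.+1)^-1) (m.+1%:R / x ^+ m.+2).
Proof.
move=> x0.
have xm0 : x ^+ m.+1 != 0 by rewrite gt_eqF// exprn_gt0.
have dX : is_derive x 1 (fun r : R => r ^+ m.+1) (m.+1%:R * x ^+ m).
  have -> : (fun r : R => r ^+ m.+1) = (id ^+ m.+1 : R -> R).
    by apply/funext => r; rewrite exprfctE.
  by apply: is_derive_eq; rewrite /GRing.scale/= mulr1.
have dV := is_deriveN (@is_deriveV R (fun r => r ^+ m.+1) x _ 1 xm0 dX).
apply: (is_derive_eq dV).
have x0' : x != 0 by rewrite gt_eqF.
rewrite /GRing.scale/= !exprS; field; by rewrite x0' expf_neq0.
Qed.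

Local Open Scope ereal_scope.

(** Writing [q^(-k-1) = t^(-k-1) + int_q^t (k+1) r^(-k-2) dr] and exchanging the
integrals leaves [rho(q <= r) = c r^(k+m+2)] to be integrated against
[(k+1) r^(-k-2)] on [[0, t]].  The set where [q = 0], on which the left-hand
integrand has the value [0^-1 = 0], is null because [c s^(k+m+2)] tends to 0. *)
Lemma radial_integral d (T : measurableType d) (rho : {measure set T -> \bar R})
    (q : T -> R) (c t : R) (k m : nat) :
  measurable_fun setT q -> (forall x, 0 <= q x)%R -> (0 < t)%R ->
  (forall s, (0 < s <= t)%R ->
     rho [set x | (q x <= s)%R] = (c * s ^+ (k.+1 + m.+1))%:E) ->
  \int[rho]_(x in [set x | (q x <= t)%R]) ((q x ^+ k.+1)^-1)%:E =
  (c * ((k.+1 + m.+1)%:R / m.+1%:R) * t ^+ m.+1)%:E.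
Proof.
move=> mq q0 t0 rhoE.
have mD s : measurable [set x | (q x <= s)%R].
  rewrite (_ : [set _ | _] = q @^-1` `]-oo, s]%classic).
    by apply: measurable_preimage => //; exact: measurable_itv.
  by apply/seteqP; split => x /=; rewrite in_itv.
set D := [set x | (q x <= t)%R].
have c0 : (0 <= c)%R.
  have : 0 <= rho D by [].
  rewrite rhoE ?t0 ?lexx// lee_fin pmulr_lge0//; exact: exprn_gt0.
pose rho' := mrestr rho (mD t).
have srho' : sigma_finite setT rho'.
  exists (fun=> setT); first by rewrite bigcup_const.
  move=> _; split => //; rewrite /rho' /= /mrestr setTI rhoE ?ltry// t0/=.
  exact: lexx.
pose rs : {sigma_finite_measure set T -> \bar R} := sigma_finite_alias srho'.
pose w (r : R) : R := (k.+1%:R / r ^+ k.+2)%R.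
(* [E] is the domain [0 < q x <= r <= t] of the double integral, and [h] the
   integral over [r]; the next facts compute [f] integrated in each order. *)
pose E : set (T * T1) := [set p | (0 < q p.1)%R /\ (q p.1 <= p.2 <= t)%R].
pose f (p : T * T1) : \bar R := ((\1_E p) * (w p.2))%:E.
have mq1 : measurable_fun setT (fun p : T * T1 => q p.1).
  exact: measurableT_comp.
have mE : measurable E.
  rewrite (_ : E = (fun p : T * T1 => q p.1) @^-1` `]0%R, +oo[%classic `&`
    ((fun p : T * T1 => p.2 - q p.1)%R @^-1` `[0%R, +oo[%classic `&`
     (snd : T * T1 -> T1) @^-1` `]-oo, t]%classic)); last first.
    apply/seteqP; split => -[x r] /=; rewrite !in_itv/= !andbT subr_ge0.
      by move=> [? /andP[]].
    by move=> [? [? ?]]; split => //; exact/andP.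
  apply: measurableI; last apply: measurableI.
  - by apply: measurable_preimage => //; exact: measurable_itv.
  - apply: measurable_preimage; last exact: measurable_itv.
    by apply: measurable_funB => //; exact: measurable_snd.
  - by apply: measurable_preimage; [exact: measurable_snd|exact: measurable_itv].
have mw : measurable_fun setT w.
  apply: measurable_funM => //; apply: measurableT_comp => //.
    exact: measurable_inv.
have mf : measurable_fun setT f.
  apply/measurable_EFinP; apply: measurable_funM.
    exact: measurable_indic.
  by apply: measurableT_comp => //; exact: measurable_snd.
have f0 p : 0 <= f p.
  rewrite /f indicE lee_fin; have [|_] := boolP (p \in E); last by rewrite mul0r.
  rewrite inE mul1r => -[h1 /andP[h2 _]]; rewrite divr_ge0// exprn_ge0//.
  by rewrite (le_trans _ h2)// ltW.
pose h (x : T) : \bar R := if (0 < q x <= t)%R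
  then ((q x ^+ k.+1)^-1 - (t ^+ k.+1)^-1)%:E else 0.
have H1 x : \int[@lebesgue_measure R]_r f (x, r) = h x.
  rewrite /h; case: ifPn => [/andP[qx0 qxt]|qx].
    transitivity (\int[@lebesgue_measure R]_(r in `[q x, t]) (w r)%:E).
      rewrite [RHS]integral_mkcond; apply: eq_integral => r _.
      rewrite patchE /f indicE; rewrite mem_setE in_itv/=; case: ifPn => qr; first by rewrite mem_set// mul1r.
      by rewrite memNset ?mul0r// => -[_]; exact/negP.
    have dF r : (q x <= r <= t)%R ->
        is_derive r 1%R (fun r => - (r ^+ k.+1)^-1)%R (w r).
      by move=> /andP[qr _]; apply: is_derive_expV; exact: lt_le_trans qr.
    have cw r : (q x <= r <= t)%R -> {for r, continuous w}.
      move=> /andP[qr _].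
      have r0 : (r ^+ k.+2 != 0)%R by rewrite expf_neq0// gt_eqF// (lt_le_trans qx0).
      apply: cvgM; first exact: cvg_cst.
      by apply: cvgV => //; exact: exprn_continuous.
    by rewrite (integral_itv_is_derive qxt dF cw) opprK addrC.
  apply: integral0_eq => r _; rewrite /f indicE memNset ?mul0r//= => -[/= a /andP[b e]].
  by move/negP : qx; apply; rewrite a (le_trans b).
have rho0 : rho [set x | (q x <= 0)%R] = 0.
  have le0 s : (0 < s <= t)%R -> rho [set x | (q x <= 0)%R] <= (c * s ^+ (k.+1 + m.+1))%:E.
    move=> st; rewrite -rhoE//; apply: le_measure; rewrite ?inE//.
    by move=> x /= /le_trans; apply; case/andP : st => /ltW.
  have := le0 _ (introT andP (conj t0 (lexx t))).
  have : 0 <= rho [set x | (q x <= 0)%R] by [].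
  move: le0; case: (rho _) => // a le0; rewrite lee_fin => a0 _.
  apply/eqP; rewrite eqe eq_le a0 andbT leNgt; apply/negP => a1.
  (* With [s <= 1], the bound is at most [c s]; the factor 2 makes it less than
     [a], and the 1 keeps the denominator positive when [c = 0]. *)
  pose s := Num.min (Num.min t 1)%R (a / (2 * c + 1))%R.
  have d0 : (0 < 2 * c + 1)%R by lra.
  have s0 : (0 < s)%R by rewrite !lt_min t0 ltr01 divr_gt0.
  have st : (0 < s <= t)%R by rewrite s0 !ge_min lexx.
  have s1 : (s <= 1)%R by rewrite !ge_min lexx orbT.
  have sa : (s * (2 * c + 1) <= a)%R by rewrite -ler_pdivlMr// !ge_min lexx orbT.
  have := le0 _ st; rewrite lee_fin addSn exprS => le1.
  have : (s * s ^+ (k + m.+1) <= s)%R by apply: ler_piMr; [exact: ltW|apply: exprn_ile1 => //; exact: ltW].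
  nra.
have H2 r : \int[rs]_x f (x, r) =
    if (0 < r <= t)%R then (c * k.+1%:R * r ^+ m)%:E else 0.
  case: ifPn => [/andP[r0 rt]|rt]; last first.
    apply: integral0_eq => x _; rewrite /f indicE memNset ?mul0r//= => -[/= a /andP[b e]].
    by move/negP : rt; apply; rewrite e (lt_le_trans a).
  pose A := [set x | (0 < q x)%R] `&` [set x | (q x <= r)%R].
  have mA : measurable A.
    apply: measurableI => //.
    rewrite (_ : [set _ | _] = q @^-1` `]0%R, +oo[%classic).
      by apply: measurable_preimage => //; exact: measurable_itv.
    by apply/seteqP; split => x /=; rewrite in_itv/= andbT.
  have rA : rho A = (c * r ^+ (k.+1 + m.+1))%:E.
    rewrite -rhoE ?r0//.
    rewrite [in RHS](_ : [set x | (q x <= r)%R] = A `|` [set x | (q x <= 0)%R]).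
      by rewrite measureU0//; apply/eqP; rewrite eq_le.
    apply/seteqP; split => x /=; rewrite /A/=.
      by move=> qr; have [|] := ltP 0%R (q x); [left|right].
    by move=> [[]//|/le_trans]; apply; exact: ltW.
  transitivity (\int[rs]_x ((w r)%:E * (\1_A x)%:E)).
    apply: eq_integral => x _; rewrite /f -EFinM mulrC; congr (_ * _)%:E.
    rewrite !indicE; congr ((nat_of_bool _)%:R); apply/idP/idP; rewrite !inE /E /A/=.
      by move=> [? /andP[]].
    by move=> [? ->]; rewrite rt.
  have w0 : (0 <= w r)%R by rewrite divr_ge0// exprn_ge0// ltW.
  rewrite ge0_integralZl//; last exact/measurable_EFinP/measurable_indic.
  rewrite integral_indic// setIT.
  have rsA : rs A = rho A.
    rewrite /rs/= /sigma_finite_alias/= /rho' /mrestr/=; congr (rho _).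
    by apply/setIidPl => x [_ /= qr]; exact: le_trans qr rt.
  rewrite [X in _ * X]rsA rA -EFinM; congr EFin; rewrite /w.
  rewrite addSnnS exprD !exprS; have : (r != 0)%R by rewrite gt_eqF.
  move=> rn0; field; by rewrite rn0 expf_neq0.
have mh : measurable_fun setT h.
  rewrite (_ : h = fubini_F lebesgue_measure f).
    exact: measurable_fun_fubini_tonelli_F.
  by apply/funext => x; rewrite -H1.
have h0 x : 0 <= h x by rewrite -H1; exact: integral_ge0.
have Ih : \int[rho]_(x in D) h x = (c * k.+1%:R * (t ^+ m.+1 / m.+1%:R))%:E.
  transitivity (\int[rs]_x h x).
    rewrite [RHS](_ : _ = \int[rs]_(x in D) h x).
      apply: eq_measure_integral => A mA AD.
      by rewrite /rs/= /sigma_finite_alias/= /rho' /mrestr/=; congr (rho _); apply/esym/setIidPl.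
    rewrite [RHS]integral_mkcond; apply: eq_integral => x _; rewrite patchE.
    case: ifPn => //; rewrite notin_setE /D/= /h => /negP/negbTE ->.
    by rewrite andbF.
  under eq_integral do rewrite -H1.
  rewrite (fubini_tonelli f)//.
  under eq_integral do rewrite H2.
  transitivity (\int[@lebesgue_measure R]_(r in `]0%R, t]) (c * k.+1%:R * r ^+ m)%:E).
    rewrite [RHS]integral_mkcond; apply: eq_integral => r _; rewrite patchE.
    by rewrite mem_setE in_itv.
  rewrite integral_itv_obnd_cbnd; last first.
    apply: measurable_funTS; apply/measurable_EFinP; apply: measurable_funM => //.
  have dF r : (0 <= r <= t)%R -> is_derive r 1%R
      (fun r => c * k.+1%:R * (r ^+ m.+1 / m.+1%:R))%R (c * k.+1%:R * r ^+ m)%R.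
    move=> _; have dZ := is_deriveZ (c * k.+1%:R)%R (is_derive_exp m r).
    exact: (is_derive_eq dZ).
  have cF r : (0 <= r <= t)%R ->
      {for r, continuous (fun s : R => c * k.+1%:R * s ^+ m)%R}.
    by move=> _; apply: cvgM; [exact: cvg_cst|exact: exprn_continuous].
  rewrite (integral_itv_is_derive (ltW t0) dF cF).
  by rewrite expr0n/= mul0r mulr0 subr0.
transitivity (\int[rho]_(x in D) (((t ^+ k.+1)^-1)%:E + h x)).
  apply: ge0_ae_eq_integral => //.
  - exact: mD.
  - by apply: measurable_funTS; apply/measurable_EFinP; exact: measurable_exprV.
  - by apply: measurable_funTS; apply: emeasurable_funD.
  - by move=> x _; rewrite lee_fin invr_ge0 exprn_ge0.
  - by move=> x _; rewrite adde_ge0// lee_fin invr_ge0 exprn_ge0// ltW.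
  exists [set x | (q x <= 0)%R]; split => // x /= /not_implyP[Dx].
  apply: contra_notP => /negP; rewrite -ltNge => qx0.
  by rewrite /h qx0 /= Dx -EFinD addrC subrK.
rewrite ge0_integralD//; last 3 first.
- exact: mD.
- by move=> x _; rewrite lee_fin invr_ge0 exprn_ge0// ltW.
- exact: measurable_funTS.
rewrite integral_cst ?Ih ?rhoE ?t0 ?lexx//; last exact: mD.
rewrite -!EFinM -EFinD; congr EFin.
rewrite natrD !exprD; have : (t != 0)%R by rewrite gt_eqF.
have m0 : (m.+1%:R != 0 :> R)%R by rewrite pnatr_eq0.
by move=> tn0; field; rewrite -natr1 addrC in m0; rewrite m0 expf_neq0.
Qed.

End radial.

(** * Star bodies and their Minkowski functionals *)

Section star.
Context {R : realType} {n : nat}.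
Implicit Types (D : set 'rV[R]_n) (x y u : 'rV[R]_n).

Lemma at_most_two T (A : set T) (p q r : T) : (A #= `I_2)%card ->
  A p -> A q -> A r -> [\/ p = q, q = r | p = r].
Proof.
move=> /eq_cardSP[x Ax /eq_cardSP[y [Ay yx]]]; rewrite II0 card_eq0 => /eqP E.
have H z : A z -> z = x \/ z = y.
  move=> Az; have [->|zx] := pselect (z = x); first by left.
  have [->|zy] := pselect (z = y); first by right.
  by suff : set0 z by []; rewrite -E; split.
move=> /H[->|->] /H[->|->] /H[->|->];
  by [constructor 1|constructor 2|constructor 3].
Qed.

Lemma coord_le_norm x i : `|x 0 i| <= `|x|.
Proof.
by rewrite [leRHS]/Num.norm /= mx_normrE; apply/bigmax_geP; right => /=; exists (0, i).
Qed.

(** Otherwise the parameters [s] of the segment with [s u] in [D] form a subset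
that is open, closed and, as it separates the end points, neither empty nor
full. *)
Lemma boundary_crossing D u (a b : R) : closed D -> a <= b ->
  ~ (D (a *: u) <-> D (b *: u)) ->
  exists2 s, a <= s <= b & boundary D (s *: u).
Proof.
move=> cD ab nab; apply: contrapT => /forall2NP nb; apply: nab.
have cs : continuous (fun s : R => s *: u) by move=> s; exact: scalel_continuous.
pose B := `[a, b]%classic `&` [set s : R | D (s *: u)].
have DB s : a <= s <= b -> D (s *: u) -> D° (s *: u).
  move=> sab Ds; have [/negP//|nbs] := nb s.
  by apply: contrapT => Dis; apply: nbs; split => //; exact: subset_closure.
have BT : B !=set0 -> B = `[a, b]%classic.
  move=> B0; apply: (@segment_connected R a b B) => //.
    exists ((fun s : R => s *: u) @^-1` D°).
      by apply: open_comp => //; exact: open_interior.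
    apply/seteqP; split => s [sab /= Ds]; split => //=; last exact: interior_subset.
    by apply: DB => //; move: sab; rewrite /= in_itv.
  exists ((fun s : R => s *: u) @^-1` D) => //.
  by apply: closed_comp.
split => Dx.
  have : B b by rewrite BT; [|exists a; split => //=]; rewrite /= in_itv/= lexx ab.
  by case.
have : B a by rewrite BT; [|exists b; split => //=]; rewrite /= in_itv/= lexx ab.
by case.
Qed.

Lemma star_body0 D : star_body D -> D 0.
Proof. by case=> _ _ _ + _ => /interior_subset. Qed.

Let invr_ge1_lt1 (a : R) : 0 < a -> a < 1 -> 1 <= a^-1.
Proof. by move=> a0 a1; rewrite -[leRHS]mul1r ler_pdivlMr// mul1r; exact: ltW. Qed.

(** A star body is star-shaped: if [x = a y] were outside [D], the line through
[x] would cross the boundary between [0] and [x], between [x] and [y], and, [D]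
being bounded, on the opposite ray. *)
Lemma star_body_scale D (a : R) y : star_body D -> 0 <= a < 1 -> D y -> D (a *: y).
Proof.
move=> sD /andP[a0 a1] Dy; have D0 := star_body0 sD.
have [cD bD line i0 _] := sD.
move: a0; rewrite le_eqVlt => /predU1P[<-|a0]; first by rewrite scale0r.
apply: contrapT; have [x xE] : exists x, x = a *: y by exists (a *: y).
rewrite -xE => Dx.
have x0 : x != 0 by apply/eqP => x0; rewrite x0 in Dx.
have nbd p : boundary D p -> p <> 0 /\ p <> x.
  move=> [cp ip]; split=> p0; rewrite p0 in cp ip; first exact: ip.
  by apply: Dx; rewrite ((closure_id D).1 cD).
have [M M0 DM] := ex_strict_bound_gt0 bD.
have [s1 /andP[s10 s11] bs1] : exists2 s, 0 <= s <= 1 & boundary D (s *: x).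
  by apply: boundary_crossing => //; rewrite scale0r scale1r; case=> /(_ D0).
have [s2 /andP[s21 s22] bs2] : exists2 s, 1 <= s <= a^-1 & boundary D (s *: x).
  apply: (boundary_crossing cD (invr_ge1_lt1 a0 a1)).
  rewrite scale1r [X in a^-1 *: X]xE scalerA mulVf ?gt_eqF// scale1r.
  by case=> _ /(_ Dy).
(* At [- c *: x] the norm reaches the bound [M] of [D]. *)
pose c := M / `|x|.
have c0 : 0 < c by rewrite divr_gt0// normr_gt0.
have [s3 /andP[s31 s32] bs3] : exists2 s, - c <= s <= 0 & boundary D (s *: x).
  have c0' : - c <= 0 by rewrite oppr_le0; exact: ltW.
  apply: (boundary_crossing cD c0').
  rewrite scale0r => -[_ /(_ D0) /DM /=]; rewrite normrZ normrN gtr0_norm//.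
  by rewrite /c divfK ?ltxx// normr_eq0.
have inj s s' : s *: x = s' *: x -> s = s'.
  move=> /eqP; rewrite -subr_eq0 -scalerBl scaler_eq0 (negbTE x0) orbF subr_eq0.
  by move/eqP.
have sb s : boundary D (s *: x) -> (s != 0) /\ (s != 1).
  by move=> /nbd[p0 p1]; split; apply/eqP => s0;
    [apply: p0; rewrite s0 scale0r|apply: p1; rewrite s0 scale1r].
have S s : boundary D (s *: x) -> [set x0 | [/\ boundary D x0, x0 != 0 & exists t : R, x0 = t *: x]] (s *: x).
  move=> bs; split => //; last by exists s.
  by rewrite scaler_eq0 (negbTE x0) orbF; have [] := sb _ bs.
have [s1n0 s1n1] := sb _ bs1; have [_ s2n1] := sb _ bs2; have [s3n0 _] := sb _ bs3.
by have [/inj|/inj|/inj] := at_most_two (line _ x0) (S _ bs1) (S _ bs2) (S _ bs3);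
  move=> E; move: s1n0 s1n1 s2n1 s3n0 => /eqP ? /eqP ? /eqP ? /eqP ?; lra.
Qed.

Lemma star_body_nonempty D x : star_body D ->
  [set a | 0 <= a /\ exists2 y, D y & x = a *: y] !=set0.
Proof.
move=> [_ _ _ i0 _].
have cs : continuous (fun s : R => s *: x) by move=> s; exact: scalel_continuous.
have := cs 0 D; rewrite /= scale0r => /(_ i0) /nbhs_ballP[e /= e0 eD].
have e2 : 0 < e / 2 by rewrite divr_gt0.
exists (e / 2)^-1; split; first by rewrite invr_ge0 ltW.
exists ((e / 2) *: x); last by rewrite scalerA mulVf ?scale1r// gt_eqF.
by apply: eD; rewrite /ball/= sub0r normrN gtr0_norm//; lra.
Qed.

Lemma minkowski_has_lbound D x :
  has_lbound [set a : R | 0 <= a /\ exists2 y, D y & x = a *: y].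
Proof. by exists 0 => a []. Qed.

Lemma minkowski_le D x y (a : R) : 0 <= a -> D y -> x = a *: y -> Defs.minkowski D x <= a.
Proof.
by move=> a0 Dy xy; apply: ge_inf; [exact: minkowski_has_lbound|split => //; exists y].
Qed.

Lemma minkowski_ge0 D x : 0 <= Defs.minkowski D x.
Proof.
rewrite /Defs.minkowski; set S := [set a | _].
have [->|S0] := eqVneq S set0; first by rewrite inf0.
by apply: lb_le_inf; [exact/set0P|move=> a []].
Qed.

Lemma minkowski_lt D x (a : R) : star_body D -> Defs.minkowski D x < a ->
  exists2 b, 0 <= b < a & exists2 y, D y & x = b *: y.
Proof.
move=> sD /inf_lt [|b [b0 Sb] ba]; last by exists b; rewrite ?b0.
exact: star_body_nonempty.
Qed.

Lemma minkowskiZ_le D x (t : R) : star_body D -> 0 < t ->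
  Defs.minkowski D (t *: x) <= t * Defs.minkowski D x.
Proof.
move=> sD t0; apply/ler_addgt0Pr => e e0.
have [|b /andP[b0 be] [y Dy xy]] := @minkowski_lt D x (Defs.minkowski D x + e / t) sD.
  by rewrite ltrDl divr_gt0.
apply: (@le_trans _ _ (t * b)).
  apply: (minkowski_le _ Dy); first by rewrite mulr_ge0// ltW.
  by rewrite xy scalerA.
rewrite (le_trans (ler_wpM2l (ltW t0) (ltW be)))// mulrDr lerD2l mulrC divfK//.
by rewrite gt_eqF.
Qed.

Lemma minkowskiZ D x (t : R) : star_body D -> 0 < t ->
  Defs.minkowski D (t *: x) = t * Defs.minkowski D x.
Proof.
move=> sD t0; apply/eqP; rewrite eq_le minkowskiZ_le//=.
rewrite -ler_pdivlMl//; have ti : 0 < t^-1 by rewrite invr_gt0.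
by have := minkowskiZ_le (t *: x) sD ti; rewrite scalerA mulVf ?scale1r// gt_eqF.
Qed.

Lemma minkowski_le1 D x : D x -> Defs.minkowski D x <= 1.
Proof. by move=> Dx; apply: (minkowski_le _ Dx); rewrite ?scale1r. Qed.

(** Where the functional is 1, the points [s x] with [s < 1] are in [D] because
[D] is star-shaped, and they converge to [x]. *)
Lemma minkowski_le1E D : star_body D -> [set x | Defs.minkowski D x <= 1] = D.
Proof.
move=> sD; apply/seteqP; split => x /=; last exact: minkowski_le1.
move=> x1; apply: contrapT => nDx.
have [cD _ _ _ _] := sD.
have cs : continuous (fun s : R => s *: x) by move=> s; exact: scalel_continuous.
have oD := closed_openC cD.
have := cs 1 (~` D); rewrite /= scale1r => /(_ (open_nbhs_nbhs (conj oD nDx))).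
move=> /nbhs_ballP[e /= e0 eD].
(* A factor below 1, positive, and within [e] of 1. *)
pose s := Num.max (1 - e / 2) (1 / 2).
have s1 : s < 1 by rewrite gt_max; apply/andP; split; lra.
have s0 : 0 < s by rewrite lt_max; apply/orP; right; lra.
apply: (eD s).
  have : 1 - e / 2 <= s by rewrite le_max lexx.
  by rewrite /ball/= ger0_norm; lra.
have [|b /andP[b0 b1] [y Dy ->]] := @minkowski_lt D (s *: x) 1 sD.
  by rewrite minkowskiZ// (le_lt_trans _ s1)// ger_pMr.
by apply: star_body_scale => //; rewrite b0.
Qed.

Lemma minkowski_gt0 D x : star_body D -> x != 0 -> 0 < Defs.minkowski D x.
Proof.
move=> sD x0; have [_ bD _ _ _] := sD.
have [M M0 DM] := ex_strict_bound_gt0 bD.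
have nx : 0 < `|x| by rewrite normr_gt0.
apply: (@lt_le_trans _ _ (`|x| / M)); first by rewrite divr_gt0.
apply: lb_le_inf; first exact: star_body_nonempty.
move=> a [a0 [y Dy ->]]; rewrite normrZ ger0_norm// ler_pdivrMr//.
by rewrite ler_wpM2l// ltW// DM.
Qed.

Lemma measurable_star_body D : star_body D -> measurable D.
Proof. by case=> cD _ _ _ _; exact: closed_measurable_mx. Qed.

Lemma measurable_minkowski D : star_body D -> measurable_fun setT (Defs.minkowski D).
Proof. by case=> _ _ _ _ cD; exact: continuous_measurable_mx. Qed.

Lemma star_body_cube D : star_body D -> exists2 a, 0 <= a & D `<=` cube a.
Proof.
case=> _ bD _ _ _; have [M M0 DM] := ex_strict_bound_gt0 bD.
exists M; first exact: ltW.
by move=> x Dx i; rewrite (le_trans (coord_le_norm _ _))// ltW// DM.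
Qed.

Lemma star_body_euball D : star_body D -> exists2 a, 0 < a & D `<=` euball a.
Proof.
move=> /star_body_cube[a a0 Da]; exists (1 + \sum_(i < n) a).
  by rewrite ltr_wpDr// sumr_ge0.
move=> x /Da xa; rewrite /euball/= (le_trans (enorm_le_sum _))//.
by rewrite (@le_trans _ _ (\sum_(i < n) a)) ?ler_sum// lerDr.
Qed.

Lemma lebesgue_star_body_lty D : star_body D -> (lebesgue D < +oo)%E.
Proof.
move=> sD; have [a a0 Da] := star_body_cube sD.
apply: (@le_lt_trans _ _ (lebesgue (@cube R n a))); last by rewrite lebesgue_cube ?ltry.
by apply: le_lebesgue => //; [exact: measurable_star_body|exact: measurable_cube].
Qed.

Lemma lebesgue_star_body_gt0 D : star_body D -> (0 < lebesgue D)%E.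
Proof.
move=> sD; have [_ _ _ /nbhs_ballP[e /= e0 eD] _] := sD.
have e2 : 0 < e / 2 by rewrite divr_gt0.
apply: (@lt_le_trans _ _ (lebesgue (@cube R n (e / 2)))).
  by rewrite lebesgue_cube ?ltW// lte_fin exprn_gt0// mulr_gt0.
apply: le_lebesgue; [exact: measurable_cube|exact: measurable_star_body|].
move=> x xe; apply: eD; split => // i j; rewrite !mxE (ord1 i) /ball/= sub0r normrN.
by rewrite (le_lt_trans (xe j))//; lra.
Qed.

(** The sublevel set is the dilate [s D]. *)
Lemma lebesgue_minkowski_le D (s : R) : star_body D -> 0 < s ->
  lebesgue [set x | Defs.minkowski D x <= s] = ((s ^+ n)%:E * lebesgue D)%E.
Proof.
move=> sD s0; have si : 0 < s^-1 by rewrite invr_gt0.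
rewrite (_ : [set _ | _] = (fun x => s^-1 *: x) @^-1` D).
  by rewrite lebesgue_homothety// ?exprVn ?invrK//; exact: measurable_star_body.
rewrite -[in RHS](minkowski_le1E sD); apply/seteqP; split => x /=;
by rewrite minkowskiZ// mulrC ler_pdivrMr// mul1r.
Qed.

End star.

(** * Measures with a density and mixtures of measures *)

Section integral_functional.
Context d (T : measurableType d) {R : realType}.
Variables (m : {measure set T -> \bar R}) (J : (T -> \bar R) -> \bar R).
Local Open Scope ereal_scope.

Hypothesis J_indic : forall (r : R) A, (0 <= r)%R -> measurable A ->
  J (fun x => (r * \1_A x)%:E) = r%:E * m A.
Hypothesis J_add : forall f g : T -> \bar R,
  measurable_fun setT f -> measurable_fun setT g ->
  (forall x, 0 <= f x) -> (forall x, 0 <= g x) ->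
  J (fun x => f x + g x) = J f + J g.
Hypothesis J_lim : forall f : nat -> T -> \bar R,
  (forall n, measurable_fun setT (f n)) -> (forall n x, 0 <= f n x) ->
  (forall x, nondecreasing_seq (f ^~ x)) ->
  J (fun x => limn (f ^~ x)) = limn (fun n => J (f n)).

Import HBNNSimple.

(** A non-negative simple function is the sum, over all its values, of the value
times the indicator of its level set.  A negative value in the list is
harmless because its level set is empty. *)
Let J_sum (s : seq R) (A : R -> set T) :
  (forall y, measurable (A y)) -> (forall y, (0 <= y)%R \/ A y = set0) ->
  J (fun x => (\sum_(y <- s) y * \1_(A y) x)%:E) = \int[m]_x (\sum_(y <- s) y * \1_(A y) x)%:E.
Proof.
move=> mA A0; elim: s => [|y s IHs].
  rewrite integral0_eq; last by move=> x _; rewrite big_nil.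
  rewrite -[RHS](mul0e (m set0)) -J_indic//; congr J.
  by apply/funext => x; rewrite big_nil mul0r.
have y0 z x : (0 <= z * \1_(A z) x)%R.
  have [z0|->] := A0 z; first by rewrite mulr_ge0.
  by rewrite indicE in_set0 mulr0.
have ms z : measurable_fun setT (fun x => (z * \1_(A z) x)%R).
  by apply: measurable_funM => //; exact: measurable_indic.
have msum : measurable_fun setT (fun x => (\sum_(z <- s) z * \1_(A z) x)%R).
  by apply: measurable_sum.
have sum0 x : (0 <= \sum_(z <- s) z * \1_(A z) x)%R.
  by apply: sumr_ge0 => z _.
rewrite [in LHS](_ : (fun x => _) = fun x => (y * \1_(A y) x)%:E +
    (\sum_(z <- s) z * \1_(A z) x)%:E); last first.
  by apply/funext => x; rewrite big_cons EFinD.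
under [in RHS]eq_integral do rewrite big_cons EFinD.
rewrite J_add; [|exact/measurable_EFinP|exact/measurable_EFinP|
  by move=> x; rewrite lee_fin|by move=> x; rewrite lee_fin].
rewrite ge0_integralD//; [|by move=> x _; rewrite lee_fin|exact/measurable_EFinP
  |by move=> x _; rewrite lee_fin|exact/measurable_EFinP].
rewrite IHs; congr (_ + _).
have [yge0|Ay] := A0 y.
  rewrite J_indic//; under [in RHS]eq_integral do rewrite EFinM.
  rewrite ge0_integralZl//; last exact/measurable_EFinP/measurable_indic.
  by rewrite integral_indic// setIT.
rewrite [in RHS]integral0_eq; last by move=> x _; rewrite Ay indicE in_set0 mulr0.
rewrite -[RHS](mul0e (m set0)) -J_indic//; congr J.
by apply/funext => x; rewrite Ay indicE in_set0 mulr0 mul0r.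
Qed.

(** The approximation of a measurable function by simple functions, done once:
integration against a restriction, a density or a mixture is recognised by its
value on indicators, additivity and monotone convergence. *)
Lemma integral_functional (f : T -> \bar R) :
  measurable_fun setT f -> (forall x, 0 <= f x) -> \int[m]_x f x = J f.
Proof.
move=> mf f0.
pose g := nnsfun_approx measurableT mf.
have Jg n : J (EFin \o g n) = \int[m]_x (g n x)%:E.
  have E : EFin \o g n = fun x =>
     (\sum_(y <- finmap.enum_fset (fset_set (range (g n)))) y * \1_(g n @^-1` [set y]) x)%:E.
    by apply/funext => x /=; rewrite fimfunE fsbig_finite.
  rewrite -[in RHS](_ : EFin \o g n = fun x => (g n x)%:E)// E; apply: J_sum => // y.
  have [y0|y0] := leP 0%R y; [by left|right].
  by rewrite preimage_nnfun0.
have mg n : measurable_fun setT (EFin \o g n) by exact/measurable_EFinP.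
have g0 n x : 0 <= (EFin \o g n) x by rewrite lee_fin.
have nd x : nondecreasing_seq (fun n => (EFin \o g n) x).
  by move=> a b ab; rewrite lee_fin; exact/lefP/nd_nnsfun_approx.
have fE : f = fun x => limn (fun n => (EFin \o g n) x).
  by apply/funext => x; apply/esym/cvg_lim => //; exact: cvg_nnsfun_approx.
rewrite [in RHS]fE J_lim//.
under [in RHS]eq_fun do rewrite Jg.
rewrite -monotone_convergence//.
- by apply: eq_integral => x _; rewrite {1}fE.
- by move=> n x _; exact: g0.
- by move=> x _; exact: nd.
Qed.

End integral_functional.

Section density.
Context d (T : measurableType d) {R : realType}.
Variables (mu : {measure set T -> \bar R}) (w : T -> R).
Hypotheses (mw : measurable_fun setT w) (w0 : forall x, 0 <= w x).
Local Open Scope ereal_scope.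

(** The measurability and the sign of [w] are arguments so that the term itself
carries the structure of a measure; likewise for [mixture]. *)
Definition with_density of measurable_fun setT w & (forall x, (0 <= w x)%R) :
  set T -> \bar R := fun A => \int[mu]_(x in A) (w x)%:E.

Let density0 : with_density mw w0 set0 = 0.
Proof. exact: integral_set0. Qed.

Let density_ge0 A : 0 <= with_density mw w0 A.
Proof. by apply: integral_ge0 => x _; rewrite lee_fin. Qed.

Let density_sigma_additive : semi_sigma_additive (with_density mw w0).
Proof.
apply: semi_sigma_additive_nng_induced; first exact/measurable_EFinP.
by move=> x; rewrite lee_fin.
Qed.

HB.instance Definition _ := isMeasure.Build _ _ _ (with_density mw w0)
  density0 density_ge0 density_sigma_additive.

Lemma integral_with_density (f : T -> \bar R) :
  measurable_fun setT f -> (forall x, 0 <= f x) ->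
  \int[with_density mw w0]_x f x = \int[mu]_x (f x * (w x)%:E).
Proof.
have mwE : measurable_fun setT (EFin \o w) by exact/measurable_EFinP.
have w0E x : 0 <= (w x)%:E by rewrite lee_fin.
move=> mf f0; apply: (integral_functional (J := fun f => \int[mu]_x (f x * (w x)%:E))) => //.
- move=> r A r0 mA; under eq_integral do rewrite EFinM -muleA.
  rewrite ge0_integralZl//; last 2 first.
  + apply: emeasurable_funM => //; exact/measurable_EFinP/measurable_indic.
  + by move=> x _; rewrite mule_ge0// lee_fin.
  congr (_ * _); rewrite /= /with_density [in RHS]integral_mkcond.
  by apply: eq_integral => x _; rewrite epatch_indic muleC.
- move=> g h mg mh g0 h0; under eq_integral do rewrite ge0_muleDl//.
  rewrite ge0_integralD//.
  + by move=> x _; rewrite mule_ge0.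
  + exact: emeasurable_funM.
  + by move=> x _; rewrite mule_ge0.
  + exact: emeasurable_funM.
- move=> g mg g0 nd.
  rewrite -monotone_convergence//.
  + apply: eq_integral => x _; rewrite muleC -limeMl//.
      by congr (limn _); apply/funext => n; rewrite muleC.
    exact: ereal_nondecreasing_is_cvgn.
  + by move=> n; apply: emeasurable_funM.
  + by move=> n x _; rewrite mule_ge0.
  + by move=> x _ a b ab; rewrite lee_wpmul2r//; exact: nd.
Qed.

End density.

Section mixture.
Context d1 d2 (X : measurableType d1) (T : measurableType d2) {R : realType}.
Variables (nu : {measure set X -> \bar R}) (ker : X -> {measure set T -> \bar R}).
Local Open Scope ereal_scope.
Hypothesis mker : forall A, measurable A -> measurable_fun setT (fun x => ker x A).

Definition mixture of (forall A, measurable A -> measurable_fun setT (fun x => ker x A)) :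
  set T -> \bar R := fun A => \int[nu]_x ker x A.

Let mixture0 : mixture mker set0 = 0.
Proof. by rewrite /mixture integral0_eq. Qed.

Let mixture_ge0 A : 0 <= mixture mker A.
Proof. exact: integral_ge0. Qed.

Let mixture_sigma_additive : semi_sigma_additive (mixture mker).
Proof.
move=> F mF tF mUF; rewrite /mixture.
rewrite [X in _ --> X](_ : _ = \sum_(n <oo) \int[nu]_x ker x (F n)).
  by apply: is_cvg_ereal_nneg_natsum_cond => // n _ _; exact: integral_ge0.
rewrite -integral_nneseries//; last by move=> n; exact: mker.
by apply: eq_integral => x _; rewrite measure_semi_bigcup.
Qed.

HB.instance Definition _ := isMeasure.Build _ _ _ (mixture mker)
  mixture0 mixture_ge0 mixture_sigma_additive.

Lemma integral_mixture (f : T -> \bar R) :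
  measurable_fun setT f -> (forall x, 0 <= f x) ->
  \int[mixture mker]_y f y = \int[nu]_x \int[ker x]_y f y.
Proof.
have mi g : measurable_fun setT g -> (forall y, 0 <= g y) ->
    measurable_fun setT (fun x => \int[ker x]_y g y).
  by move=> mg g0; apply: measurable_fun_integral_kernel.
move=> mf f0.
apply: (integral_functional (J := fun f => \int[nu]_x \int[ker x]_y f y)) => //.
- move=> r A r0 mA.
  under eq_integral.
    move=> x _; under eq_integral do rewrite EFinM.
    rewrite ge0_integralZl//; last exact/measurable_EFinP/measurable_indic.
    by rewrite integral_indic// setIT; over.
  rewrite ge0_integralZl//; exact: mker.
- move=> g h mg mh g0 h0.
  under eq_integral do rewrite ge0_integralD//.
  rewrite ge0_integralD//.
  + by move=> x _; exact: integral_ge0.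
  + exact: mi.
  + by move=> x _; exact: integral_ge0.
  + exact: mi.
- move=> g mg g0 nd.
  under eq_integral do rewrite monotone_convergence//.
  rewrite monotone_convergence//.
  + by move=> n; exact: mi.
  + by move=> n x _; exact: integral_ge0.
  + by move=> x _ a b ab; apply: ge0_le_integral => //= y _; exact: nd.
Qed.

End mixture.

(** * Averages over the unit sphere of a subspace *)

Section sphere.
Context {R : realType}.

Lemma enormZ n (t : R) (x : 'rV[R]_n) : 0 <= t -> enorm (t *: x) = t * enorm x.
Proof.
move=> t0; rewrite /enorm -[X in X * _]ger0_norm// -sqrtr_sqr -sqrtrM ?sqr_ge0//.
by congr Num.sqrt; rewrite mulr_sumr; apply: eq_bigr => i _; rewrite mxE exprMn.
Qed.

Lemma enorm_ge0 n (x : 'rV[R]_n) : 0 <= enorm x.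
Proof. exact: sqrtr_ge0. Qed.

Lemma enorm_gt0 n (x : 'rV[R]_n) : x != 0 -> 0 < enorm x.
Proof. by move=> x0; rewrite lt_def enorm_ge0 andbT enorm_eq0. Qed.

Lemma enorm_unit_vector n (x : 'rV[R]_n) : x != 0 -> enorm (unit_vector x) = 1.
Proof.
move=> x0; rewrite /unit_vector enormZ ?invr_ge0 ?enorm_ge0//.
by rewrite mulVf// enorm_eq0.
Qed.

Lemma unit_vector_le1 n (x : 'rV[R]_n) i : `|unit_vector x 0 i| <= 1.
Proof.
have [->|x0] := eqVneq x 0.
  by rewrite /unit_vector scaler0 mxE normr0.
by rewrite -(enorm_unit_vector x0) coord_le_enorm.
Qed.

Lemma unit_vectorZ n (t : R) (x : 'rV[R]_n) : 0 < t ->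
  unit_vector (t *: x) = unit_vector x.
Proof.
move=> t0; rewrite /unit_vector enormZ ?ltW// scalerA invfM mulrAC mulVf ?mul1r//.
by rewrite gt_eqF.
Qed.

Lemma unit_vectorK n (x : 'rV[R]_n) : enorm x *: unit_vector x = x.
Proof.
rewrite /unit_vector scalerA.
have [->|x0] := eqVneq x 0; first by rewrite scaler0.
by rewrite divff ?scale1r// enorm_eq0.
Qed.

Lemma unit_vector_mulmx m n (B : 'M[R]_(m, n)) (y : 'rV[R]_m) :
  B *m B^T = 1%:M -> unit_vector (y *m B) = unit_vector y *m B.
Proof. by move=> BB; rewrite /unit_vector enorm_mulmx// scalemxAl. Qed.

Lemma measurable_unit_vector n : measurable_fun setT (@unit_vector R n).
Proof. exact: measurable_funPT. Qed.

Lemma measurable_singleton n (x : 'rV[R]_n) : measurable [set x].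
Proof.
apply: closed_measurable_mx; apply: accessible_closed_set1.
by apply: hausdorff_accessible; exact: (@norm_hausdorff R 'rV[R]_n).
Qed.

Local Open Scope ereal_scope.

(** The homothety of ratio 2 fixes the set and divides its volume. *)
Lemma lebesgue_singleton0S n : lebesgue [set 0%R : 'rV[R]_n.+1] = 0.
Proof.
have mS := @measurable_singleton n.+1 0%R.
have := @lebesgue_homothety R n.+1 2 _ (ltr0n _ 2) mS.
rewrite (_ : _ @^-1` _ = [set 0%R]); last first.
  apply/seteqP; split => x /= /eqP; rewrite ?scaler_eq0 ?pnatr_eq0/=; last first.
    by move=> /eqP ->; rewrite scaler0.
  by move/eqP.
have : lebesgue [set 0%R : 'rV[R]_n.+1] \is a fin_num.
  rewrite ge0_fin_numE ?measure_ge0//.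
  apply: (@le_lt_trans _ _ (lebesgue (@cube R n.+1 1))); last by rewrite lebesgue_cube ?ltry.
  apply: le_lebesgue => //; first exact: measurable_cube.
  by move=> x -> i; rewrite mxE normr0.
have : 0 <= lebesgue [set 0%R : 'rV[R]_n.+1] by exact: measure_ge0.
case: (lebesgue _) => // a; rewrite lee_fin => a0 _ [] E.
have e1 : ((2 ^+ n.+1)^-1 < 1 :> R)%R by rewrite invf_lt1 ?exprn_gt0// exprn_egt1// ltr1n.
by congr EFin; move: E e1; set e := (_ ^-1)%R => E e1; nra.
Qed.

Lemma integral_mrestr d (T : measurableType d) (mu : {measure set T -> \bar R})
    (D : set T) (mD : measurable D) (f : T -> \bar R) :
  measurable_fun setT f -> (forall x, 0 <= f x) ->
  \int[mrestr mu mD]_x f x = \int[mu]_(x in D) f x.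
Proof.
move=> mf f0; apply: (integral_functional (J := fun f => \int[mu]_(x in D) f x)) => //.
- move=> r A r0 mA; under eq_integral do rewrite EFinM.
  rewrite ge0_integralZl//; last by apply: measurable_funTS; exact/measurable_EFinP/measurable_indic.
  by rewrite integral_indic.
- move=> g h mg mh g0 h0; rewrite ge0_integralD//; exact: measurable_funTS.
- move=> g mg g0 nd; rewrite monotone_convergence//.
  by move=> i; exact: measurable_funTS.
Qed.

(** The surface measure of [A] is [m+1] times the volume of the cone over [A] in
the unit ball, so that integrals over the sphere are integrals over the ball of
functions of the direction.  The origin, which has no direction, is null. *)
Lemma integral_surface m (G : 'rV[R]_m.+1 -> \bar R) :
  measurable_fun setT G -> (forall x, 0 <= G x) ->
  \int[@surface R m.+1]_(y in @sphere R m.+1) G y =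
  m.+1%:R%:E * \int[@lebesgue R m.+1]_(y in @eball R m.+1) G (unit_vector y).
Proof.
move=> mG G0.
have mS : measurable (@sphere R m.+1).
  rewrite (_ : @sphere R m.+1 = (@enorm R m.+1) @^-1` [set 1%R]) //.
  by apply: measurable_preimage; [exact: measurable_enorm|exact: measurable_set1].
have mGD : measurable_fun (@sphere R m.+1) G.
  by apply: (@measurable_funTS _ _ _ _ (@sphere R m.+1) G).
have mGS : measurable_fun setT (G \_ (@sphere R m.+1)).
  exact: (measurable_restrictT G mS).1 mGD.
have GS0 x : 0 <= (G \_ (@sphere R m.+1)) x.
  by apply: erestrict_ge0 => z _; exact: G0.
rewrite integral_mkcond.
transitivity (m.+1%:R%:E *
    \int[@cone_volume R m.+1]_y (G \_ (@sphere R m.+1)) y).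
  exact: (ge0_integral_mscale (@cone_volume R m.+1) measurableT (m.+1%:R%:nng)%R mGS
    (fun x _ => GS0 x)).
have mu_ := @measurable_unit_vector m.+1.
have T := @ge0_integral_transfer _ _ _ _ R _
  (mrestr (@lebesgue R m.+1) (@measurable_eball R m.+1)) (@cone_volume R m.+1)
  _ mu_ (fun A _ => erefl) mGS GS0.
rewrite T integral_mrestr; last 2 first.
- exact: measurableT_comp mGS mu_.
- by move=> x; exact: GS0.
suff -> : \int[@lebesgue R m.+1]_(x in @eball R m.+1)
      (G \_ (@sphere R m.+1)) (unit_vector x) =
    \int[@lebesgue R m.+1]_(x in @eball R m.+1) G (unit_vector x) by [].
apply: ge0_ae_eq_integral.
- exact: measurable_eball.
- by apply: measurable_funTS; exact: measurableT_comp mGS mu_.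
- by apply: measurable_funTS; exact: measurableT_comp mG mu_.
- by move=> x _; exact: GS0.
- by move=> x _; exact: G0.
exists [set 0%R]; split.
- exact: measurable_singleton.
- exact: lebesgue_singleton0S.
move=> x /= ; apply: contra_notP => /eqP x0 _.
have xS : unit_vector x \in @sphere R m.+1.
  by rewrite inE; exact: enorm_unit_vector.
by rewrite patchE xS.
Qed.

(** When the rows of [B] are orthonormal, this is [1/m] times the integral of [F]
over the unit sphere of the row space of [B]. *)
Definition sphere_mean m n (F : 'rV[R]_n -> \bar R) (B : 'M[R]_(m, n)) :=
  \int[@lebesgue R m]_(y in @eball R m) F (unit_vector y *m B)%R.

Lemma measurable_unit_mulmx m n (B : 'M[R]_(m, n)) :
  measurable_fun setT (fun y => unit_vector y *m B)%R.
Proof. exact: measurableT_comp (measurable_mulmx B) (@measurable_unit_vector m). Qed.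

(** The mean depends on the row space only: two orthonormal frames of it differ
by an orthogonal factor (see [frame_change]). *)
Lemma sphere_mean_orthogonal m n (F : 'rV[R]_n -> \bar R) (Q : 'M[R]_m)
    (B : 'M[R]_(m, n)) :
  measurable_fun setT F -> (forall x, 0 <= F x) -> Q *m Q^T = 1%:M ->
  sphere_mean F (Q *m B) = sphere_mean F B.
Proof.
move=> mF F0 QQ; rewrite /sphere_mean integral_mkcond [RHS]integral_mkcond.
rewrite [RHS](ge0_integral_transfer (measurable_mulmx Q) (mu := @lebesgue R m))//.
- apply: eq_integral => y _; rewrite !patchE unit_vector_mulmx// -mulmxA.
  congr (if _ then _ else _); apply/idP/idP; rewrite !inE /eball/= enorm_mulmx//.
- by move=> A mA; exact/esym/lebesgue_orthogonal.
- apply: (measurable_restrictT _ (@measurable_eball R m)).1.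
  by apply: measurable_funTS; exact: measurableT_comp mF (measurable_unit_mulmx B).
- by move=> y; apply: erestrict_ge0 => z _; exact: F0.
Qed.

Local Open Scope ring_scope.

Lemma frame_span m n (B : 'M[R]_(m, n)) V (v : 'rV[R]_n) :
  orthonormal_basis B V -> v \in V -> v = v *m B^T *m B.
Proof.
move=> [BB <-] /coord_span; set c := coord _ => vE.
pose w : 'rV[R]_m := \row_i c i v.
have -> : v = w *m B.
  rewrite [LHS]vE mulmx_sum_row; apply: eq_bigr => i _.
  by rewrite mxE (nth_map i) ?nth_ord_enum// size_enum_ord.
by rewrite -(mulmxA w) BB mulmx1.
Qed.

Lemma frame_row m n (B : 'M[R]_(m, n)) V i : orthonormal_basis B V -> row i B \in V.
Proof. by case=> _ <-; apply: memv_span; apply/mapP; exists i => //; rewrite mem_enum. Qed.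

Lemma frame_change m n (B B' : 'M[R]_(m, n)) V :
  orthonormal_basis B V -> orthonormal_basis B' V ->
  exists2 Q : 'M[R]_m, Q *m Q^T = 1%:M & B' = Q *m B.
Proof.
move=> oB oB'; have E : B' = (B' *m B^T) *m B.
  apply/row_matrixP => i; rewrite !row_mul; apply: frame_span oB _; exact: frame_row.
exists (B' *m B^T) => //.
by rewrite trmx_mul trmxK mulmxA -E; case: oB'.
Qed.

End sphere.

(** * Ramp functions and measurability on the Grassmannian *)

Section ramp.
Context {R : realType} {n : nat}.
Implicit Types (a x y : 'rV[R]_n).

Definition orthant a : set 'rV[R]_n := [set x | forall i, x 0 i < a 0 i].

(** Positive exactly on the orthant, and Lipschitz; an empty minimum is 1, so that
this holds in dimension 0 too. *)
Definition gap a x : R := \big[Num.min/1]_i (a 0 i - x 0 i).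

(** Increases with [j] to the indicator of the orthant; Lipschitz for each [j]. *)
Definition ramp a (j : nat) x : R := Num.min 1 (j%:R * Num.max 0 (gap a x)).

Lemma gap_gt0 a x : (0 < gap a x) <-> orthant a x.
Proof.
split => [h i|h].
  rewrite -subr_gt0; apply: lt_le_trans h _; exact: bigmin_le_cond.
by apply: lt_bigmin => // i _; rewrite subr_gt0.
Qed.

Lemma ramp_ge0 a j x : 0 <= ramp a j x.
Proof. by rewrite le_min ler01 mulr_ge0// le_max lexx. Qed.

Lemma ramp_nondecreasing a x : nondecreasing_seq (ramp a ^~ x).
Proof.
move=> i j ij; rewrite le_min ge_min lexx/= ge_min; apply/orP; right.
by rewrite ler_wpM2r ?ler_nat// le_max lexx.
Qed.

Lemma cvg_ramp a x : ramp a ^~ x @ \oo --> (\1_(orthant a) x : R).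
Proof.
have [s0|s0] := ltP 0 (gap a x).
  rewrite indicE mem_set; last exact/gap_gt0.
  apply: cvg_near_cst; exists (Num.truncn (gap a x)^-1).+1 => // j /= sj.
  rewrite /ramp (max_idPr (ltW s0)); apply/min_idPl.
  rewrite -ler_pdivrMr// div1r; apply: le_trans (ltW (truncnS_gt _)) _.
  by rewrite ler_nat.
rewrite indicE memNset; last by move=> /gap_gt0; rewrite ltNge s0.
apply: cvg_near_cst; exists 0%N => // j _.
by rewrite /ramp (max_idPl s0) mulr0; apply/min_idPr; exact: ler01.
Qed.

Let min_lip (a b c d : R) : `|Num.min a b - Num.min c d| <= `|a - c| + `|b - d|.
Proof.
have h1 := ler_norm (a - c); have h2 := ler_norm (b - d).
have h3 := ler_norm (c - a); have h4 := ler_norm (d - b).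
rewrite (distrC c) (distrC d) in h3 h4.
rewrite ler_norml; case: (leP a b) => ab; case: (leP c d) => cd; apply/andP; split; lra.
Qed.

Lemma gap_lip a x y : `|gap a x - gap a y| <= \sum_i `|x 0 i - y 0 i|.
Proof.
rewrite /gap; elim/big_rec3 : _ => [|i u v w _ h]; first by rewrite subrr normr0.
apply: le_trans (min_lip _ _ _ _) _; rewrite lerD//.
by rewrite (_ : _ - (_ - y 0 i) = y 0 i - x 0 i) 1?distrC//; ring.
Qed.

Lemma ramp_lip a j x y :
  `|ramp a j x - ramp a j y| <= j%:R * \sum_i `|x 0 i - y 0 i|.
Proof.
rewrite /ramp; apply: le_trans (min_lip _ _ _ _) _.
rewrite subrr normr0 add0r -mulrBr normrM ger0_norm// ler_wpM2l//.
apply: le_trans (gap_lip a x y); set s := gap a x; set t := gap a y.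
have h1 := ler_norm (s - t); have h2 := ler_norm (t - s).
rewrite (distrC t) in h2.
by rewrite ler_norml; case: (leP 0 s) => ab; case: (leP 0 t) => cd; apply/andP; split; lra.
Qed.

Lemma ramp_continuous a j : continuous (ramp a j).
Proof.
move=> x; apply/(@cvgrPdist_lt _ _ _ (nbhs x)) => e e0.
have d0 : 0 < e / (j%:R * n%:R + 1) by rewrite divr_gt0// ltr_wpDl// mulr_ge0.
apply/nbhs_ballP; exists (e / (j%:R * n%:R + 1)) => //= y [_ xy].
apply: le_lt_trans (ramp_lip _ _ _ _) _.
apply: (@le_lt_trans _ _ (j%:R * \sum_(i < n) (e / (j%:R * n%:R + 1)))).
  by rewrite ler_wpM2l//; apply: ler_sum => i _; apply/ltW; exact: (xy 0 i).
rewrite sumr_const card_ord -[X in _ * X]mulr_natr.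
set E := e / _ in d0 *.
have -> : e = E * (j%:R * n%:R + 1) by rewrite /E divfK// gt_eqF// ltr_wpDl// mulr_ge0.
by rewrite mulrDr mulr1 mulrCA ltrDl.
Qed.

Lemma measurable_ramp a j : measurable_fun setT (ramp a j).
Proof. by apply: continuous_measurable_mx; exact: ramp_continuous. Qed.

Lemma measurable_orthant a : measurable (orthant a).
Proof.
rewrite (_ : orthant a = \bigcap_(i in [set: 'I_n])
    ((fun x : 'rV[R]_n => x 0 i) @^-1` `]-oo, a 0 i[%classic)).
  apply: fin_bigcap_measurable => // i _; apply: measurable_preimage.
    exact: measurable_coord.
  exact: measurable_itv.
apply/seteqP; split => x h i; first by move=> _; rewrite /= in_itv/=; exact: h.
by have := h i Logic.I; rewrite /= in_itv.
Qed.

End ramp.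

Section grass_measurability.
Context {R : realType}.
Local Open Scope ereal_scope.

(** For a unit vector [u], the coordinates of [u *m B] and [u *m B'] differ by at
most [m e], so that [h] differs by at most [C n m e]. *)
Lemma sphere_mean_dist m n (h : 'rV[R]_n -> R) (C e : R) (B B' : 'M[R]_(m, n)) :
  measurable_fun setT h -> (forall x, (0 <= h x)%R) -> (0 <= C)%R -> (0 <= e)%R ->
  (forall x y, (`|h x - h y| <= C * \sum_i `|x 0 i - y 0 i|)%R) ->
  (forall i j, (`|B i j - B' i j| <= e)%R) ->
  sphere_mean (EFin \o h) B <= sphere_mean (EFin \o h) B' +
    (C * (n%:R * (m%:R * e)))%:E * lebesgue (@eball R m).
Proof.
move=> mh h0 C0 e0 hl Be.
have mc (B0 : 'M[R]_(m, n)) : measurable_fun (@eball R m)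
    (fun y => (h (unit_vector y *m B0)%R)%:E).
  apply: measurable_funTS; apply/measurable_EFinP.
  exact: measurableT_comp mh (measurable_unit_mulmx B0).
have V0 : (0 <= C * (n%:R * (m%:R * e)))%R by rewrite !mulr_ge0.
rewrite /sphere_mean -integral_cst; last exact: measurable_eball.
rewrite -ge0_integralD//; last 3 first.
- exact: measurable_eball.
- by move=> y _; rewrite /= lee_fin h0.
- exact: mc.
apply: ge0_le_integral => //.
- exact: measurable_eball.
- by move=> y _; rewrite /= lee_fin h0.
- exact: mc.
- by apply: emeasurable_funD => //; exact: mc.
move=> y _; rewrite /= -EFinD lee_fin -lerBlDl.
apply: le_trans (ler_norm _) _; apply: le_trans (hl _ _) _; rewrite ler_wpM2l//.
apply: (@le_trans _ _ (\sum_(i < n) (m%:R * e))%R); last by rewrite sumr_const card_ord -[leLHS]mulr_natl.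
apply: ler_sum => j _; rewrite !mxE -sumrB.
apply: le_trans (ler_norm_sum _ _ _) _.
apply: (@le_trans _ _ (\sum_(i < m) e)%R); last by rewrite sumr_const card_ord -[leLHS]mulr_natl.
apply: ler_sum => i _; rewrite -mulrBr normrM -[leRHS]mul1r.
by rewrite ler_pM// unit_vector_le1.
Qed.

Lemma open_sphere_mean m n (h : 'rV[R]_n -> R) (C c : R) :
  measurable_fun setT h -> (forall x, (0 <= h x)%R) -> (0 <= C)%R ->
  (forall x y, (`|h x - h y| <= C * \sum_i `|x 0 i - y 0 i|)%R) ->
  open [set B : 'M[R]_(m, n) | c%:E < sphere_mean (EFin \o h) B].
Proof.
move=> mh h0 C0 hl; rewrite openE => B /= cB.
have [r r0 cr] : exists2 r : R, (0 < r)%R & (c + r)%:E < sphere_mean (EFin \o h) B.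
  move: cB; case: (sphere_mean _ B) => [p| |]//.
    rewrite lte_fin => cp; exists ((p - c) / 2)%R; first by rewrite divr_gt0// subr_gt0.
    by rewrite lte_fin; lra.
  by move=> _; exists 1%R => //; rewrite ltry.
have /fineK vE : lebesgue (@eball R m) \is a fin_num.
  by rewrite ge0_fin_numE ?measure_ge0// (@euball_lt_oo R m 1).
set v := fine _ in vE.
have v0 : (0 <= v)%R by rewrite fine_ge0// measure_ge0.
pose W := (C * (n%:R * m%:R) * v + 1)%R.
have W0 : (0 < W)%R by rewrite ltr_wpDl// !mulr_ge0.
apply/nbhs_ballP; exists (r / W)%R; first by rewrite /= divr_gt0.
move=> B' [_ BB'] /=.
have e0 : (0 <= r / W)%R by rewrite divr_ge0 ?ltW.
have := @sphere_mean_dist m n h C (r / W) B B' mh h0 C0 e0 hl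
  (fun i j => ltW (BB' i j)).
rewrite -vE -EFinM => le1.
have : (c + r)%:E < sphere_mean (EFin \o h) B' + r%:E.
  apply: lt_le_trans cr (le_trans le1 _); rewrite leeD2l// lee_fin.
  rewrite (_ : (C * (n%:R * (m%:R * (r / W))) * v)%R = (r * ((W - 1) / W))%R); last first.
    rewrite /W addrK; set V := (_ + 1)%R; ring.
  rewrite ger_pMr// ler_pdivrMr// mul1r; lra.
by rewrite EFinD lteD2rE.
Qed.

(** The open sets of the Grassmannian are those which are open in terms of all
orthonormal frames.  The mean is lower semicontinuous in the frame and the same
for all frames of [H], so that its superlevel sets are open, whatever the choice
of [grass_basis]. *)
Lemma measurable_sphere_mean n k (h : 'rV[R]_n -> R) (C : R) :
  measurable_fun setT h -> (forall x, (0 <= h x)%R) -> (0 <= C)%R ->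
  (forall x y, (`|h x - h y| <= C * \sum_i `|x 0 i - y 0 i|)%R) ->
  measurable_fun setT (fun H : grass R n k => sphere_mean (EFin \o h) (grass_basis H)).
Proof.
move=> mh h0 C0 hl.
apply: (measurability _ (ErealGenOInfty.measurableE R)) => _ [_ [c ->] <-].
rewrite setTI; apply: sub_sigma_algebra.
exists [set B : 'M[R]_(n - k, n) | c%:E < sphere_mean (EFin \o h) B].
  exact: open_sphere_mean hl.
move=> H B BH; have [Q QQ ->] := frame_change (grass_basisP H) BH.
rewrite /= in_itv/= andbT sphere_mean_orthogonal//.
exact/measurable_EFinP.
Qed.

End grass_measurability.

(** * Cones and the measures of sections *)

Section cones.
Context {R : realType} {n : nat}.
Implicit Types (a x : 'rV[R]_n).

Definition cone a (t : R) : set 'rV[R]_n :=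
  [set x | enorm x <= t /\ orthant a (unit_vector x)].

Definition cones : set (set 'rV[R]_n) := [set C | exists a t, C = cone a t].

Lemma measurable_cone a t : measurable (cone a t).
Proof.
apply: measurableI; first exact: measurable_euball.
apply: measurable_preimage; [exact: measurable_unit_vector|exact: measurable_orthant].
Qed.

(** The coordinates of a unit vector are less than 2. *)
Lemma cone2E t : cone (const_mx 2) t = euball t.
Proof.
apply/seteqP; split => x; first by case.
move=> xt; split => // i; rewrite [ltRHS]mxE; have := unit_vector_le1 x i.
by rewrite ler_norml => /andP[_ h]; lra.
Qed.

Lemma setI_closed_cones : setI_closed cones.
Proof.
move=> _ _ [a [s ->]] [b [t ->]].
exists (\row_i Num.min (a 0 i) (b 0 i)), (Num.min s t).
apply/seteqP; split => x.
  move=> [[xs xa] [xt xb]]; split; first by rewrite le_min xs xt.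
  by move=> i; rewrite [ltRHS]mxE lt_min xa xb.
move=> [xst xab]; move: xst; rewrite le_min => /andP[xs xt].
by split; split => // i; have := xab i; rewrite [ltRHS]mxE lt_min => /andP[].
Qed.

(** Both factors of [x = |x| (x / |x|)] are measurable for the sigma-algebra that
the cones generate, hence so is the identity map to the Borel sets. *)
Lemma measurable_cones : @measurable _ 'rV[R]_n = <<s cones >>.
Proof.
apply/seteqP; split; last first.
  apply: smallest_sub; first exact: sigma_algebra_measurable.
  by move=> _ [a [t ->]]; exact: measurable_cone.
pose Y := g_sigma_algebraType cones.
have mC a t : measurable (cone a t : set Y) by apply: sub_sigma_algebra; exists a, t.
have me : measurable_fun setT (fun x : Y => enorm (x : 'rV[R]_n)).
  apply: (measurability _ (RGenOInfty.measurableE R)) => _ [_ [t ->] <-].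
  rewrite setTI (_ : _ @^-1` _ = ~` (cone (const_mx 2) t : set Y)).
    by apply: measurableC; exact: mC.
  rewrite cone2E; apply/seteqP; split => x /=; rewrite in_itv/= andbT ltNge.
    by move/negP.
  by move/negP.
have mu i : measurable_fun setT (fun x : Y => unit_vector (x : 'rV[R]_n) 0 i).
  apply: (measurability _ (RGenInftyO.measurableE R)) => _ [_ [s ->] <-].
  pose a : 'rV[R]_n := \row_j (if j == i then s else 2).
  rewrite setTI (_ : _ @^-1` _ = \bigcup_(t : nat) (cone a t%:R : set Y)).
    by apply: bigcup_measurable => t _; exact: mC.
  apply/seteqP; split => x /=; rewrite in_itv/=; last first.
    by move=> [t _ [_ /(_ i)]]; rewrite [ltRHS]mxE eqxx.
  move=> xs; exists (Num.truncn (enorm x)).+1 => //; split.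
    exact/ltW/truncnS_gt.
  move=> j; rewrite [ltRHS]mxE; case: eqP => [->//|_].
  by have := unit_vector_le1 x j; rewrite ler_norml => /andP[_ h]; lra.
have mid : measurable_fun setT (fun x : Y => x : 'rV[R]_n).
  apply: measurable_rV => i.
  rewrite (_ : (fun x => _) = fun x : Y => enorm (x : 'rV[R]_n) * unit_vector (x : 'rV[R]_n) 0 i).
    exact: measurable_funM.
  by apply/funext => x; rewrite -[in LHS](unit_vectorK x) mxE.
by move=> A mA; have := mid measurableT A mA; rewrite setTI.
Qed.

Lemma bigcup_euball : \bigcup_(j : nat) euball j%:R = [set: 'rV[R]_n].
Proof.
apply/seteqP; split => // x _; exists (Num.truncn (enorm x)).+1 => //.
exact/ltW/truncnS_gt.
Qed.

End cones.

Section image_measure.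
Context {R : realType} {m n : nat}.
Local Open Scope ereal_scope.

Lemma measurable_mxmap (B : 'M[R]_(m, n)) : measurable_fun setT (mxmap B).
Proof. exact: measurable_mulmx. Qed.

Definition image_measure (B : 'M[R]_(m, n)) : set 'rV[R]_n -> \bar R :=
  pushforward (@lebesgue R m) (mxmap B).

Variable B : 'M[R]_(m, n).

Let image_measure0 : image_measure B set0 = 0.
Proof. exact: measure0. Qed.

Let image_measure_ge0 A : 0 <= image_measure B A.
Proof. exact: measure_ge0. Qed.

Let image_measure_sigma_additive : semi_sigma_additive (image_measure B).
Proof.
by apply: measure_semi_sigma_additive; exact: measurable_mxmap.
Qed.

HB.instance Definition _ := isMeasure.Build _ _ _ (image_measure B)
  image_measure0 image_measure_ge0 image_measure_sigma_additive.

End image_measure.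

Section section_kernel.
Context {R : realType} {n k : nat}.
Local Open Scope ereal_scope.
Implicit Types (H : grass R n k).

(** [A |-> |A /\ H /\ B(0, N)|].  The ball makes it finite, which the passage to
complements in [measurable_section_measure] needs. *)
Definition section_measure (N : R) H : {measure set 'rV[R]_n -> \bar R} :=
  mrestr (image_measure (grass_basis H))
    (@measurable_euball R n N).

Lemma section_measureE N H A :
  section_measure N H A =
  lebesgue (mxmap (grass_basis H) @^-1` (A `&` euball N)).
Proof. by []. Qed.

(** The row space of [B] meets the cone in a cone of dimension [m]: its volume is
homogeneous of degree [m] in the radius, and for radius 1 it is the mean of the
indicator of the orthant. *)
Lemma lebesgue_section_cone m (B : 'M[R]_(m, n)) a s : B *m B^T = 1%:M ->
  (0 < s)%R -> lebesgue (mxmap B @^-1` cone a s) =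
    (s ^+ m)%:E * sphere_mean (EFin \o \1_(orthant a)) B.
Proof.
move=> BB s0; have si : (0 < s^-1)%R by rewrite invr_gt0.
have mO : measurable (((fun y => unit_vector y *m B)%R) @^-1` orthant a).
  by apply: measurable_preimage; [exact: measurable_unit_mulmx|exact: measurable_orthant].
have -> : sphere_mean (EFin \o \1_(orthant a)) B = lebesgue (mxmap B @^-1` cone a 1).
  rewrite /sphere_mean -[LHS]/(\int[@lebesgue R m]_(y in @eball R m)
    (\1_(((fun y => unit_vector y *m B)%R) @^-1` orthant a) y)%:E).
  rewrite integral_indic//; last exact: measurable_eball.
  congr (lebesgue _); apply/seteqP; split => y.
    by move=> [yO yb]; split; rewrite /mxmap ?enorm_mulmx ?unit_vector_mulmx.
  by move=> []; rewrite /mxmap enorm_mulmx// unit_vector_mulmx.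
rewrite (_ : mxmap B @^-1` cone a s = (fun y => s^-1 *: y)%R @^-1` (mxmap B @^-1` cone a 1)).
  rewrite lebesgue_homothety// ?exprVn ?invrK//.
  by apply: measurable_preimage; [exact: measurable_mxmap|exact: measurable_cone].
have E x : cone a 1 (s^-1 *: x)%R = cone a s x.
  rewrite /cone/= unit_vectorZ// enormZ; last exact: ltW.
  by rewrite mulrC ler_pdivrMr// mul1r.
by apply/funext => y; rewrite /preimage/= /mxmap -scalemxAl E.
Qed.

Lemma section_measureT N H :
  section_measure N H setT = lebesgue (@euball R (n - k) N).
Proof.
rewrite section_measureE setTI; congr (lebesgue _).
by apply/seteqP; split => y; rewrite /euball/mxmap/= enorm_mulmx//; case: (grass_basisP H).
Qed.

Lemma section_measure_lty N H A : measurable A -> section_measure N H A < +oo.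
Proof.
move=> mA; apply: le_lt_trans (@euball_lt_oo R (n - k) N).
by rewrite -(section_measureT N H); apply: le_measure; rewrite ?inE.
Qed.

Lemma lebesgue_singleton0 m : (0 < m)%N -> lebesgue [set 0%R : 'rV[R]_m] = 0.
Proof. by case: m => // m _; exact: lebesgue_singleton0S. Qed.

(** The ball cuts a cone at the smaller radius.  If that is not positive, the
section is contained in the origin. *)
Lemma section_measure_cone N H a t : (0 < n - k)%N ->
  section_measure N H (cone a t) =
    if (0 < Num.min t N)%R then
      (Num.min t N ^+ (n - k))%:E *
      sphere_mean (EFin \o \1_(orthant a)) (grass_basis H)
    else 0.
Proof.
move=> nk; have [BB _] := grass_basisP H.
rewrite section_measureE (_ : _ `&` _ = cone a (Num.min t N)); last first.
  apply/seteqP; split => x; first by move=> [[? ?] ?]; split => //; rewrite le_min; exact/andP.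
  by rewrite /cone /= le_min => -[/andP[]].
case: ifPn => [s0|]; first exact: lebesgue_section_cone.
rewrite -leNgt => s0; apply/eqP; rewrite eq_le measure_ge0 andbT.
rewrite -(lebesgue_singleton0 nk); apply: le_lebesgue.
- by apply: measurable_preimage; [exact: measurable_mxmap|exact: measurable_cone].
- exact: measurable_singleton.
move=> y; rewrite /mxmap => -[/=]; rewrite enorm_mulmx// => ys _.
apply/eqP; rewrite -enorm_eq0; apply/eqP/le_anti; rewrite enorm_ge0 andbT.
exact: le_trans ys s0.
Qed.

Lemma sphere_mean_cvg m a (B : 'M[R]_(m, n)) :
  sphere_mean (EFin \o ramp a j) B @[j --> \oo] -->
  sphere_mean (EFin \o \1_(orthant a)) B.
Proof.
rewrite /sphere_mean [X in _ --> X](_ : _ = \int[@lebesgue R m]_(y in @eball R m)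
  limn (fun j => (ramp a j (unit_vector y *m B))%:E)); last first.
  apply: eq_integral => y _; apply/esym/cvg_lim => //.
  by apply/cvg_EFin; [exact: nearW|exact: cvg_ramp].
apply: cvg_monotone_convergence.
- exact: measurable_eball.
- move=> j; apply: measurable_funTS; apply/measurable_EFinP.
  exact: measurableT_comp (measurable_ramp a j) (measurable_unit_mulmx B).
- by move=> j y _; rewrite lee_fin ramp_ge0.
- by move=> y _ i j ij; rewrite lee_fin; exact: ramp_nondecreasing.
Qed.

Lemma measurable_sphere_mean_ramp a j :
  measurable_fun setT (fun H => sphere_mean (EFin \o ramp a j) (grass_basis H)).
Proof.
apply: (@measurable_sphere_mean R n k (ramp a j) j%:R).
- exact: measurable_ramp.
- exact: ramp_ge0.
- exact: ler0n.
- exact: ramp_lip.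
Qed.

Lemma measurable_sphere_mean_orthant a :
  measurable_fun setT (fun H => sphere_mean (EFin \o \1_(orthant a)) (grass_basis H)).
Proof.
apply: (emeasurable_fun_cvg
  (fun j H => sphere_mean (EFin \o ramp a j) (grass_basis H))).
  by move=> j; exact: measurable_sphere_mean_ramp.
by move=> H _; exact: sphere_mean_cvg.
Qed.

(** The sets [A] for which this holds are a Dynkin system, and on cones the
volume of the section is a constant times a spherical mean. *)
Lemma measurable_section_measure N : (0 < n - k)%N ->
  forall A, measurable A -> measurable_fun setT (fun H => section_measure N H A).
Proof.
move=> nk A mA.
have mT : measurable_fun setT (fun H => section_measure N H setT).
  under eq_fun do rewrite section_measureT.
  exact: measurable_cst.
rewrite measurable_cones in mA; move: A mA.
apply: (dynkin_induction (P := fun A => measurable_fun setT (fun H => section_measure N H A))).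
- exact: measurable_cones.
- exact: setI_closed_cones.
- exact: mT.
- move=> _ [a [t ->]]; have [s0|/negbTE s0] := boolP (0 < Num.min t N)%R.
    under eq_fun do rewrite section_measure_cone// s0.
    by apply: measurable_funeM; exact: measurable_sphere_mean_orthant.
  under eq_fun do rewrite section_measure_cone// s0.
  exact: measurable_cst.
- move=> S mS mkS.
  rewrite (_ : (fun H => _) = fun H => section_measure N H setT - section_measure N H S).
    exact: emeasurable_funB.
  apply/funext => H; rewrite -setTD measureD//; last exact: section_measure_lty.
  by rewrite setTI.
- move=> F mF tF mkF.
  rewrite (_ : (fun H => _) = fun H => \sum_(i <oo) section_measure N H (F i)).
    exact: ge0_emeasurable_sum.
  by apply/funext => H; rewrite measure_semi_bigcup//; exact: bigcup_measurable.
Qed.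

End section_kernel.

(** * Integration against a generalized intersection body *)

Section radial_range.
Context {R : realType}.
Local Open Scope ereal_scope.

Lemma radial_integral_range d (T : measurableType d)
    (rho : {measure set T -> \bar R}) (q : T -> R) (c t : R) (n k : nat) :
  (0 < k < n)%N ->
  measurable_fun setT q -> (forall x, 0 <= q x)%R -> (0 < t)%R ->
  (forall s, (0 < s <= t)%R -> rho [set x | (q x <= s)%R] = (c * s ^+ n)%:E) ->
  \int[rho]_(x in [set x | (q x <= t)%R]) ((q x ^+ k)^-1)%:E =
  (c * (n%:R / (n - k)%:R) * t ^+ (n - k))%:E.
Proof.
case: k => // k kn mq q0 t0.
have nE : n = (k.+1 + (n - k.+1).-1.+1)%N by lia.
have mE : (n - k.+1)%N = (n - k.+1).-1.+1 by lia.
have := @radial_integral R _ _ rho q c t k (n - k.+1).-1 mq q0 t0.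
by rewrite -nE -mE.
Qed.

Lemma integral_surface_gt0 m (G : 'rV[R]_m -> \bar R) : (0 < m)%N ->
  measurable_fun setT G -> (forall x, 0 <= G x) ->
  \int[@surface R m]_(y in @sphere R m) G y =
  m%:R%:E * \int[@lebesgue R m]_(y in @eball R m) G (unit_vector y).
Proof. by case: m G => // m G _; exact: integral_surface. Qed.

End radial_range.

Section intersection_body.
Context {R : realType} {n k : nat}.
Variables (D : set 'rV[R]_n) (nu : {finite_measure set grass R n k -> \bar R}).
Hypotheses (kn : (0 < k < n)%N) (sD : star_body D).
Local Open Scope ereal_scope.
Hypothesis nuD : forall h : 'rV[R]_n -> R, {within @sphere R n, continuous h} ->
  \int[@surface R n]_(x in @sphere R n) (Defs.minkowski D x ^- k * h x)%:E =
  \int[nu]_H radon H h.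

(** [v] is the function of the direction from which [w] is recovered by
homogeneity of degree [- k]. *)
Let w (x : 'rV[R]_n) : R := (Defs.minkowski D x ^+ k)^-1%R.
Let v (x : 'rV[R]_n) : R := w (unit_vector x).

Let n0 : (0 < n)%N. Proof. by lia. Qed.
Let m0 : (0 < n - k)%N. Proof. by lia. Qed.

Let expr0k : (0 ^+ k = 0 :> R)%R.
Proof. by rewrite expr0n; case: k kn. Qed.

Let w0 x : (0 <= w x)%R.
Proof. by rewrite invr_ge0 exprn_ge0// minkowski_ge0. Qed.

Let v0 x : (0 <= v x)%R. Proof. exact: w0. Qed.

Let mw : measurable_fun setT w.
Proof. by apply: measurable_exprV; exact: measurable_minkowski. Qed.

Let mv : measurable_fun setT v.
Proof. exact: measurableT_comp mw (@measurable_unit_vector R n). Qed.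

Let minkowski0 : Defs.minkowski D 0 = 0%R.
Proof.
apply/eqP; rewrite eq_le minkowski_ge0 andbT.
by apply: (minkowski_le (lexx _) (star_body0 sD)); rewrite scaler0.
Qed.

(** At the origin both sides are 0 because [0^-1 = 0] and [k > 0]. *)
Let wE x : w x = ((enorm x ^+ k)^-1 * v x)%R.
Proof.
have [->|x0] := eqVneq x 0%R.
  rewrite /v /w /unit_vector scaler0 minkowski0 expr0k.
  by rewrite invr0 mulr0.
have e0 := enorm_gt0 x0.
by rewrite /v /w -invfM -exprMn -minkowskiZ// unit_vectorK.
Qed.

(** [D] lies in a ball of radius [M], so its functional is at least [1 / M] on the sphere. *)
Let v_bounded : exists2 M : R, (0 <= M)%R & forall x, (v x <= M)%R.
Proof.
have [M M0 DM] := star_body_euball sD.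
exists (M ^+ k)%R => [|x]; first by rewrite exprn_ge0// ltW.
have [->|x0] := eqVneq x 0%R.
  rewrite /v /w /unit_vector scaler0 minkowski0 expr0k.
  by rewrite invr0 exprn_ge0// ltW.
suff h : (M^-1 <= Defs.minkowski D (unit_vector x))%R.
  have M1 : (0 < M^-1)%R by rewrite invr_gt0.
  rewrite /v /w -[leRHS]invrK lef_pV2 ?posrE -?exprVn ?exprn_gt0//.
    by rewrite lerXn2r// nnegrE ?minkowski_ge0// ltW.
  exact: lt_le_trans h.
apply: lb_le_inf; first exact: star_body_nonempty.
move=> a [a0 [y Dy uy]].
have := enorm_unit_vector x0; rewrite uy enormZ// => ay.
rewrite -div1r ler_pdivrMr// -ay ler_wpM2l//; exact: DM.
Qed.

Let I a := \int[@lebesgue R n]_(x in cone a 1) (v x)%:E.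

Let I_fin a : I a \is a fin_num.
Proof.
have [M M0 vM] := v_bounded.
rewrite ge0_fin_numE; last by apply: integral_ge0 => x _; rewrite lee_fin.
apply: (@le_lt_trans _ _ (\int[@lebesgue R n]_(x in cone a 1) M%:E)).
  apply: ge0_le_integral => //.
  - exact: measurable_cone.
  - by move=> x _; rewrite lee_fin.
  - by apply: measurable_funTS; exact/measurable_EFinP.
  - by move=> x _; rewrite lee_fin.
rewrite integral_cst; last exact: measurable_cone.
apply: (@le_lt_trans _ _ (M%:E * lebesgue (@euball R n 1))).
  rewrite lee_wpmul2l ?lee_fin//; apply: le_lebesgue.
  - exact: measurable_cone.
  - exact: measurable_euball.
  - by move=> x [].
by rewrite lte_mul_pinfty// ?lee_fin// euball_lt_oo.
Qed.

(** The defining identity of [D] for a continuous function, with both spherical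
integrals written over balls. *)
Let surface_ramp a j :
  n%:R%:E * \int[@lebesgue R n]_(x in @eball R n) (v x * ramp a j (unit_vector x))%:E =
  (n - k)%:R%:E * \int[nu]_H sphere_mean (EFin \o ramp a j) (grass_basis H).
Proof.
have mr := measurable_ramp a j.
have hw : measurable_fun setT (fun x => (w x * ramp a j x)%:E).
  by apply/measurable_EFinP; exact: measurable_funM.
rewrite -(@integral_surface_gt0 R n (fun x => (w x * ramp a j x)%:E))//; last first.
  by move=> x; rewrite lee_fin mulr_ge0// ramp_ge0.
rewrite nuD; last by apply: continuous_subspaceT; exact: ramp_continuous.
rewrite -ge0_integralZl//; last 2 first.
- exact: measurable_sphere_mean_ramp.
- by move=> H _; apply: integral_ge0 => y _; rewrite lee_fin ramp_ge0.
apply: eq_integral => H _; rewrite /radon.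
rewrite (@integral_surface_gt0 R (n - k) (fun y => (ramp a j (y *m grass_basis H))%:E))//.
  by apply/measurable_EFinP; exact: measurableT_comp mr (measurable_mulmx _).
by move=> y; rewrite lee_fin ramp_ge0.
Qed.

(** Monotone convergence as the ramps increase to the indicator of the orthant. *)
Let surface_orthant a :
  n%:R%:E * I a =
  (n - k)%:R%:E * \int[nu]_H sphere_mean (EFin \o \1_(orthant a)) (grass_basis H).
Proof.
pose L j := \int[@lebesgue R n]_(x in @eball R n) (v x * ramp a j (unit_vector x))%:E.
have cL : L j @[j --> \oo] --> I a.
  rewrite [X in _ --> X](_ : _ = \int[@lebesgue R n]_(x in @eball R n)
      limn (fun j => (v x * ramp a j (unit_vector x))%:E)); last first.
    transitivity (\int[@lebesgue R n]_(x in @eball R n)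
        (v x * \1_(orthant a) (unit_vector x))%:E).
      rewrite /I integral_mkcond [RHS]integral_mkcond; apply: eq_integral => x _.
      rewrite !patchE indicE; have [xb|xb] := boolP (x \in @eball R n); last first.
        by rewrite memNset// => -[xb' _]; move/negP : xb; apply; rewrite inE.
      have [xo|xo] := boolP (unit_vector x \in orthant a).
        by rewrite mulr1 mem_set//; split; [move: xb|move: xo]; rewrite inE.
      by rewrite mulr0 memNset// => -[_ xo']; move/negP : xo; apply; rewrite inE.
    apply: eq_integral => x _; apply/esym/cvg_lim => //.
    apply/cvg_EFin; first exact: nearW.
    by apply: cvgM; [exact: cvg_cst|exact: cvg_ramp].
  apply: cvg_monotone_convergence.
  - exact: measurable_eball.
  - move=> j; apply: measurable_funTS; apply/measurable_EFinP; apply: measurable_funM => //.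
    exact: measurableT_comp (measurable_ramp a j) (@measurable_unit_vector R n).
  - by move=> j y _; rewrite lee_fin mulr_ge0// ramp_ge0.
  - by move=> y _ i j ij; rewrite lee_fin ler_wpM2l//; exact: ramp_nondecreasing.
pose M j := \int[nu]_H sphere_mean (EFin \o ramp a j) (grass_basis H).
have cM : M j @[j --> \oo] -->
    \int[nu]_H sphere_mean (EFin \o \1_(orthant a)) (grass_basis H).
  rewrite [X in _ --> X](_ : _ = \int[nu]_H
      limn (fun j => sphere_mean (EFin \o ramp a j) (grass_basis H))); last first.
    by apply: eq_integral => H _; apply/esym/cvg_lim => //; exact: sphere_mean_cvg.
  apply: cvg_monotone_convergence => //.
  - by move=> j; exact: measurable_sphere_mean_ramp.
  - by move=> j H _; apply: integral_ge0 => y _; rewrite lee_fin ramp_ge0.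
  - move=> H _ i j ij; apply: ge0_le_integral.
    + exact: measurable_eball.
    + by move=> y _; rewrite lee_fin ramp_ge0.
    + apply: measurable_funTS; apply/measurable_EFinP.
      exact: measurableT_comp (measurable_ramp a i) (measurable_unit_mulmx _).
    + apply: measurable_funTS; apply/measurable_EFinP.
      exact: measurableT_comp (measurable_ramp a j) (measurable_unit_mulmx _).
    + by move=> y _; rewrite lee_fin; exact: ramp_nondecreasing.
have c1 : n%:R%:E * L j @[j --> \oo] --> n%:R%:E * I a by apply: cvgeZl.
have c2 : (n - k)%:R%:E * M j @[j --> \oo] --> (n - k)%:R%:E *
    \int[nu]_H sphere_mean (EFin \o \1_(orthant a)) (grass_basis H).
  by apply: cvgeZl.
have LM : (fun j => n%:R%:E * L j) = (fun j => (n - k)%:R%:E * M j).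
  by apply/funext => j; exact: surface_ramp.
rewrite LM in c1; exact: (cvg_unique _ c1 c2).
Qed.

(** [v] is constant along rays, so only the volume scales. *)
Let cone_density a r : (0 < r)%R ->
  \int[@lebesgue R n]_(x in cone a r) (v x)%:E = (r ^+ n)%:E * I a.
Proof.
move=> r0; have ri : (0 < r^-1)%R by rewrite invr_gt0.
have mphi : measurable_fun setT (fun x : 'rV[R]_n => (r^-1 *: x)%R).
  by apply: measurable_scalerV.
pose F x := ((EFin \o v) \_ (cone a 1)) x.
have mF : measurable_fun setT F.
  apply: (measurable_restrictT _ (measurable_cone a 1)).1.
  by apply: measurable_funTS; exact/measurable_EFinP.
have F0 x : 0 <= F x by apply: erestrict_ge0 => z _; rewrite lee_fin.
have rn0 : (0 <= r ^+ n)%R by rewrite exprn_ge0// ltW.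
have := @ge0_integral_transfer _ _ _ _ R _ (@lebesgue R n)
  (mscale (NngNum rn0) (@lebesgue R n)) F mphi _ mF F0.
rewrite ge0_integral_mscale// => /(_ _)/esym E.
rewrite /I [in RHS]integral_mkcond [LHS]integral_mkcond.
rewrite -[RHS]E; last first.
  move=> A mA; rewrite [RHS](lebesgue_homothety ri mA).
  by rewrite exprVn invrK.
apply: eq_integral => x _; rewrite /F !patchE.
have -> : (r^-1 *: x)%R \in cone a 1 = (x \in cone a r).
  apply/idP/idP; rewrite !inE /cone/= unit_vectorZ// enormZ ?(ltW ri)// mulrC ler_pdivrMr// mul1r//.
by case: ifPn => // _; rewrite /= /v unit_vectorZ.
Qed.

(** Radial integration with [q = enorm], for the measure [v dx] restricted to the
directions in the orthant: [w = |x|^(-k) v]. *)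
Let cone_weight a s : (0 < s)%R ->
  \int[@lebesgue R n]_(x in cone a s) (w x)%:E =
  (n%:R / (n - k)%:R * s ^+ (n - k))%:E * I a.
Proof.
move=> s0.
pose O := @unit_vector R n @^-1` orthant a.
have mO : measurable O.
  by apply: measurable_preimage; [exact: measurable_unit_vector|exact: measurable_orthant].
(* [rho] of the ball of radius [r] is [r^n I a] by [cone_density]. *)
pose rho : {measure set 'rV[R]_n -> \bar R} := mrestr (with_density (@lebesgue R n) mv v0) mO.
have rhoE r : (0 < r <= s)%R ->
    rho [set x | (enorm x <= r)%R] = (fine (I a) * r ^+ n)%:E.
  by move=> /andP[r0 _]; rewrite EFinM fineK// muleC -cone_density.
have e0 := @enorm_ge0 R n.
have := radial_integral_range kn (@measurable_enorm R n) e0 s0 rhoE.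
have -> : (fine (I a) * (n%:R / (n - k)%:R) * s ^+ (n - k))%:E =
    (n%:R / (n - k)%:R * s ^+ (n - k))%:E * I a.
  by rewrite -mulrA EFinM fineK// muleC.
move=> <-; rewrite [RHS]integral_mkcond.
have mE : measurable_fun setT (fun x : 'rV[R]_n => ((enorm x ^+ k)^-1)%:E).
  by apply/measurable_EFinP; apply: measurable_exprV; exact: measurable_enorm.
set G := _ \_ _.
have mG : measurable_fun setT G.
  apply: (measurable_restrictT _ (@measurable_euball R n s)).1.
  exact: measurable_funTS.
have G0 x : 0 <= G x.
  by apply: erestrict_ge0 => z _; rewrite lee_fin invr_ge0 exprn_ge0.
rewrite integral_mrestr// [RHS]integral_mkcond integral_with_density; last 2 first.
- by apply: (measurable_restrictT _ mO).1; exact: measurable_funTS.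
- by move=> x; exact: erestrict_ge0.
rewrite [LHS]integral_mkcond; apply: eq_integral => x _; rewrite /G !patchE.
have [xO|xO] := boolP (x \in O); last first.
  rewrite mul0e memNset// => -[_ xo]; move/negP : xO; apply; rewrite inE; exact: xo.
have [xs|xs] := boolP (x \in [set x | (enorm x <= s)%R]); last first.
  rewrite mul0e memNset// => -[xs' _]; move/negP : xs; apply; rewrite inE; exact: xs'.
rewrite mem_set; first by rewrite wE EFinM.
by split; [move: xs|move: xO]; rewrite inE.
Qed.

Let mixture_cone N a t :
  mrestr (with_density (@lebesgue R n) mw w0) (@measurable_euball R n N) (cone a t) =
  mixture nu (@measurable_section_measure R n k N m0) (cone a t).
Proof.
rewrite /mixture; under eq_integral do rewrite section_measure_cone//.
have -> : mrestr (with_density (@lebesgue R n) mw w0) (@measurable_euball R n N) (cone a t) =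
    \int[@lebesgue R n]_(x in cone a (Num.min t N)) (w x)%:E.
  rewrite /mrestr /with_density; congr integral.
  apply/seteqP; split => x; first by move=> [[? ?] ?]; split => //; rewrite le_min; exact/andP.
  by rewrite /cone /= le_min => -[/andP[]].
have [s0|] := ltP 0%R (Num.min t N).
  rewrite cone_weight// ge0_integralZl//; last 3 first.
  - exact: measurable_sphere_mean_orthant.
  - by move=> H _; apply: integral_ge0 => y _; rewrite lee_fin.
  - by rewrite lee_fin exprn_ge0// ltW.
  have nk0 : (0 < (n - k)%:R :> R)%R by rewrite ltr0n.
  apply: (EFin_mulI nk0).
  rewrite [RHS]muleCA -surface_orthant !muleA -!EFinM.
  by congr (_%:E * _); field; rewrite gt_eqF.
move=> s0; rewrite [RHS]integral0.
apply/eqP; rewrite eq_le; apply/andP; split; last first.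
  by apply: integral_ge0 => x _; rewrite lee_fin.
rewrite integral0_eq// => x [xs _].
have /eqP : enorm x = 0%R by apply/le_anti; rewrite enorm_ge0 andbT (le_trans xs).
by rewrite enorm_eq0 => /eqP ->; rewrite /w minkowski0 expr0k invr0.
Qed.

(** Inside a ball, [||x||_D^(-k) dx] is the [nu]-mixture of the Lebesgue measures
of the subspaces: two measures that agree on the cones, which are stable under
intersection and generate the Borel sets. *)
Lemma mixture_density N A : measurable A ->
  mrestr (with_density (@lebesgue R n) mw w0) (@measurable_euball R n N) A =
  mixture nu (@measurable_section_measure R n k N m0) A.
Proof.
move=> mA.
pose m1 : {measure set 'rV[R]_n -> \bar R} :=
  mrestr (with_density (@lebesgue R n) mw w0) (@measurable_euball R n N).
pose m2 : {measure set 'rV[R]_n -> \bar R} :=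
  mixture nu (@measurable_section_measure R n k N m0).
have g_cones j : cones (cone (const_mx 2 : 'rV[R]_n)%R j%:R).
  by exists (const_mx 2)%R, j%:R%R.
have g_cover : \bigcup_(j : nat) cone (const_mx 2 : 'rV[R]_n)%R j%:R = setT.
  by under eq_bigcupr do rewrite cone2E; exact: bigcup_euball.
have m12 C : cones C -> m1 C = m2 C.
  by move=> [a [t ->]]; exact: mixture_cone.
apply: (@measure_unique _ R _ _ _ measurable_cones setI_closed_cones g_cones
  g_cover m1 m2 m12 _ A mA).
move=> j; apply: (@le_lt_trans _ _ (\int[@lebesgue R n]_(x in cone (const_mx 2)%R j.+1%:R) (w x)%:E)).
  rewrite /mrestr /= /with_density; apply: ge0_subset_integral.
  - by apply: measurableI; [exact: measurable_cone|exact: measurable_euball].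
  - exact: measurable_cone.
  - by apply: measurable_funTS; exact/measurable_EFinP.
  - by move=> x _; rewrite lee_fin.
  - move=> x [[xj xo] _]; split => //; rewrite (le_trans xj)// ler_nat//.
by rewrite cone_weight// -[I _]fineK// -EFinM ltry.
Qed.

(** [mixture_density] in terms of integrals.  The measurability in [H] is
recorded as well, since integrals over the Grassmannian are to be compared. *)
Lemma gen_intersection_body_integral N (A : set 'rV[R]_n) (F : 'rV[R]_n -> \bar R) :
  measurable A -> A `<=` euball N ->
  measurable_fun setT F -> (forall x, 0 <= F x) ->
  measurable_fun setT (fun H : grass R n k => grass_integral H A F) /\
  \int[@lebesgue R n]_(x in A) (F x * (Defs.minkowski D x ^- k)%:E) =
  \int[nu]_H grass_integral H A F.
Proof.
move=> mA AN mF F0.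
pose G := F \_ A.
have mG : measurable_fun setT G.
  by apply: (measurable_restrictT _ mA).1; exact: measurable_funTS.
have G0 x : 0 <= G x by apply: erestrict_ge0.
have GN (mu : {measure set 'rV[R]_n -> \bar R}) :
    \int[mu]_(x in euball N) G x = \int[mu]_x G x.
  rewrite integral_mkcond; apply: eq_integral => x _; rewrite patchE.
  case: ifPn => //; rewrite notin_setE => xN; rewrite /G patchE memNset//.
  by move=> /AN.
have HE (H : grass R n k) : \int[section_measure N H]_x G x = grass_integral H A F.
  rewrite /section_measure integral_mrestr// GN.
  have mB := measurable_mulmx (grass_basis H).
  have T := @ge0_integral_transfer _ _ _ _ R _ (@lebesgue R (n - k))
    (image_measure (grass_basis H)) G mB (fun A _ => erefl) mG G0.
  rewrite T.
  rewrite /grass_integral [RHS]integral_mkcond; apply: eq_integral => y _.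
  by rewrite /G !patchE; congr (if _ then _ else _); apply/idP/idP; rewrite !inE.
split.
  under eq_fun do rewrite -HE.
  apply: measurable_fun_integral_kernel => //.
  exact: measurable_section_measure.
under [RHS]eq_integral do rewrite -HE.
rewrite -(integral_mixture nu (@measurable_section_measure R n k N m0))//.
transitivity (\int[mrestr (with_density (@lebesgue R n) mw w0) (@measurable_euball R n N)]_x G x).
  rewrite integral_mrestr// GN integral_with_density// [LHS]integral_mkcond.
  by apply: eq_integral => x _; rewrite /G !patchE; case: ifPn; rewrite ?mul0e.
by apply: eq_measure_integral => B mB _; exact: mixture_density.
Qed.

End intersection_body.

(** * Null sets and null sections *)

Section null_sections.
Context {R : realType}.
Local Open Scope ereal_scope.
Local Notation T1 := (measurableTypeR R).

Lemma ge0_integral_eq0 d (T : measurableType d) (mu : {measure set T -> \bar R})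
    (A : set T) (f : T -> \bar R) : measurable A ->
  measurable_fun A f -> (forall x, A x -> 0 <= f x) ->
  \int[mu]_(x in A) f x = 0 -> mu.-negligible [set x | A x /\ f x != 0].
Proof.
move=> mA mf f0 If.
have : \int[mu]_(x in A) `|f x| = 0.
  by rewrite -[RHS]If; apply: eq_integral => x /[!inE] /f0/gee0_abs.
move=> /(ae_eq_integral_abs mu mA mf) [N [mN N0 fN]].
exists N; split => // x [Ax /eqP fx0]; apply: fN => /=.
by move=> /(_ Ax).
Qed.

(** Tonelli for the translates of the hyperplane along [e_i]: a line in this
direction meets it in one point, while all its translates have the same volume,
so that this volume times [+oo] is 0. *)
Lemma lebesgue_hyperplane m (i : 'I_m) : lebesgue [set x : 'rV[R]_m | x 0 i = 0]%R = 0.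
Proof.
set P := [set x : 'rV[R]_m | x 0 i = 0]%R.
have mP : measurable P.
  rewrite (_ : P = (fun x : 'rV[R]_m => x 0%R i) @^-1` [set 0%R])//.
  by apply: measurable_preimage; [exact: measurable_coord|exact: measurable_set1].
pose e : 'rV[R]_m := delta_mx 0%R i.
pose E : set ('rV[R]_m * T1) := [set p | P (p.1 + p.2 *: e)%R].
have mE : measurable E.
  apply: measurable_preimage mP.
  apply: measurable_addrV; first exact: measurable_fst.
  by apply: measurable_scalerV => //; exact: measurable_snd.
have T := @tonelli_sections R _ _ _ _ (@lebesgue R m) (@lebesgue_measure R) E mE.
have E1 : \int[@lebesgue R m]_x @lebesgue_measure R (xsection E x) = 0.
  apply: integral0_eq => x _; rewrite (_ : xsection E x = [set (- x 0 i)%R]).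
    exact: lebesgue_measure_set1.
  apply/seteqP; split => s; rewrite /xsection/= inE /E/P/= !mxE !eqxx/= mulr1.
    by move=> /eqP; rewrite addrC addr_eq0 => /eqP.
  by move=> ->; rewrite subrr.
have E2 : \int[@lebesgue_measure R]_s @lebesgue R m (ysection E s) = lebesgue P * +oo.
  rewrite (eq_integral (fun=> lebesgue P)).
    rewrite integral_cst//=; congr (_ * _).
    by rewrite -set_itvNyy lebesgue_measure_itv.
  move=> s _; rewrite -(lebesgue_shift (s *: e)%R mP); congr (lebesgue _).
  by apply/seteqP; split => x; rewrite /ysection/= inE.
have /eqP : lebesgue P * +oo = 0 := etrans (esym E2) (etrans (esym T) E1).
by rewrite mule_eq0 orbF => /eqP.
Qed.

Variables (n k : nat).
Hypothesis kn : (0 < k < n)%N.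

Let m0 : (0 < n - k)%N. Proof. by lia. Qed.
Let n0 : (0 < n)%N. Proof. by lia. Qed.
Let i0 : 'I_(n - k) := Ordinal m0.
Let j0 : 'I_n := Ordinal n0.

(** The rows of [pencil v] are [v] and the coordinate vectors [e_2, ..., e_(n-k)],
those of [pencil_base] the same with 0 for [v].  A point [y *m pencil v] is
affine in [v] with slope [y_1], which makes the two orders of integration over
[v] and [y] comparable. *)
Definition pencil_base : 'M[R]_(n - k, n) :=
  \matrix_(i, j) ((i != 0%N :> nat) && (i == j :> nat))%:R.

Definition pencil (v : 'rV[R]_n) : 'M[R]_(n - k, n) :=
  \matrix_(i, j) if i == 0%N :> nat then v 0%R j else (i == j :> nat)%:R.

Let mulmx_pencil v (y : 'rV[R]_(n - k)) :
  (y *m pencil v = y 0 i0 *: v + y *m pencil_base)%R.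
Proof.
apply/rowP => j; rewrite !mxE (bigD1 i0)//= [in RHS](bigD1 i0)//= !mxE eqxx/=.
rewrite mulr0 add0r; congr (_ + _)%R; apply: eq_bigr => i ii0; rewrite !mxE.
have /negbTE -> : (i != 0%N :> nat) by apply: contraNneq ii0 => i00; apply/eqP/val_inj.
by [].
Qed.

Let pencil_inj (v : 'rV[R]_n) (c : 'rV[R]_(n - k)) : v 0%R j0 != 0%R ->
  (c *m pencil v = 0)%R -> c = 0%R.
Proof.
move=> v0 cv.
have E j : (c 0%R i0 * v 0%R j + (c *m pencil_base) 0%R j = 0)%R.
  by have := congr1 (fun x : 'rV[R]_n => x 0%R j) cv; rewrite mulmx_pencil !mxE.
have bj0 : ((c *m pencil_base) 0%R j0 = 0)%R.
  rewrite mxE big1// => i _; rewrite mxE /=.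
  by case: eqP => /= [_|_]; rewrite mulr0.
have c0 : (c 0%R i0 = 0)%R.
  by have := E j0; rewrite bj0 addr0 => /eqP; rewrite mulf_eq0 (negbTE v0) orbF => /eqP.
apply/rowP => i; rewrite mxE.
have [->//|ii0] := eqVneq i i0.
have kn' : (n - k <= n)%N by lia.
have := E (widen_ord kn' i); rewrite c0 mul0r add0r mxE (bigD1 i)//= mxE /= eqxx.
have -> /= : (i != 0%N :> nat) by apply: contraNneq ii0 => i00; apply/eqP/val_inj.
rewrite mulr1 big1 ?addr0// => l li; rewrite mxE /=.
have /negbTE -> : (l != i :> nat) by [].
by rewrite andbF mulr0.
Qed.

Lemma dim_row_span m (B : 'M[R]_(m, n)) : (forall c : 'rV_m, c *m B = 0 -> c = 0)%R ->
  \dim <<[tuple row i B | i < m]>>%VS = m.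
Proof.
move=> injB; apply/eqP; rewrite -[X in _ == X](size_tuple [tuple row i B | i < m]).
apply/freeP => c cB i.
pose cc : 'rV[R]_m := (\row_i c i)%R.
suff : cc = 0%R by move=> /rowP/(_ i); rewrite !mxE.
apply: injB; rewrite mulmx_sum_row -[RHS]cB; apply: eq_bigr => j _.
by rewrite mxE (nth_map j) ?nth_ord_enum// size_enum_ord.
Qed.

(** A matrix of full rank and the orthonormal basis of its row space differ by an
invertible factor, and such a factor preserves null sets. *)
Lemma grass_of_matrix (B : 'M[R]_(n - k, n)) :
  (forall c : 'rV_(n - k), c *m B = 0 -> c = 0)%R ->
  exists (H : grass R n k) (P : 'M[R]_(n - k)),
    P \in unitmx /\ B = (P *m grass_basis H)%R.
Proof.
move=> injB; have /eqP dB := dim_row_span injB.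
pose H : grass R n k := exist (fun V : {vspace 'rV[R]_n} => \dim V == (n - k)%N) _ dB.
have BH := grass_basisP H.
exists H, (B *m (grass_basis H)^T)%R.
have E : B = (B *m (grass_basis H)^T *m grass_basis H)%R.
  apply/row_matrixP => i; rewrite !row_mul; apply: frame_span BH _.
  by apply: memv_span; apply/mapP; exists i => //; rewrite mem_enum.
split => //.
rewrite -row_free_unit -kermx_eq0; apply/eqP/row_matrixP => i; rewrite row0.
apply: injB; rewrite [X in _ *m X = _]E mulmxA -row_mul.
by rewrite mulmx_ker row0 mul0mx.
Qed.

(** [v |-> y0 v + b] is an affine bijection. *)
Let shift_null (A : set 'rV[R]_n) (y0 : R) (b : 'rV[R]_n) : measurable A -> y0 != 0%R ->
  lebesgue [set v | A (y0 *: v + b)%R] = 0 <-> lebesgue A = 0.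
Proof.
move=> mA y00.
have uQ : (y0%:M : 'M[R]_n)%R \in unitmx by rewrite unitmxE det_scalar unitrX// unitfE.
have [c c0 cE] := lebesgue_mxmap uQ.
pose A' := (fun x => x + b)%R @^-1` A.
have mA' : measurable A'.
  by apply: measurable_preimage => //; apply: measurable_addrV.
rewrite (_ : [set v | _] = mxmap y0%:M @^-1` A'); last first.
  by apply/seteqP; split => v; rewrite /A'/= /mxmap mul_mx_scalar.
rewrite (cE A' mA') (lebesgue_shift b mA); split => [/eqP|->]; last by rewrite mule0.
by rewrite mule_eq0 eqe gt_eqF//= => /eqP.
Qed.

Let measurable_pencil_map (A : set 'rV[R]_n) : measurable A ->
  measurable [set p : 'rV[R]_n * 'rV[R]_(n - k) | A (p.2 *m pencil p.1)%R].
Proof.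
move=> mA.
have mf : measurable_fun setT (fun p : 'rV[R]_n * 'rV[R]_(n - k) => p.2 *m pencil p.1)%R.
  under eq_fun do rewrite mulmx_pencil.
  apply: measurable_addrV.
    apply: measurable_scalerV; last exact: measurable_fst.
    exact: measurableT_comp (measurable_coord i0) measurable_snd.
  exact: measurableT_comp (measurable_mulmx pencil_base) measurable_snd.
exact: (measurable_preimage mf mA).
Qed.

Lemma pencil_tonelli (A : set 'rV[R]_n) : measurable A ->
  \int[@lebesgue R n]_v lebesgue [set y : 'rV[R]_(n - k) | A (y *m pencil v)%R] =
  \int[@lebesgue R (n - k)]_y lebesgue [set v : 'rV[R]_n | A (y *m pencil v)%R].
Proof.
move=> mA.
have := tonelli_sections (@lebesgue R n) (@lebesgue R (n - k)) (measurable_pencil_map mA).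
have E1 v : xsection [set p : 'rV[R]_n * 'rV[R]_(n - k) | A (p.2 *m pencil p.1)%R] v =
    [set y : 'rV[R]_(n - k) | A (y *m pencil v)%R].
  by apply/seteqP; split => y; rewrite /xsection/= inE.
have E2 y : ysection [set p : 'rV[R]_n * 'rV[R]_(n - k) | A (p.2 *m pencil p.1)%R] y =
    [set v : 'rV[R]_n | A (y *m pencil v)%R].
  by apply/seteqP; split => v; rewrite /ysection/= inE.
have T1 := eq_integral (mu := @lebesgue R n) (D := setT) _ _
  (fun v _ => congr1 (@lebesgue R (n - k)) (E1 v)).
have T2 := eq_integral (mu := @lebesgue R (n - k)) (D := setT) _ _
  (fun y _ => congr1 (@lebesgue R n) (E2 y)).
by move=> T; exact: etrans (etrans (esym T1) T) T2.
Qed.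

Let pencil_fiber (A : set 'rV[R]_n) (y : 'rV[R]_(n - k)) : measurable A ->
  y 0%R i0 != 0%R ->
  lebesgue [set v : 'rV[R]_n | A (y *m pencil v)%R] = 0 <-> lebesgue A = 0.
Proof.
move=> mA y0; rewrite -(shift_null (y *m pencil_base)%R mA y0).
by under eq_set do rewrite mulmx_pencil.
Qed.

Let F (A : set 'rV[R]_n) (v : 'rV[R]_n) :=
  lebesgue [set y : 'rV[R]_(n - k) | A (y *m pencil v)%R].
Let G (A : set 'rV[R]_n) (y : 'rV[R]_(n - k)) :=
  lebesgue [set v : 'rV[R]_n | A (y *m pencil v)%R].

Let mF A : measurable A -> measurable_fun setT (F A).
Proof.
move=> mA.
have := @measurable_fun_xsection _ _ _ _ R (@lebesgue R (n - k)) _ (measurable_pencil_map mA).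
congr (measurable_fun _ _); apply/funext => v; congr (lebesgue _).
by apply/seteqP; split => y; rewrite /xsection/= inE.
Qed.

Let mG A : measurable A -> measurable_fun setT (G A).
Proof.
move=> mA.
have := @measurable_fun_ysection _ _ _ _ R (@lebesgue R n) _ (measurable_pencil_map mA).
congr (measurable_fun _ _); apply/funext => y; congr (lebesgue _).
by apply/seteqP; split => v; rewrite /ysection/= inE.
Qed.

Lemma negligible_hyperplane m (i : 'I_m) :
  (@lebesgue R m).-negligible [set x : 'rV[R]_m | x 0 i = 0]%R.
Proof.
exists [set x : 'rV[R]_m | x 0 i = 0]%R; split => //; last exact: lebesgue_hyperplane.
rewrite (_ : [set _ | _] = (fun x : 'rV[R]_m => x 0%R i) @^-1` [set 0%R])//.
by apply: measurable_preimage; [exact: measurable_coord|exact: measurable_set1].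
Qed.

(** For almost every [y] the fibre [{v | y *m pencil v in A}] is an affine image
of [A], hence null; by Tonelli almost every section is null too. *)
Lemma pencil_null_sections (A : set 'rV[R]_n) : measurable A -> lebesgue A = 0 ->
  (@lebesgue R n).-negligible
    [set v | lebesgue [set y : 'rV[R]_(n - k) | A (y *m pencil v)%R] != 0].
Proof.
move=> mA A0.
have IG : \int[@lebesgue R (n - k)]_y G A y = 0.
  rewrite -[RHS](@integral0 _ _ R (@lebesgue R (n - k)) setT).
  apply: ge0_ae_eq_integral => //; first exact: mG.
  apply: negligibleS (negligible_hyperplane i0) => y /=.
  apply: contra_notP => /eqP y0 _; exact/(pencil_fiber mA y0).
have IF : \int[@lebesgue R n]_v F A v = 0 by rewrite /F pencil_tonelli.
have F0 v : setT v -> 0 <= F A v by [].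
by apply: negligibleS (ge0_integral_eq0 measurableT (mF mA) F0 IF).
Qed.

(** Conversely, almost every fibre over [y] is null, and any one with [y_1 <> 0]
shows that [A] is null: if [A] were not, the unit ball of [R^(n-k)] would be
contained in a null set. *)
Lemma null_of_pencil_sections (A : set 'rV[R]_n) : measurable A ->
  (@lebesgue R n).-negligible
    [set v | lebesgue [set y : 'rV[R]_(n - k) | A (y *m pencil v)%R] != 0] ->
  lebesgue A = 0.
Proof.
move=> mA nF; apply: contrapT => A0.
have IF : \int[@lebesgue R n]_v F A v = 0.
  rewrite -[RHS](@integral0 _ _ R (@lebesgue R n) setT).
  apply: ge0_ae_eq_integral => //; first exact: mF.
  by apply: negligibleS nF => v /=; apply: contra_notN => /eqP.
have IG : \int[@lebesgue R (n - k)]_y G A y = 0 by rewrite /G -pencil_tonelli.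
have G0 y : setT y -> 0 <= G A y by [].
have nG := ge0_integral_eq0 measurableT (mG mA) G0 IG.
have [N [mN N0 sN]] := negligibleU nG (negligible_hyperplane i0).
have : lebesgue (@euball R (n - k) 1) <= 0.
  rewrite -N0; apply: le_lebesgue => //; first exact: measurable_euball.
  move=> y _; apply: sN; have [y0|y0] := eqVneq (y 0%R i0) 0%R; first by right.
  by left; split => //; apply/eqP => /(pencil_fiber mA y0).
by rewrite leNgt euball_gt0.
Qed.

Lemma grass_of_pencil (v : 'rV[R]_n) : v 0%R j0 != 0%R ->
  exists (H : grass R n k) (P : 'M[R]_(n - k)),
    P \in unitmx /\ pencil v = (P *m grass_basis H)%R.
Proof. by move=> v0; apply: grass_of_matrix => c; exact: pencil_inj. Qed.

(** Almost all [v] give a subspace of dimension [n - k] in which [Z] is null, and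
then [Y] is null in it too; the sections of [Y] by the pencil suffice. *)
Lemma null_by_sections (Z Y : set 'rV[R]_n) : measurable Z -> measurable Y ->
  lebesgue Z = 0 ->
  (forall H : grass R n k, image_measure (grass_basis H) Z = 0 ->
    image_measure (grass_basis H) Y = 0) ->
  lebesgue Y = 0.
Proof.
move=> mZ mY Z0 ZY; apply: null_of_pencil_sections => //.
apply: negligibleS (negligibleU (pencil_null_sections mZ Z0) (negligible_hyperplane j0)).
move=> v /= Yv; have [v0|v0] := eqVneq (v 0%R j0) 0%R; first by right.
left; apply: contra Yv => /eqP Zv; apply/eqP.
have [H [P [uP BE]]] := grass_of_pencil v0.
have [c c0 cE] := lebesgue_mxmap uP.
have E A : measurable A -> lebesgue [set y : 'rV[R]_(n - k) | A (y *m pencil v)%R] =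
    c%:E * image_measure (grass_basis H) A.
  move=> mA; rewrite /image_measure /pushforward -cE.
    by congr (lebesgue _); apply/seteqP; split => y; rewrite /= /mxmap BE mulmxA.
  by apply: measurable_preimage => //; exact: measurable_mxmap.
rewrite E// ZY ?mule0//; apply/eqP.
by have /eqP := Zv; rewrite E// mule_eq0 eqe gt_eqF.
Qed.

End null_sections.

(** * The bathtub principle *)

Section bathtub.
Context {R : realType}.

Lemma powR_frac (x : R) n k : 0 <= x -> x `^ (k%:R / n%:R) = (x `^ n%:R^-1) ^+ k.
Proof. by move=> x0; rewrite mulrC powRrM powR_mulrn// powR_ge0. Qed.

Lemma powR_invK (x : R) n : (0 < n)%N -> 0 <= x -> (x `^ n%:R^-1) ^+ n = x.
Proof.
by move=> n0 x0; rewrite -powR_frac// divff ?powRr1// pnatr_eq0 -lt0n.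
Qed.

(** The two sides of [bathtub_at] at [t = (m / V)^(1/n)], for which the dilate of
[D] has mass [t^n V = m], so that the terms in [t^(-k) m] cancel. *)
Lemma bathtub_optimum (V m : R) (n k : nat) (a := V `^ n%:R^-1) (b := m `^ n%:R^-1) :
  (0 < k < n)%N -> 0 < V -> 0 < m ->
  (b / a) ^- k * m + V * (n%:R / (n - k)%:R) * (b / a) ^+ (n - k) =
  n%:R / (n - k)%:R * V `^ (k%:R / n%:R) * m `^ ((n - k)%:R / n%:R) +
  (b / a) ^- k * ((b / a) ^+ n * V).
Proof.
move=> kn V0 m0; rewrite !powR_frac ?ltW// -/a -/b.
have n0 : (0 < n)%N by lia.
have a0 : a != 0 by rewrite gt_eqF// powR_gt0.
have b0 : b != 0 by rewrite gt_eqF// powR_gt0.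
have -> : V = a ^+ n by rewrite powR_invK// ltW.
have -> : m = b ^+ n by rewrite powR_invK// ltW.
have nk : (n - k)%:R != 0 :> R by rewrite pnatr_eq0; lia.
have [p E] : exists p, (n = k + p)%N by exists (n - k)%N; lia.
have pE : (n - k)%N = p by lia.
rewrite pE in nk *.
have En (x : R) : x ^+ n = x ^+ k * x ^+ p by rewrite E exprD.
rewrite !En !exprMn !exprVn.
by field; rewrite nk /= !expf_neq0.
Qed.

Local Open Scope ereal_scope.
Variables (n k : nat) (D : set 'rV[R]_n).
Hypotheses (kn : (0 < k < n)%N) (sD : star_body D).

Let w (x : 'rV[R]_n) : R := (Defs.minkowski D x ^- k)%R.

Let w0 x : (0 <= w x)%R.
Proof. by rewrite invr_ge0 exprn_ge0// minkowski_ge0. Qed.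

Let mw : measurable_fun setT w.
Proof. by apply: measurable_exprV; exact: measurable_minkowski. Qed.

Let VE : lebesgue D = (fine (lebesgue D))%:E.
Proof. by rewrite fineK// ge0_fin_numE ?measure_ge0// lebesgue_star_body_lty. Qed.

Let V0 : (0 < fine (lebesgue D))%R.
Proof. by rewrite fine_gt0// lebesgue_star_body_gt0// lebesgue_star_body_lty. Qed.

(** [(g - 1_(tD)) (||x||_D^(-k) - t^(-k)) <= 0] at every [x <> 0], integrated.  As the
integrals may be infinite, the negative terms are moved to the other side. *)
Let bathtub_at (g : 'rV[R]_n -> R) (t : R) :
  measurable_fun setT g -> (forall x, (0 <= g x <= 1)%R) -> (0 < t)%R ->
  \int[@lebesgue R n]_x (g x * w x)%:E + (t ^- k * (t ^+ n * fine (lebesgue D)))%:E <=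
  (t ^- k)%:E * \int[@lebesgue R n]_x (g x)%:E +
  (fine (lebesgue D) * (n%:R / (n - k)%:R) * t ^+ (n - k))%:E.
Proof.
move=> mg g01 t0.
have g0 x : (0 <= g x)%R by have /andP[] := g01 x.
pose B := [set x | (Defs.minkowski D x <= t)%R].
have BE : lebesgue B = (t ^+ n * fine (lebesgue D))%:E.
  by rewrite lebesgue_minkowski_le// VE EFinM.
have mB : measurable B.
  rewrite (_ : B = Defs.minkowski D @^-1` `]-oo, t]%classic).
    by apply: measurable_preimage; [exact: measurable_minkowski|exact: measurable_itv].
  by apply/seteqP; split => x; rewrite /= in_itv.
have n0 : (0 < n)%N by lia.
have tk0 : (0 <= t ^- k)%R by rewrite invr_ge0 exprn_ge0// ltW.
have mB1 : measurable_fun setT (\1_B : 'rV[R]_n -> R) by exact: measurable_indic.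
have -> : (fine (lebesgue D) * (n%:R / (n - k)%:R) * t ^+ (n - k))%:E =
    \int[@lebesgue R n]_x (w x * \1_B x)%:E.
  rewrite -(@radial_integral_range R _ _ (@lebesgue R n) (Defs.minkowski D)
    (fine (lebesgue D)) t n k)//.
  - rewrite integral_mkcond; apply: eq_integral => x _.
    by rewrite patchE indicE; case: ifPn => xB; rewrite ?mulr1 ?mulr0.
  - exact: measurable_minkowski.
  - by move=> x; exact: minkowski_ge0.
  - move=> s /andP[s0 _]; rewrite [LHS](lebesgue_minkowski_le sD s0).
    by rewrite [in LHS]VE -EFinM mulrC.
have -> : (t ^- k * (t ^+ n * fine (lebesgue D)))%:E =
    \int[@lebesgue R n]_x (t ^- k * \1_B x)%:E.
  under eq_integral do rewrite EFinM.
  rewrite ge0_integralZl//; last exact/measurable_EFinP.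
  by rewrite integral_indic// setIT [X in _ * X]BE -EFinM.
rewrite -ge0_integralZl//; last 2 first.
- exact/measurable_EFinP.
- by move=> x _; rewrite lee_fin.
rewrite -!ge0_integralD//.
- apply: ae_ge0_le_integral => //.
  + by move=> x _; rewrite -EFinD lee_fin addr_ge0// mulr_ge0.
  + apply: emeasurable_funD; apply/measurable_EFinP; exact: measurable_funM.
  + by move=> x _; rewrite -EFinM -EFinD lee_fin addr_ge0// mulr_ge0.
  + apply: emeasurable_funD; last by apply/measurable_EFinP; exact: measurable_funM.
    by apply: measurable_funeM; exact/measurable_EFinP.
  exists [set 0%R]; split; [exact: measurable_singleton|exact: lebesgue_singleton0|].
  move=> x /=; apply: contra_notP => /eqP x0 _.
  rewrite -EFinM -!EFinD lee_fin indicE.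
  have px := minkowski_gt0 sD x0; have /andP[gx0 gx1] := g01 x.
  have [xB|xB] := boolP (x \in B).
    rewrite !mulr1; have : (t ^- k <= w x)%R.
      rewrite inE /B/= in xB.
      by rewrite lef_pV2 ?posrE ?exprn_gt0// lerXn2r// ?nnegrE ltW.
    nra.
  rewrite !mulr0 !addr0 mulrC ler_wpM2r//.
  have xt : (t <= Defs.minkowski D x)%R.
    by move: xB; rewrite notin_setE /B/= => /negP; rewrite -ltNge => /ltW.
  by rewrite lef_pV2 ?posrE ?exprn_gt0// lerXn2r// ?nnegrE// ltW.
- by move=> x _; rewrite -EFinM lee_fin mulr_ge0.
- by apply: measurable_funeM; exact/measurable_EFinP.
- by move=> x _; rewrite lee_fin mulr_ge0.
- by apply/measurable_EFinP; exact: measurable_funM.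
- by move=> x _; rewrite lee_fin mulr_ge0.
- by apply/measurable_EFinP; exact: measurable_funM.
- by move=> x _; rewrite lee_fin mulr_ge0.
- by apply/measurable_EFinP; exact: measurable_funM.
Qed.

(** The extremal density is the indicator of the dilate of [D] of the same mass;
[bathtub_at] for its ratio is the inequality. *)
Lemma bathtub (g : 'rV[R]_n -> R) :
  measurable_fun setT g -> (forall x, (0 <= g x <= 1)%R) ->
  \int[@lebesgue R n]_x (g x)%:E < +oo ->
  \int[@lebesgue R n]_x (g x * w x)%:E <=
  (n%:R / (n - k)%:R)%:E * lebesgue D `^ (k%:R / n%:R) *
  (\int[@lebesgue R n]_x (g x)%:E) `^ ((n - k)%:R / n%:R).
Proof.
move=> mg g01 goo.
have g0 x : (0 <= g x)%R by have /andP[] := g01 x.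
have mE : \int[@lebesgue R n]_x (g x)%:E = (fine (\int[@lebesgue R n]_x (g x)%:E))%:E.
  by rewrite fineK// ge0_fin_numE// integral_ge0// => x _; rewrite lee_fin.
set m := fine _ in mE.
have m0 : (0 <= m)%R.
  by rewrite fine_ge0// integral_ge0// => x _; rewrite lee_fin.
rewrite mE VE !poweR_EFin -!EFinM.
move: m0; rewrite le_eqVlt => /predU1P[m0|m0].
  rewrite -m0 in mE.
  have g0' : forall x, setT x -> 0 <= (g x)%:E by move=> x _; rewrite lee_fin.
  have mgE : measurable_fun setT (EFin \o g) by exact/measurable_EFinP.
  have ng := ge0_integral_eq0 measurableT mgE g0' mE.
  rewrite [leLHS](_ : _ = 0).
    by rewrite lee_fin mulr_ge0 ?powR_ge0// mulr_ge0 ?powR_ge0// divr_ge0.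
  rewrite -[RHS](@integral0 _ _ R (@lebesgue R n) setT).
  apply: ge0_ae_eq_integral => //.
  - by apply/measurable_EFinP; exact: measurable_funM.
  - by move=> x _; rewrite lee_fin mulr_ge0.
  apply: negligibleS ng => x /= h; split => //; apply: contra_not_neq h => -[->] _.
  by rewrite mul0r.
have t0 : (0 < m `^ n%:R^-1 / fine (lebesgue D) `^ n%:R^-1)%R by rewrite divr_gt0// powR_gt0.
have := bathtub_at mg g01 t0.
rewrite mE -EFinM -EFinD bathtub_optimum// EFinD.
by rewrite leeD2rE.
Qed.

End bathtub.

(** * Comparison of the measures *)

Section sandwich.
Context d (T : measurableType d) {R : realType}.
Local Open Scope ereal_scope.

(** The integral of a non-negative function is a supremum over the simple
functions below it, hence monotone without measurability: the restrictions of
[f] and [g] to a given subspace may fail to be measurable. *)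
Lemma le_integral_nonmeasurable (mu : {measure set T -> \bar R}) (A : set T)
    (f g : T -> \bar R) :
  (forall x, A x -> 0 <= f x) -> (forall x, A x -> f x <= g x) ->
  \int[mu]_(x in A) f x <= \int[mu]_(x in A) g x.
Proof.
move=> f0 fg.
have g0 x : A x -> 0 <= g x by move=> Ax; exact: le_trans (f0 x Ax) (fg x Ax).
rewrite !ge0_integralE//; apply: le_ereal_sup => _ [h hf <-]; exists h => // x.
apply: le_trans (hf x) _; rewrite !patchE; case: ifPn => //.
by rewrite inE => /fg.
Qed.

(** [f] equals a Borel function off a Borel null set [N], which can be enlarged
to contain a given null set; on [N] the bounds are 0 and [+oo].  The inequalities
hold at every point, so that they pass to sections, of which [N] may fill a set
of positive measure. *)
Lemma borel_sandwich (mu : {measure set T -> \bar R}) (f f0 : T -> R) (E : set T) :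
  (forall x, 0 <= f x)%R -> measurable_fun setT f0 ->
  {ae mu, forall x, f x = f0 x} -> mu.-negligible E ->
  exists N (lo : T -> R) (up : T -> \bar R),
    [/\ measurable N /\ mu N = 0, E `<=` N,
        measurable_fun setT lo /\ measurable_fun setT up,
        (forall x, (0 <= lo x)%R) /\ (forall x, (lo x)%:E <= (f x)%:E <= up x) &
        (forall x, N x -> lo x = 0%R) /\ (forall x, ~ N x -> lo x = f x /\ up x = (lo x)%:E)].
Proof.
move=> fge0 mf0 ff0 nE.
have [N [mN N0 sN]] := negligibleU ff0 nE.
have fN x : ~ N x -> f x = f0 x.
  by move=> Nx; apply: contrapT => h; apply: Nx; apply: sN; left.
exists N, (f0 \_ (~` N)), (fun x => if x \in N then +oo else (f0 x)%:E).
have mNc : measurable (~` N) by exact: measurableC.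
split => //.
- by move=> x Ex; apply: sN; right.
- split; first by apply: (measurable_restrictT _ mNc).1; exact: measurable_funTS.
  apply: measurable_fun_ifT => //; last exact/measurable_EFinP.
  apply: (measurable_fun_bool true); rewrite setTI.
  rewrite (_ : _ @^-1` _ = N)//.
  by apply/seteqP; split => x; [move/set_mem|move/mem_set].
- have lo x : (f0 \_ (~` N)) x = if x \in N then 0%R else f x.
    rewrite patchE in_setC; case: (boolP (x \in N)) => //= xN.
    by rewrite fN//; move: xN; rewrite notin_setE.
  split => x; rewrite lo; first by case: ifP.
  case: (boolP (x \in N)) => xN; first by rewrite lee_fin fge0 leey.
  by rewrite fN ?lexx//; move: xN; rewrite notin_setE.
- split => x Nx; rewrite patchE in_setC; first by rewrite mem_set.
  by rewrite memNset//= fN.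
Qed.

End sandwich.

Section volume_comparison.
Context {R : realType}.
Local Open Scope ereal_scope.

Lemma expye j : (0 < j)%N -> (+oo : \bar R) ^+ j = +oo.
Proof. by case: j => // j _; elim: j => // j IHj; rewrite expeS IHj mulyy. Qed.

Lemma Lnorm_oo_le d (T : measurableType d) (mu : {measure set T -> \bar R}) (g : T -> R) :
  0 < mu setT -> 'N[mu]_+oo[EFin \o g] = 1 -> mu.-negligible [set x | (1 < g x)%R].
Proof.
move=> muT; rewrite unlock muT => g1.
have := ess_sup_ge mu (abse \o (EFin \o g)); rewrite g1.
move=> [N [mN N0 sN]]; exists N; split => // x /= gx; apply: sN => /=.
rewrite lee_fin => h; move: gx; rewrite ltNge => /negP; apply.
exact: le_trans (ler_norm _) h.
Qed.

Variables (n k : nat) (K L : set 'rV[R]_n) (f g : 'rV[R]_n -> R).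
Hypotheses (sK : star_body K) (sL : star_body L) (kn : (0 < k < n)%N).
Hypotheses (f0 : forall x, (0 <= f x)%R) (g0 : forall x, (0 <= g x)%R).
Hypotheses (lf : locally_integrable_rV f) (lg : locally_integrable_rV g).
Hypothesis g1 : 'N[@lebesgue R n]_+oo [EFin \o g] = 1.
Hypothesis fg : forall H : grass R n k, density_section f K H <= density_section g L H.

Let mu : {measure set 'rV[R]_n -> \bar R} := @lebesgue R n.

Let mK : measurable K. Proof. exact: measurable_star_body. Qed.
Let mL : measurable L. Proof. exact: measurable_star_body. Qed.

Let muT : 0 < mu setT.
Proof.
apply: (@lt_le_trans _ _ (mu K)); first exact: lebesgue_star_body_gt0.
by apply: le_lebesgue.
Qed.

(** Off [N] the two bounds agree, so their integrals do. *)
Let sandwich_integral (A N : set 'rV[R]_n) (h lo : 'rV[R]_n -> R)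
    (up : 'rV[R]_n -> \bar R) : measurable A ->
  measurable N /\ mu N = 0 ->
  measurable_fun setT lo /\ measurable_fun setT up ->
  (forall x, (0 <= lo x)%R) /\ (forall x, (lo x)%:E <= (h x)%:E <= up x) ->
  (forall x, ~ N x -> lo x = h x /\ up x = (lo x)%:E) ->
  \int[mu]_(x in A) (lo x)%:E = \int[mu]_(x in A) (h x)%:E.
Proof.
move=> mA [mN N0] [mlo mup] [lo0 loup] loN.
have h0 x : 0 <= (h x)%:E.
  by apply: (@le_trans _ _ (lo x)%:E); [rewrite lee_fin|have /andP[] := loup x].
have up0 x : 0 <= up x.
  by apply: (le_trans (h0 x)); have /andP[] := loup x.
apply/eqP; rewrite eq_le; apply/andP; split.
  apply: le_integral_nonmeasurable => x _; first by rewrite lee_fin.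
  by have /andP[] := loup x.
apply: (@le_trans _ _ (\int[mu]_(x in A) up x)).
  apply: le_integral_nonmeasurable => x _ //.
  by have /andP[] := loup x.
rewrite (@ge0_ae_eq_integral _ _ _ mu A up (EFin \o lo))//.
- exact: measurable_funTS.
- by apply: measurable_funTS; exact/measurable_EFinP.
- by move=> x _; rewrite lee_fin.
exists N; split => // x /=; apply: contra_notP => Nx _.
by have [_ ->] := loN x Nx.
Qed.

(** The bound for a single body of the class, from the chain of inequalities
through the two integrals over the Grassmannian. *)
Let bound_one (D : set 'rV[R]_n) : gen_intersection_body k D -> K `<=` D ->
  density_measure f K <= (n%:R / (n - k)%:R)%:E * lebesgue D `^ (k%:R / n%:R) *
    density_measure g L `^ ((n - k)%:R / n%:R).
Proof.
move=> [sD _ [nu nuD]] KD.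
have [[fB mfB ffB] _] := lf; have [[gB mgB ggB] gloc] := lg.
have [Nf [lof [upf [Nf0 _ mf1 f1 Nf1]]]] := borel_sandwich f0 mfB ffB (negligible_set0 mu).
have [Ng [log [upg [Ng0 gN mg1 g2 Ng1]]]] := borel_sandwich g0 mgB ggB (Lnorm_oo_le muT g1).
have [aK aK0 Ka] := star_body_euball sK.
have [aL aL0 La] := star_body_euball sL.
pose a := Num.max aK aL.
have KN : K `<=` euball a.
  by move=> x /Ka xa; rewrite /euball/= le_max; apply/orP; left.
have LN : L `<=` euball a.
  by move=> x /La xa; rewrite /euball/= le_max; apply/orP; right.
pose w x : R := (Defs.minkowski D x ^- k)%R.
have w0 x : (0 <= w x)%R by rewrite invr_ge0 exprn_ge0// minkowski_ge0.
have mw : measurable_fun setT w by apply: measurable_exprV; exact: measurable_minkowski.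
have mlof : measurable_fun setT (EFin \o lof) by apply/measurable_EFinP; exact: mf1.1.
have lof0 x : 0 <= (EFin \o lof) x by rewrite lee_fin; exact: f1.1.
have upg0 x : 0 <= upg x.
  apply: (@le_trans _ _ (g x)%:E); first by rewrite lee_fin.
  by have /andP[] := g2.2 x.
have [mfH fH] := gen_intersection_body_integral kn sD nuD mK KN mlof lof0.
have [mgH gH] := gen_intersection_body_integral kn sD nuD mL LN mg1.2 upg0.
rewrite /density_measure -(sandwich_integral mK Nf0 mf1 f1 Nf1.2).
apply: (@le_trans _ _ (\int[mu]_(x in K) ((EFin \o lof) x * (w x)%:E))).
  apply: ae_ge0_le_integral => //.
  - by move=> x _; exact: lof0.
  - exact: measurable_funTS.
  - by move=> x _; rewrite mule_ge0// lee_fin.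
  - by apply: measurable_funTS; apply: emeasurable_funM => //; exact/measurable_EFinP.
  exists [set 0%R]; split; [exact: measurable_singleton| |].
    by apply: lebesgue_singleton0; lia.
  move=> x /=; apply: contra_notP => /eqP x0 Kx; rewrite -EFinM lee_fin.
  have px := minkowski_gt0 sD x0; have p1 := minkowski_le1 (KD _ Kx).
  have w1 : (1 <= w x)%R.
    rewrite /w -[leLHS]invr1 lef_pV2 ?posrE ?exprn_gt0//.
    by apply: exprn_ile1 => //; exact: ltW.
  by rewrite ler_peMr// f1.1.
rewrite fH; apply: (@le_trans _ _ (\int[nu]_H grass_integral H L upg)).
  apply: ge0_le_integral => //.
  - by move=> H _; apply: integral_ge0 => y _; exact: lof0.
  move=> H _; apply: (@le_trans _ _ (density_section f K H)).
    apply: le_integral_nonmeasurable => y _; first exact: lof0.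
    by have /andP[] := f1.2 (y *m grass_basis H).
  apply: le_trans (fg H) _.
  apply: le_integral_nonmeasurable => y _; first by rewrite lee_fin.
  by have /andP[] := g2.2 (y *m grass_basis H).
rewrite -gH.
(* [log <= 1] everywhere, since the null set on which [log] is 0 contains the
   points where [g > 1]; so the bathtub principle applies to [h]. *)
pose h := log \_ L.
have mh : measurable_fun setT h.
  by apply: (measurable_restrictT _ mL).1; apply: measurable_funTS; exact: mg1.1.
have h01 x : (0 <= h x <= 1)%R.
  rewrite /h patchE; case: ifPn => _; last by rewrite lexx ler01.
  rewrite g2.1/=; have [Nx|Nx] := pselect (Ng x); first by rewrite Ng1.1.
  rewrite (Ng1.2 _ Nx).1 leNgt; apply/negP => gx; apply: Nx; exact: gN.
have hE : \int[mu]_x (h x)%:E = \int[mu]_(x in L) (g x)%:E.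
  rewrite -(sandwich_integral mL Ng0 mg1 g2 Ng1.2) [RHS]integral_mkcond.
  by apply: eq_integral => x _; rewrite /h !patchE; case: ifPn.
have cL : compact L.
  by case: sL => cL bL _ _ _; exact: bounded_closed_compact.
have hoo : \int[mu]_x (h x)%:E < +oo.
  rewrite hE; apply: le_lt_trans (gloc L cL).
  by apply: le_integral_nonmeasurable => x _; rewrite lee_fin// ler_norm.
have := bathtub kn sD mh h01 hoo; rewrite hE; apply: le_trans.
rewrite [leRHS](_ : _ = \int[mu]_(x in L) ((log x)%:E * (w x)%:E)).
  rewrite (@ge0_ae_eq_integral _ _ _ mu L _ (fun x => (log x)%:E * (w x)%:E))//.
  - apply: measurable_funTS; apply: emeasurable_funM; first exact: mg1.2.
    exact/measurable_EFinP.
  - apply: measurable_funTS; apply: emeasurable_funM; apply/measurable_EFinP.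
      exact: mg1.1.
    exact: mw.
  - by move=> x _; rewrite mule_ge0// lee_fin; exact: (w0 x).
  - by move=> x _; rewrite mule_ge0// lee_fin//; exact: g2.1.
  have [mNg Ng00] := Ng0; exists Ng; split => // x /=; apply: contra_notP => Nx _.
  by have [_ ->] := Ng1.2 x Nx.
rewrite [RHS]integral_mkcond; apply: eq_integral => x _; rewrite /h !patchE.
case: ifPn => _; first by rewrite EFinM.
by rewrite mul0r.
Qed.

(** The upper bound of [g] vanishes on [L] off a null set [Z]; in a subspace where
[Z] is null, the lower bound of [f] vanishes almost everywhere on [K], that is,
the set [Y] of its non-zeros is null there. *)
Let null_case : density_measure g L = 0 -> density_measure f K = 0.
Proof.
have [[fB mfB ffB] _] := lf; have [[gB mgB ggB] gloc] := lg.
have [Nf [lof [upf [Nf0 _ mf1 f1 Nf1]]]] := borel_sandwich f0 mfB ffB (negligible_set0 mu).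
have [Ng [log [upg [Ng0 gN mg1 g2 Ng1]]]] := borel_sandwich g0 mgB ggB (negligible_set0 mu).
rewrite /density_measure -(sandwich_integral mK Nf0 mf1 f1 Nf1.2).
rewrite -(sandwich_integral mL Ng0 mg1 g2 Ng1.2) => log0.
have upg0 x : 0 <= upg x.
  apply: (@le_trans _ _ (g x)%:E); first by rewrite lee_fin.
  by have /andP[] := g2.2 x.
have mlog : measurable_fun setT (EFin \o log) by apply/measurable_EFinP; exact: mg1.1.
have mlof : measurable_fun setT (EFin \o lof) by apply/measurable_EFinP; exact: mf1.1.
have upgI : \int[mu]_(x in L) upg x = 0.
  rewrite -[RHS]log0; apply: ge0_ae_eq_integral => //.
  - by apply: measurable_funTS; exact: mg1.2.
  - exact: measurable_funTS.
  - by move=> x _; rewrite lee_fin; exact: g2.1.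
  have [mNg Ng00] := Ng0; exists Ng; split => // x /=; apply: contra_notP => Nx _.
  by have [_ ->] := Ng1.2 x Nx.
have mupL : measurable_fun L upg by apply: measurable_funTS; exact: mg1.2.
have [Z [mZ Z0 LZ]] := ge0_integral_eq0 mL mupL (fun x _ => upg0 x) upgI.
pose Y := K `&` [set x | lof x != 0%R].
have mY : measurable Y.
  apply: measurableI => //.
  rewrite (_ : [set _ | _] = lof @^-1` [set~ 0%R]).
    apply: measurable_preimage; first exact: mf1.1.
    by apply: measurableC; exact: measurable_set1.
  by apply/seteqP; split => x /= /eqP.
have Y0 : lebesgue Y = 0.
  apply: (null_by_sections kn mZ mY Z0) => H HZ.
  have HB := measurable_mulmx (grass_basis H).
  have fH0 : density_section f K H <= 0.
    apply: (le_trans (fg H)); apply: (@le_trans _ _ (grass_integral H L upg)).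
      apply: le_integral_nonmeasurable => y _; first by rewrite lee_fin.
      by have /andP[] := g2.2 (y *m grass_basis H).
    rewrite /grass_integral.
    have mHL : measurable [set y : 'rV[R]_(n - k) | L (y *m grass_basis H)].
      exact: (measurable_preimage HB mL).
    rewrite (@ge0_ae_eq_integral _ _ _ (@lebesgue R (n - k)) _ _ (fun=> 0))//.
    - by rewrite integral0.
    - by apply: measurable_funTS; exact: measurableT_comp mg1.2 HB.
    exists (mxmap (grass_basis H) @^-1` Z); split => //.
      by apply: measurable_preimage.
    move=> y /= /not_implyP[Ly /eqP uy]; apply: LZ; split => //; exact: Ly.
  have lH0 : \int[@lebesgue R (n - k)]_(y in [set y | K (y *m grass_basis H)])
      (EFin \o lof) (y *m grass_basis H)%R = 0.
    apply/eqP; rewrite eq_le; apply/andP; split; last first.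
      by apply: integral_ge0 => y _; rewrite lee_fin; exact: f1.1.
    apply: le_trans fH0; apply: le_integral_nonmeasurable => y _.
      by rewrite lee_fin; exact: f1.1.
    by have /andP[] := f1.2 (y *m grass_basis H).
  have mHK : measurable [set y : 'rV[R]_(n - k) | K (y *m grass_basis H)].
    exact: (measurable_preimage HB mK).
  have mlH : measurable_fun [set y : 'rV[R]_(n - k) | K (y *m grass_basis H)]
      (fun y => (EFin \o lof) (y *m grass_basis H)%R).
    by apply: measurable_funTS; exact: measurableT_comp mlof HB.
  have lofH0 (y : 'rV[R]_(n - k)) : [set y | K (y *m grass_basis H)] y ->
      0 <= (EFin \o lof) (y *m grass_basis H)%R.
    by move=> _; rewrite lee_fin; exact: f1.1.
  have [M [mM M0 sM]] := ge0_integral_eq0 mHK mlH lofH0 lH0.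
  apply/eqP; rewrite eq_le measure_ge0 andbT -M0; apply: le_lebesgue => //.
    by apply: measurable_preimage.
transitivity (\int[mu]_(x in K) (cst 0 x : \bar R)); last exact: integral0.
apply: ge0_ae_eq_integral => //.
- exact: measurable_funTS.
- by move=> x _; rewrite lee_fin; exact: f1.1.
exists Y; split => // x /= /not_implyP[Kx lx]; split => //=.
by apply/eqP => lx0; apply: lx; rewrite lx0.
Qed.

Let VK : lebesgue K = (fine (lebesgue K))%:E.
Proof. by rewrite fineK// ge0_fin_numE ?measure_ge0// lebesgue_star_body_lty. Qed.

Let VK0 : (0 < fine (lebesgue K))%R.
Proof. by rewrite fine_gt0// lebesgue_star_body_gt0// lebesgue_star_body_lty. Qed.

Let gL_fin : density_measure g L = (fine (density_measure g L))%:E.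
Proof.
have [_ gloc] := lg.
rewrite fineK// ge0_fin_numE; last by apply: integral_ge0 => x _; rewrite lee_fin.
have cL : compact L by case: sL => cL bL _ _ _; exact: bounded_closed_compact.
apply: le_lt_trans (gloc L cL).
by apply: le_integral_nonmeasurable => x _; rewrite lee_fin// ler_norm.
Qed.

Let ratio (D : set 'rV[R]_n) : R := (fine (lebesgue D) / fine (lebesgue K)) `^ n%:R^-1.

Let ratioE (D : set 'rV[R]_n) : star_body D ->
  (lebesgue D / lebesgue K) `^ n%:R^-1 = (ratio D)%:E.
Proof.
move=> sD.
have VD : lebesgue D = (fine (lebesgue D))%:E.
  by rewrite fineK// ge0_fin_numE ?measure_ge0// lebesgue_star_body_lty.
by rewrite VD VK inver gt_eqF//= -EFinM poweR_EFin.
Qed.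

Let const : R := (n%:R / (n - k)%:R * fine (lebesgue K) `^ (k%:R / n%:R) *
  fine (density_measure g L) `^ ((n - k)%:R / n%:R))%R.

Let bound_ratio D : gen_intersection_body k D -> K `<=` D ->
  density_measure f K <= (const * ratio D ^+ k)%:E.
Proof.
move=> gD KD; apply: le_trans (bound_one gD KD) _.
have [sD _ _] := gD.
have VD : lebesgue D = (fine (lebesgue D))%:E.
  by rewrite fineK// ge0_fin_numE ?measure_ge0// lebesgue_star_body_lty.
rewrite VD gL_fin !poweR_EFin -!EFinM lee_fin.
have VD0 : (0 <= fine (lebesgue D))%R by rewrite fine_ge0// measure_ge0.
have E : (fine (lebesgue D) `^ (k%:R / n%:R) =
    fine (lebesgue K) `^ (k%:R / n%:R) * ratio D ^+ k)%R.
  rewrite /ratio -powR_frac ?divr_ge0// ?(ltW VK0)// -powRM ?divr_ge0 ?(ltW VK0)//.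
  by rewrite mulrCA divff ?mulr1// gt_eqF.
by rewrite E /const; set x := (_ `^ _)%R; set y := (_ `^ _)%R; lra.
Qed.

(** If [K] lies in some body of the class, the bound for each body says that
[(|D| / |K|)^(1/n)] is at least the [k]-th root of [mu_1(K)] over a constant that
does not depend on [D], and this passes to the infimum.  If not, the right-hand side is [+oo] unless
[mu_2(L) = 0]. *)
Lemma volume_comparison :
  density_measure f K <=
     dovr k K ^+ k * (n%:R / (n - k)%:R)%:E
     * lebesgue K `^ (k%:R / n%:R)
     * density_measure g L `^ ((n - k)%:R / n%:R).
Proof.
have n0 : (0 < n)%N by lia.
have k0 : (0 < k)%N by lia.
have nk0 : (0 < (n - k)%:R :> R)%R by rewrite ltr0n; lia.
have m0 : (0 <= fine (density_measure g L))%R.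
  by rewrite fine_ge0// integral_ge0// => x _; rewrite lee_fin.
have c0 : (0 <= const)%R by rewrite /const !mulr_ge0 ?powR_ge0// invr_ge0 ltW.
set d := dovr k K.
have dlb x : (forall D, gen_intersection_body k D -> K `<=` D -> x <= (ratio D)%:E) -> x <= d.
  move=> h; apply: le_ereal_inf_tmp => _ [D [KD gD] <-].
  by have [sD _ _] := gD; rewrite (ratioE sD); exact: h.
have d0 : 0 <= d by apply: dlb => D _ _; rewrite lee_fin powR_ge0.
have RE (r : R) : d = r%:E -> d ^+ k * (n%:R / (n - k)%:R)%:E
     * lebesgue K `^ (k%:R / n%:R) * density_measure g L `^ ((n - k)%:R / n%:R) =
     (const * r ^+ k)%:E.
  move=> ->; rewrite VK gL_fin !poweR_EFin -EFin_expe -!EFinM /const; congr EFin.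
  by rewrite -!mulrA mulrC -!mulrA.
have [[D [KD gD]]|nD] := pselect (exists D, K `<=` D /\ gen_intersection_body k D).
  have [sD _ _] := gD.
  have dD : d <= (ratio D)%:E.
    by rewrite -ratioE//; apply: ereal_inf_lbound; exists D.
  have dfin : d = (fine d)%:E.
    by rewrite fineK// ge0_fin_numE// (le_lt_trans dD)// ltry.
  rewrite (RE _ dfin).
  have a_fin : density_measure f K = (fine (density_measure f K))%:E.
    rewrite fineK// ge0_fin_numE.
      by rewrite (le_lt_trans (bound_ratio gD KD))// ltry.
    by apply: integral_ge0 => x _; rewrite lee_fin.
  set a := fine _ in a_fin.
  have a0 : (0 <= a)%R.
    by rewrite fine_ge0//; apply: integral_ge0 => x _; rewrite lee_fin.
  move: c0; rewrite le_eqVlt => /predU1P[c0|c0].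
    by have := bound_ratio gD KD; rewrite -c0 !mul0r.
  pose r := ((a / const) `^ k%:R^-1)%R.
  have ac0 : (0 <= a / const)%R by rewrite divr_ge0// ltW.
  have rd : r%:E <= d.
    apply: dlb => D' gD' KD'; rewrite lee_fin.
    rewrite -(@ler_pXn2r _ k)// ?nnegrE ?powR_ge0// powR_invK// ler_pdivrMr// mulrC.
    by have := bound_ratio gD' KD'; rewrite a_fin lee_fin.
  rewrite a_fin lee_fin mulrC -ler_pdivrMr//.
  rewrite -(powR_invK k0 ac0) -/r; apply: lerXn2r; rewrite ?nnegrE ?powR_ge0//.
    by rewrite fine_ge0.
  by rewrite -lee_fin -dfin.
have dy : d = +oo.
  have S0 : [set D | K `<=` D /\ gen_intersection_body k D] = set0.
    by apply/seteqP; split => // D [KD gD]; apply: nD; exists D.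
  by rewrite /d /dovr S0 image_set0 ereal_inf0.
have [gL0|gL0] := eqVneq (density_measure g L) 0.
  by rewrite null_case// gL0 poweR0r ?mule0// gt_eqF// divr_gt0// ltr0n.
have gLpos : 0 < density_measure g L.
  by rewrite lt_neqAle eq_sym gL0/=; apply: integral_ge0 => x _; rewrite lee_fin.
rewrite dy expye// gt0_mulye; last by rewrite lte_fin divr_gt0// ltr0n.
rewrite gt0_mulye; last by apply: poweR_gt0; exact: lebesgue_star_body_gt0.
by rewrite gt0_mulye ?leey//; exact: poweR_gt0.
Qed.

End volume_comparison.

Unset Implicit Arguments.

Theorem theorem1 (R : realType) (n k : nat) (K L : set 'rV[R]_n)
    (f g : 'rV[R]_n -> R) :
  star_body K -> star_body L ->
  (0 < k < n)%N ->
  (forall x, 0 <= f x) -> (forall x, 0 <= g x) ->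
  locally_integrable_rV f -> locally_integrable_rV g ->
  ('N[@lebesgue R n]_+oo [EFin \o g] = 1)%E -> g 0 = 1 ->
  (forall H : grass R n k,
     (density_section f K H <= density_section g L H)%E) ->
  (density_measure f K <=
     dovr k K ^+ k * (n%:R / (n - k)%:R)%:E
     * @lebesgue R n K `^ (k%:R / n%:R)
     * density_measure g L `^ ((n - k)%:R / n%:R))%E.
Proof.
move=> sK sL kn f0 g0 lf lg g1 _ fg.
exact: volume_comparison.
Qed.
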